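(* Let $K$ be a field, let $n,m$ be positive integers with $n\ge 4$ and $m\le n-1$; if $K=\mathrm{GF}(3)$, assume moreover $n\ge 5$. Let $\Omega$ and $\Psi$ be $(m,n-m)$-cyclic conjugacy classes of $\mathrm{GL}(n,K)$. Then the product $\Omega\Psi=\{XY : X\in\Omega,\ Y\in\Psi\}$ contains all nonscalar matrices $M\in\mathrm{GL}(n,K)$ with $\det M=\det\Omega\Psi$.
   Context: A square matrix over $K$ is cyclic if its minimal polynomial equals its characteristic polynomial. A cyclic square matrix $C$ over $K$ (and its conjugacy class) is called $(m,k)$-cyclic, where $m,k\ge 1$, if $C$ is similar over $K$ to a block diagonal matrix $A\oplus B$ with $A$ of size $m\times m$ and $B$ of size $k\times k$. For conjugacy classes $\Omega,\Psi$, $\det\Omega$ denotes the common determinant of the elements of $\Omega$, and $\det\Omega\Psi=\det\Omega\cdot\det\Psi$. A matrix is scalar if it is $\lambda \mathrm{I}_n$ for some $\lambda\in K$. *)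

(* Defs.v *)
From mathcomp Require Import all_boot all_algebra.
From mathcomp Require Import classical_sets.

Set Implicit Arguments.
Unset Strict Implicit.
Unset Printing Implicit Defensive.

Import GRing.Theory.
Local Open Scope ring_scope.
Local Open Scope classical_set_scope.

(* The size is of the form [n.+1] because [mxminpoly] is only defined for
   nonempty matrices. *)
Definition cyclic_mx (K : fieldType) (n : nat) (C : 'M[K]_n.+1) : Prop :=
  mxminpoly C = char_poly C.

(* [castmx] only transports the type along [m + k = n.+1]. *)
Definition mk_cyclic_mx (K : fieldType) (n m k : nat) (C : 'M[K]_n.+1) : Prop :=
  [/\ (1 <= m)%N, (1 <= k)%N, cyclic_mx C &
    exists (e : (m + k = n.+1)%N) (A : 'M[K]_m) (B : 'M[K]_k),
      similar_in unitmx C (castmx (e, e) (block_mx A 0 0 B))].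

Definition GL_conj_class (K : fieldType) (n : nat) (Omega : set 'M[K]_n) : Prop :=
  exists2 C : 'M[K]_n, C \in unitmx & Omega = [set X | similar_in unitmx C X].

Definition mk_cyclic_class (K : fieldType) (n m k : nat)
    (Omega : set 'M[K]_n.+1) : Prop :=
  GL_conj_class Omega /\ forall C, Omega C -> mk_cyclic_mx m k C.

(* [d] is the common determinant of the elements of the class [Omega]; it is
   unique, since a conjugacy class is nonempty. *)
Definition common_det (K : fieldType) (n : nat) (Omega : set 'M[K]_n) (d : K) :
    Prop :=
  forall X, Omega X -> \det X = d.

Definition class_mul (K : fieldType) (n : nat) (Omega Psi : set 'M[K]_n) :
    set 'M[K]_n :=
  [set X *m Y | X in Omega & Y in Psi].

(* Main.v *)
(* Call [M] LU-split into [P] and [N] when [M] is similar to a block matrix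
   [A, B; C, N] with Schur complement [P = A - B N^-1 C].  If [P] is a product of
   cyclic matrices with characteristic polynomials [a], [a'] and [N] is one with
   [b], [b'], where [a, b] and [a', b'] are coprime, then [M] is a product of
   cyclic matrices with characteristic polynomials [a b] and [a' b'].  Suitable
   [P] and [N] come from pole placement: a block triangular matrix with given
   diagonal blocks of the right determinant and a suitable corner is a product of
   members of any two cyclic classes, and by Sylvester's equation the corner is
   irrelevant when the diagonal blocks have coprime annihilators.  Hence one has to
   LU-split [M] so that the minimal polynomials of [P] and [N] are not primary.

   If the minimal polynomial of [M] is not primary, pole placement applies to [M]
   itself; if [M] is cyclic, one solves [X Y = M] for [X = M Y^-1] instead.  The
   other matrices are split according to the degree of the irreducible factor.
   Unipotent matrices close to the identity have no good splitting; for them the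
   corner block in the pole placement is computed. *)
Require Import Defs.
From HB Require Import structures.
From mathcomp Require Import all_boot all_fingroup all_algebra all_field.
From mathcomp Require Import ring zify classical_sets boolp.

Set Implicit Arguments.
Unset Strict Implicit.
Unset Printing Implicit Defensive.

Import GRing.Theory.
Local Open Scope ring_scope.

(** To place both classes at once, [Z] (the future [Y^-1]) and [N Z] (the future [X]) are written as
    block triangular matrices times the same unipotent factor. Their corners can then be chosen
    independently to place the two characteristic polynomials, and the corner of [N] absorbs the
    difference. The obstacle is small fields, where there may be no element left to tell two
    eigenvalues apart. Hence coprimality is arranged by means that work over every field:
    polynomials with a prescribed constant term and one further nonzero value, polynomials of degree
    below that of the irreducible factor, and [phi6]. In size 4 with [M] annihilated by an
    irreducible quadratic this is not enough: the two diagonal blocks determine each other, and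
    making their eigenvalues distinct needs a unit whose square differs from a given element. This
    can fail only over GF(2), which is settled by hand, and over GF(3), which the hypothesis on [K]
    removes. *)

Section PolynomialsInMatrices.

Variable K : fieldType.

Lemma monic_top n (f : {poly K}) : f \is monic -> size f = n.+1 -> f`_n = 1.
Proof. by move=> /monicP + sf; rewrite /lead_coef sf. Qed.

Lemma sqr_sign n : (-1) ^+ n * (-1) ^+ n = 1 :> K.
Proof. by rewrite -exprMn mulrNN mulr1 expr1n. Qed.

Lemma size_two_term (x y : K) : (size (x%:P + y%:P * 'X : {poly K})%R <= 2)%N.
Proof.
rewrite (leq_trans (size_polyD _ _)) // geq_max (leq_trans (size_polyC_leq1 _)) //=.
by rewrite mul_polyC (leq_trans (size_scale_leq _ _)) // size_polyX.
Qed.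

Lemma two_term_poly (h : {poly K}) : (size h <= 2)%N -> h = (h`_0)%:P + (h`_1)%:P * 'X.
Proof.
move=> sh; apply/polyP => i; rewrite mul_polyC !(coefD, coefZ, coefC, coefX).
case: i => [|[|i]] /=; rewrite ?(mulr0, mulr1, addr0, add0r) //.
by rewrite nth_default // (leq_trans sh).
Qed.

Lemma monic_quadratic (f : {poly K}) : f \is monic -> size f = 3 ->
  f = 'X^2 + ((f`_0)%:P + (f`_1)%:P * 'X).
Proof.
move=> mf sf; apply/polyP => i; rewrite !mul_polyC !(coefD, coefZ, coefC, coefX, coefXn).
case: i => [|[|[|i]]] /=; rewrite ?(mulr0, mulr1, addr0, add0r) //.
  exact: monic_top.
by rewrite nth_default // sf.
Qed.

(* [horner_mx] is only defined for nonempty matrices; the convention for size 0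
   keeps empty blocks harmless. *)
Definition hmx n : 'M[K]_n -> {poly K} -> 'M[K]_n :=
  match n with 0 => fun _ _ => 0 | n'.+1 => fun A p => horner_mx A p end.

Lemma hmxD n (A : 'M[K]_n) p q : hmx A (p + q) = hmx A p + hmx A q.
Proof. by case: n A => [|n] A; rewrite ?thinmx0 //= rmorphD. Qed.

Lemma hmxB n (A : 'M[K]_n) p q : hmx A (p - q) = hmx A p - hmx A q.
Proof. by case: n A => [|n] A; rewrite ?thinmx0 //= rmorphB. Qed.

Lemma hmxN n (A : 'M[K]_n) p : hmx A (- p) = - hmx A p.
Proof. by case: n A => [|n] A; rewrite ?thinmx0 //= rmorphN. Qed.

Lemma hmxM n (A : 'M[K]_n) p q : hmx A (p * q) = hmx A p *m hmx A q.
Proof. by case: n A => [|n] A; rewrite ?thinmx0 //= rmorphM. Qed.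

Lemma hmxC n (A : 'M[K]_n) c : hmx A c%:P = c%:M.
Proof. by case: n A => [|n] A; rewrite ?thinmx0 //= horner_mx_C. Qed.

Lemma hmx0 n (A : 'M[K]_n) : hmx A 0 = 0.
Proof. by rewrite hmxC; apply/matrixP=> i j; rewrite !mxE mul0rn. Qed.

Lemma hmx1 n (A : 'M[K]_n) : hmx A 1 = 1%:M.
Proof. exact: hmxC. Qed.

Lemma hmxX n (A : 'M[K]_n) : hmx A 'X = A.
Proof. by case: n A => [|n] A; rewrite ?(thinmx0 A) ?thinmx0 //= horner_mx_X. Qed.

Lemma hmxZ n (A : 'M[K]_n) c p : hmx A (c *: p) = c *: hmx A p.
Proof. by rewrite -mul_polyC hmxM hmxC mul_scalar_mx. Qed.

Lemma hmx_sum n (A : 'M[K]_n) (I : Type) (r : seq I) (P : pred I) F :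
  hmx A (\sum_(i <- r | P i) F i) = \sum_(i <- r | P i) hmx A (F i).
Proof. by elim/big_rec2: _ => [|i y x _ <-]; rewrite ?hmx0 ?hmxD. Qed.

Lemma hmxXn n (A : 'M[K]_n) i : hmx A 'X^i = A ^+ i.
Proof.
by elim: i => [|i IH]; rewrite ?hmx1 ?exprS ?hmxM ?hmxX ?IH.
Qed.

Lemma hmxE n (A : 'M[K]_n) p : hmx A p = \sum_(i < size p) p`_i *: A ^+ i.
Proof.
rewrite -[in LHS](coefK p) poly_def hmx_sum.
by apply: eq_bigr => i _; rewrite hmxZ hmxXn.
Qed.

Lemma hmx_comm n (A : 'M[K]_n) p q : hmx A p *m hmx A q = hmx A q *m hmx A p.
Proof. by rewrite -!hmxM mulrC. Qed.

Lemma hmxS n (A : 'M[K]_n) p : hmx A p *m A = A *m hmx A p.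
Proof. by have := hmx_comm A p 'X; rewrite hmxX. Qed.

Lemma hmx_dvd0 n (A : 'M[K]_n) p q : p %| q -> hmx A p = 0 -> hmx A q = 0.
Proof. by move=> /dvdpP[r ->] h; rewrite hmxM h mulmx0. Qed.

Lemma hmx_char n (A : 'M[K]_n) : hmx A (char_poly A) = 0.
Proof. by case: n A => [|n] A; rewrite ?thinmx0 //= Cayley_Hamilton. Qed.

Lemma hmx_inter n n' (A : 'M[K]_n) (B : 'M[K]_n') (T : 'M_(n, n')) p :
  A *m T = T *m B -> hmx A p *m T = T *m hmx B p.
Proof.
move=> h; elim/poly_ind: p => [|p c IH]; first by rewrite !hmx0 mul0mx mulmx0.
rewrite !hmxD !hmxM !hmxX !hmxC mulmxDl mulmxDr scalar_mxC.
by rewrite -mulmxA h mulmxA IH mulmxA.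
Qed.

Lemma hmx_lblock n1 n2 (A : 'M[K]_n1) (B : 'M[K]_n2) X p :
  exists Y, hmx (block_mx A 0 X B) p = block_mx (hmx A p) 0 Y (hmx B p).
Proof.
elim/poly_ind: p => [|p c [Y IH]].
  by exists 0; rewrite !hmx0 -block_mx0.
rewrite !hmxD !hmxM !hmxX !hmxC IH mulmx_block scalar_mx_block add_block_mx.
by rewrite !mul0mx !mulmx0 !(addr0, add0r); eexists.
Qed.

Lemma hmx_dblock n1 n2 (A : 'M[K]_n1) (B : 'M[K]_n2) p :
  hmx (block_mx A 0 0 B) p = block_mx (hmx A p) 0 0 (hmx B p).
Proof.
elim/poly_ind: p => [|p c IH]; first by rewrite !hmx0 -block_mx0.
rewrite !hmxD !hmxM !hmxX !hmxC IH mulmx_block scalar_mx_block add_block_mx.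
by rewrite !mul0mx !mulmx0 !(addr0, add0r).
Qed.

Lemma hmx_coprime_unit n (A : 'M[K]_n) p q :
  coprimep p q -> hmx A p = 0 -> hmx A q \in unitmx.
Proof.
move=> /Bezout_eq1_coprimepP[[u v] /= uv1] hp.
have := congr1 (hmx A) uv1; rewrite hmxD !hmxM hp mulmx0 add0r hmx1.
by move=> /mulmx1_unit[].
Qed.

Lemma hmx_tr n (A : 'M[K]_n) p : hmx A^T p = (hmx A p)^T.
Proof.
elim/poly_ind: p => [|p c IH]; first by rewrite !hmx0 trmx0.
by rewrite !hmxD !hmxM !hmxX !hmxC linearD /= tr_scalar_mx IH hmxS trmx_mul.
Qed.

Lemma hmx_comp_scale n (A : 'M[K]_n) c p :
  hmx (c *: A) p = hmx A (p \Po (c *: 'X)).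
Proof.
elim/poly_ind: p => [|p d IH]; first by rewrite comp_poly0 !hmx0.
by rewrite comp_polyD comp_polyM comp_polyX comp_polyC !hmxD !hmxM hmxZ !hmxX
  !hmxC IH.
Qed.

(** * Similarity and cyclic matrices *)

(* The sizes are allowed to differ syntactically, which avoids [castmx]. *)
Definition simx n n' (A : 'M[K]_n) (B : 'M[K]_n') : Prop :=
  exists T : 'M[K]_(n, n'), exists T' : 'M[K]_(n', n),
    [/\ T *m T' = 1%:M, T' *m T = 1%:M & A *m T = T *m B].

Lemma simx_refl n (A : 'M[K]_n) : simx A A.
Proof. by exists 1%:M, 1%:M; rewrite !mulmx1 !mul1mx. Qed.

Lemma simx_sym n n' (A : 'M[K]_n) (B : 'M[K]_n') : simx A B -> simx B A.
Proof.
move=> [T [T' [h1 h2 h3]]]; exists T', T; split=> //.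
by rewrite -[LHS]mul1mx -h2 -!mulmxA (mulmxA T) -h3 -mulmxA h1 mulmx1.
Qed.

Lemma simx_trans n n' n'' (A : 'M[K]_n) (B : 'M[K]_n') (C : 'M[K]_n'') :
  simx A B -> simx B C -> simx A C.
Proof.
move=> [T [T' [h1 h2 h3]]] [S [S' [g1 g2 g3]]]; exists (T *m S), (S' *m T').
split.
- by rewrite mulmxA -(mulmxA T) g1 mulmx1.
- by rewrite mulmxA -(mulmxA S') h2 mulmx1.
by rewrite mulmxA h3 -!mulmxA g3.
Qed.

Lemma simx_conj n n' (A : 'M[K]_n) T (T' : 'M[K]_(n', n)) :
  T *m T' = 1%:M -> T' *m T = 1%:M -> simx A (T' *m A *m T).
Proof. by move=> h1 h2; exists T, T'; split=> //; rewrite !mulmxA h1 mul1mx. Qed.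

Lemma simx_unit n (A B T : 'M[K]_n) : T \in unitmx -> T *m A = B *m T -> simx A B.
Proof.
move=> uT h; exists (invmx T), T; rewrite mulVmx ?mulmxV //; split=> //.
by rewrite -[LHS]mul1mx -(mulVmx uT) -!mulmxA (mulmxA T) h mulmxK.
Qed.

Lemma simx_size n n' (A : 'M[K]_n) (B : 'M[K]_n') : simx A B -> n = n'.
Proof.
move=> [T [T' [h1 h2 _]]]; apply/eqP; rewrite eqn_leq.
have r1 : (n <= n')%N.
  by rewrite -[X in (X <= _)%N](mxrank1 K) -h1 (leq_trans (mxrankM_maxl _ _))
    ?rank_leq_col.
have r2 : (n' <= n)%N.
  by rewrite -[X in (X <= _)%N](mxrank1 K) -h2 (leq_trans (mxrankM_maxl _ _))
    ?rank_leq_col.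
by rewrite r1 r2.
Qed.

Lemma simx_conjugate n (A B : 'M[K]_n) : simx A B ->
  exists2 T, T \in unitmx & A = invmx T *m B *m T.
Proof.
move=> [T [T' [h1 h2 h3]]]; have [uT uT'] := mulmx1_unit h1.
exists T' => //; have -> : invmx T' = T.
  by rewrite -[LHS]mul1mx -h1 -mulmxA mulmxV ?mulmx1.
by rewrite -h3 -mulmxA h1 mulmx1.
Qed.

Lemma simx_det n n' (A : 'M[K]_n) (B : 'M[K]_n') : simx A B -> \det A = \det B.
Proof.
move=> h; have e := simx_size h; subst n'; have [T uT ->] := simx_conjugate h.
rewrite !det_mulmx det_inv mulrAC mulVf ?mul1r //.
by rewrite -unitfE -unitmxE.
Qed.

Lemma simx_hmx n n' (A : 'M[K]_n) (B : 'M[K]_n') p :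
  simx A B -> simx (hmx A p) (hmx B p).
Proof.
by move=> [T [T' [h1 h2 h3]]]; exists T, T'; split=> //; apply: hmx_inter.
Qed.

Lemma simx0 n n' (A : 'M[K]_n) (B : 'M[K]_n') : simx A B -> A = 0 -> B = 0.
Proof.
move=> [T [T' [h1 h2 h3]]] A0; rewrite -[B]mul1mx -h2 -mulmxA -h3 A0.
by rewrite mul0mx mulmx0.
Qed.

Lemma simx_hmx0 n n' (A : 'M[K]_n) (B : 'M[K]_n') p :
  simx A B -> hmx A p = 0 -> hmx B p = 0.
Proof. by move=> /(@simx_hmx _ _ _ _ p); apply: simx0. Qed.

Lemma simx_mul n n' (A X Y : 'M[K]_n) (B : 'M[K]_n') : simx A B -> A = X *m Y ->
  exists X', exists Y', [/\ simx X X', simx Y Y' & B = X' *m Y'].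
Proof.
move=> [T [T' [h1 h2 h3]]] AE; exists (T' *m X *m T), (T' *m Y *m T).
split; try exact: simx_conj.
rewrite !mulmxA -(mulmxA _ T T') h1 mulmx1 -(mulmxA T') -AE -mulmxA h3 mulmxA.
by rewrite h2 mul1mx.
Qed.

Lemma simx_unitmx n n' (A : 'M[K]_n) (B : 'M[K]_n') :
  simx A B -> A \in unitmx -> B \in unitmx.
Proof.
by rewrite !unitmxE => /simx_det ->.
Qed.

(** Similarity to a companion matrix makes sense in every size, including 0, and makes any two
    matrices with the same [f] similar at once. *)
Definition cycp n (X : 'M[K]_n) (f : {poly K}) : Prop :=
  f \is monic /\ simx X (companionmx f).

Lemma cycp_sim n n' (X : 'M[K]_n) (Y : 'M[K]_n') f :
  simx X Y -> cycp X f -> cycp Y f.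
Proof. by move=> s [mf h]; split=> //; apply: simx_trans (simx_sym s) h. Qed.

Lemma cycp_size n (X : 'M[K]_n) f : cycp X f -> size f = n.+1.
Proof.
move=> [mf /simx_size ->]; rewrite prednK // size_poly_gt0.
by apply: monic_neq0.
Qed.

Lemma simx_char n n' (A : 'M[K]_n) (B : 'M[K]_n') :
  simx A B -> char_poly A = char_poly B.
Proof.
move=> s; have e := simx_size s; subst n'.
have [T uT ->] := simx_conjugate s.
rewrite /char_poly /char_poly_mx.
have -> : 'X%:M - map_mx polyC (invmx T *m B *m T) =
   map_mx polyC (invmx T) *m ('X%:M - map_mx polyC B) *m map_mx polyC T.
  rewrite mulmxBr mulmxBl !map_mxM scalar_mxC -!mulmxA -(map_mxM _ (invmx T) T).
  by rewrite mulVmx // map_mx1 mulmx1.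
rewrite !det_mulmx mulrAC -det_mulmx -map_mxM mulVmx // map_mx1 det1 mul1r //.
Qed.

Lemma cycp_char n (X : 'M[K]_n) f : cycp X f -> char_poly X = f.
Proof. by move=> [mf /simx_char ->]; rewrite companionmxK. Qed.

Lemma cycp_hmx0 n (X : 'M[K]_n) f : cycp X f -> hmx X f = 0.
Proof. by move=> /cycp_char {1}<-; apply: hmx_char. Qed.

Lemma char_coef0 n (X : 'M[K]_n) : \det X = (-1) ^+ n * (char_poly X)`_0.
Proof. by rewrite char_poly_det mulrA sqr_sign mul1r. Qed.

Lemma cycp_det n (X : 'M[K]_n) f : cycp X f -> \det X = (-1) ^+ n * f`_0.
Proof. by move=> /cycp_char {1}<-; apply: char_coef0. Qed.

Lemma cycp_unit n (X : 'M[K]_n) (f : {poly K}) : cycp X f -> f`_0 != 0 -> X \in unitmx.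
Proof. by move=> c h; rewrite unitmxE (cycp_det c) unitfE mulf_neq0 ?signr_eq0. Qed.

Lemma cycp_companion f : f \is monic -> cycp (companionmx f) f.
Proof. by split=> //; apply: simx_refl. Qed.

(* The row vectors generate the [K[x]]-module defined by [X]. *)
Definition gen n (X : 'M[K]_n) (u : 'rV[K]_n) : Prop :=
  forall y : 'rV[K]_n, exists q, y = u *m hmx X q.

Definition kryl n (X : 'M[K]_n) (u : 'rV[K]_n) : 'M[K]_n :=
  \matrix_(i < n) (u *m X ^+ i).

Lemma row_kryl_poly n (X : 'M[K]_n) u (r : 'rV_n) :
  r *m kryl X u = u *m hmx X (rVpoly r).
Proof.
rewrite mulmx_sum_row /rVpoly poly_def hmx_sum mulmx_sumr.
apply: eq_bigr => i _; rewrite rowK valK hmxZ hmxXn -scalemxAr.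
by congr (_ *: _).
Qed.

Lemma gen_small n (X : 'M[K]_n) u y : gen X u ->
  exists2 q : {poly K}, (size q <= n)%N & y = u *m hmx X q.
Proof.
move=> /(_ y)[q yq]; exists (q %% char_poly X).
  rewrite -ltnS -(size_char_poly X) ltn_modp.
  by rewrite monic_neq0 ?char_poly_monic.
rewrite yq {1}(divp_eq q (char_poly X)) hmxD hmxM hmx_char mulmx0 add0r //.
Qed.

Lemma gen_kryl n (X : 'M[K]_n) u : gen X u -> kryl X u \in unitmx.
Proof.
move=> g; rewrite -row_full_unit -sub1mx; apply/row_subP => i.
have [q sq ->] := gen_small (row i 1%:M) g.
by rewrite -(poly_rV_K sq) -row_kryl_poly submxMl.
Qed.

Lemma gen_min n (X : 'M[K]_n) u (q : {poly K}) : gen X u -> (size q <= n)%N ->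
  u *m hmx X q = 0 -> q = 0.
Proof.
move=> g sq h; rewrite -(poly_rV_K sq); set r : 'rV_n := poly_rV q.
suff -> : r = 0 by apply/polyP=> i; rewrite coef_rVpoly coef0; case: insub => // ?; rewrite mxE.
have := row_kryl_poly X u r; rewrite (poly_rV_K sq) h.
by move/(congr1 (mulmx^~ (invmx (kryl X u)))); rewrite mulmxK ?gen_kryl ?mul0mx.
Qed.

(** [T] need not be square: the relation serves both a cyclic vector and a vector that generates a
    proper submodule. *)
Lemma kryl_companion n (X : 'M[K]_n) (u : 'rV_n) (f : {poly K}) :
  f \is monic -> u *m hmx X f = 0 ->
  let T := \matrix_(i < (size f).-1) (u *m X ^+ i) in
  T *m X = companionmx f *m T.
Proof.
move=> mf uf T; apply/row_matrixP => i; rewrite !row_mul rowK -mulmxA.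
have -> : X ^+ i *m X = X ^+ i.+1 by rewrite exprSr.
case: (eqVneq i.+1 (size f).-1) => [ei|nei].
  have fE d : size f = d.+1 -> hmx X f = X ^+ d + \sum_(j < d) f`_j *: X ^+ j.
    move=> sd; rewrite hmxE sd big_ord_recr /= addrC; congr (_ + _).
    by have /monicP := mf; rewrite /lead_coef sd /= => ->; rewrite scale1r.
  rewrite ei; move: uf; rewrite (fE (size f).-1); last first.
    by rewrite prednK // size_poly_gt0 monic_neq0.
  rewrite mulmxDr => /eqP; rewrite addr_eq0 => /eqP ->.
  rewrite mulmx_sumr mulmx_sum_row -sumrN; apply: eq_bigr => j _.
  rewrite rowK !mxE ifT; first by rewrite scaleNr scalemxAr.
  by apply/eqP; rewrite -[LHS]/(i.+1.-1) ei.
have lti : (i.+1 < (size f).-1)%N by rewrite ltn_neqAle nei ltn_ord.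
by rewrite rowE mulmx_delta_companion -rowE rowK.
Qed.

Lemma gen_cycp_char n (X : 'M[K]_n) u : gen X u -> cycp X (char_poly X).
Proof.
move=> g; split; first exact: char_poly_monic.
set f := char_poly X; have sf : (size f).-1 = n by rewrite size_char_poly.
pose T : 'M[K]_((size f).-1, n) := \matrix_(i < (size f).-1) (u *m X ^+ i).
have [T' [h1 h2]] : exists T' : 'M_(n, (size f).-1),
    T *m T' = 1%:M /\ T' *m T = 1%:M.
  rewrite {}/T; move: (size f).-1 sf => d ->.
  by exists (invmx (kryl X u)); rewrite mulVmx ?mulmxV ?gen_kryl.
have key : T *m X = companionmx f *m T.
  by apply: kryl_companion; rewrite ?char_poly_monic // hmx_char mulmx0.
exists T', T; split=> //.
by rewrite -[X in X *m T']mul1mx -h2 -!mulmxA (mulmxA T X) key -!mulmxA h1 mulmx1.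
Qed.

(** The difference of [f] and the characteristic polynomial kills the generator and has degree below
    [n], so it vanishes. *)
Lemma gen_cycp n (X : 'M[K]_n) u f : gen X u -> f \is monic -> size f = n.+1 ->
  u *m hmx X f = 0 -> cycp X f.
Proof.
move=> g mf sf h; suff -> : f = char_poly X by apply: gen_cycp_char g.
apply/eqP; rewrite -subr_eq0; apply/eqP; apply: (gen_min g).
  have := size_char_poly X; set c := char_poly X => sc.
  have mc : c \is monic by apply: char_poly_monic.
  apply/leq_sizeP => j; rewrite leq_eqVlt => /orP[/eqP <-|lt_nj].
    move: mf mc; rewrite !monicE /lead_coef sf sc /= coefB => /eqP-> /eqP->.
    by rewrite subrr.
  by rewrite coefB !nth_default ?subrr ?sf ?sc.
by rewrite hmxB mulmxBr h hmx_char mulmx0 subrr.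
Qed.

End PolynomialsInMatrices.

(** * Inverses and block sums of cyclic matrices *)

Section CyclicMatrices.

Variable K : fieldType.

Lemma gen_sim n n' (X : 'M[K]_n) (Y : 'M[K]_n') u T T' :
  T *m T' = 1%:M -> T' *m T = 1%:M -> X *m T = T *m Y ->
  gen X u -> gen Y (u *m T).
Proof.
move=> h1 h2 h3 g y; have [q yq] := g (y *m T'); exists q.
by rewrite -mulmxA -(hmx_inter _ h3) mulmxA -yq -mulmxA h2 mulmx1.
Qed.

Lemma companion_pow (f : {poly K}) (d := (size f).-1) (i j : 'I_d) :
  i = 0%N :> nat ->
  delta_mx 0 i *m companionmx f ^+ j = delta_mx 0 j :> 'rV_d.
Proof.
move=> i0; case: j => j ltj /=; elim: j ltj => [|j IH] ltj.
  by rewrite expr0 mulmx1; congr delta_mx; apply: val_inj.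
rewrite exprSr -[_ * _]/(_ *m _) mulmxA (IH (ltnW ltj)).
by rewrite mulmx_delta_companion.
Qed.

Lemma companion_gen (f : {poly K}) (d := (size f).-1) (i : 'I_d) :
  i = 0%N :> nat -> gen (companionmx f) (delta_mx 0 i).
Proof.
move=> i0 y; exists (rVpoly y); rewrite [in LHS](row_sum_delta y).
rewrite /rVpoly poly_def hmx_sum mulmx_sumr; apply: eq_bigr => j _.
by rewrite valK hmxZ hmxXn -scalemxAr companion_pow.
Qed.

Lemma cycp_gen n (X : 'M[K]_n) f : cycp X f -> exists u, gen X u.
Proof.
case: n X => [|n] X cX.
  by exists 0 => y; exists 0; rewrite (thinmx0 y) thinmx0.
have sf := cycp_size cX; case: cX => mf /simx_sym[T [T' [h1 h2 h3]]].
have lt0 : (0 < (size f).-1)%N by rewrite sf.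
by exists (delta_mx 0 (Ordinal lt0) *m T); apply: (gen_sim h1 h2 h3);
  apply: companion_gen.
Qed.

Lemma cycp_transport n n' (X : 'M[K]_n) (Y : 'M[K]_n') f :
  cycp X f -> cycp Y f -> simx X Y.
Proof. by move=> [_ sX] [_ sY]; apply: simx_trans sX (simx_sym sY). Qed.

(** The monic reciprocal [x^d f(1/x) / f(0)] with [d] the degree of [f]: it belongs to [X^-1] when
    [f] belongs to [X]. *)
Definition recip (f : {poly K}) : {poly K} :=
  \poly_(i < size f) (f`_((size f).-1 - i) / f`_0).

Lemma size_recip f : f \is monic -> f`_0 != 0 -> size (recip f) = size f.
Proof.
move=> mf f0; have s0 : (0 < size f)%N by rewrite size_poly_gt0 monic_neq0.
rewrite /recip -[X in \poly_(_ < X) _]prednK //.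
by rewrite size_poly_eq ?prednK // subnn divff ?oner_eq0.
Qed.

Lemma recip_monic f : f \is monic -> f`_0 != 0 -> recip f \is monic.
Proof.
move=> mf f0; have s0 : (0 < size f)%N by rewrite size_poly_gt0 monic_neq0.
by rewrite monicE /lead_coef size_recip // coef_poly prednK // leqnn subnn divff.
Qed.

Lemma recip_coef0 f : f \is monic -> (recip f)`_0 = (f`_0)^-1.
Proof.
move=> mf; have s0 : (0 < size f)%N by rewrite size_poly_gt0 monic_neq0.
rewrite coef_poly s0 subn0 -/(lead_coef f).
by have /monicP-> := mf; rewrite mul1r.
Qed.

Lemma recipK f : f \is monic -> f`_0 != 0 -> recip (recip f) = f.
Proof.
move=> mf f0; apply/polyP => i; rewrite coef_poly size_recip //.
case: ltnP => hi; last by rewrite nth_default.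
rewrite recip_coef0 // coef_poly invrK.
have s0 : (0 < size f)%N by rewrite size_poly_gt0 monic_neq0.
rewrite ifT; last by (have := hi; have := s0; lia).
have -> : ((size f).-1 - ((size f).-1 - i) = i)%N by lia.
by rewrite mulfVK.
Qed.

Lemma hmx_recip n (X : 'M[K]_n) f : f \is monic -> f`_0 != 0 ->
  X \in unitmx -> hmx (invmx X) (recip f) = (f`_0)^-1 *: (invmx X ^+ (size f).-1 *m hmx X f).
Proof.
move=> mf f0 uX; rewrite !hmxE size_recip // mulmx_sumr scaler_sumr.
have s0 : (0 < size f)%N by rewrite size_poly_gt0 monic_neq0.
rewrite (reindex_inj rev_ord_inj) /=; apply: eq_bigr => i _.
have hi := ltn_ord i.
have sub_lt (s j : nat) : (j < s)%N -> (s - j.+1 < s)%N /\ (s.-1 - (s - j.+1) = j)%N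
  by lia.
have [lt1 eq1] := sub_lt _ _ hi.
rewrite coef_poly lt1 eq1 -scalemxAr scalerA mulrC; congr (_ *: _).
have -> : (size f).-1 = (size f - i.+1 + i)%N by move: (size f) (i : nat) hi {lt1 eq1} => *; lia.
rewrite exprD -[_ * _]/(_ *m _) -mulmxA; set Z := _ ^+ (_ - _).
rewrite -[LHS]mulmx1; congr (_ *m _).
elim: (nat_of_ord i) => [|j IH]; first by rewrite !expr0 mulmx1.
rewrite exprSr exprS -[_ * _]/(_ *m _) -[X in _ *m X]/(_ *m _) -mulmxA.
by rewrite (mulmxA (invmx X)) mulVmx // mul1mx.
Qed.

Lemma hmx_inv n (X : 'M[K]_n) : X \in unitmx -> exists q, invmx X = hmx X q.
Proof.
move=> uX; set c := char_poly X.
have c0 : c`_0 != 0.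
  by rewrite char_poly_det mulf_neq0 ?signr_eq0 // -unitfE -unitmxE.
exists (- (c`_0)^-1 *: drop_poly 1 c).
have h := hmx_char X; rewrite -/c -(poly_take_drop 1 c) hmxD hmxM hmxXn in h.
have ct : take_poly 1 c = (c`_0)%:P.
  by apply/polyP=> [[|i]]; rewrite coef_take_poly coefC.
rewrite ct hmxC expr1 in h; rewrite hmxZ.
have e : hmx X (drop_poly 1 c) *m X = - (c`_0)%:M.
  by apply/eqP; rewrite -addr_eq0 addrC; apply/eqP.
rewrite -[hmx X _](mulmxK uX) e mulNmx mul_scalar_mx scalerN scaleNr opprK.
by rewrite scalerA mulVf // scale1r.
Qed.

Lemma gen_invmx n (X : 'M[K]_n) u : X \in unitmx -> gen X u -> gen (invmx X) u.
Proof.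
move=> uX g y; have [q ->] := g y.
have uX' : invmx X \in unitmx by rewrite unitmx_inv.
have [r rE] := hmx_inv uX'; rewrite invmxK in rE.
exists (q \Po r); congr (_ *m _); rewrite {1}rE.
elim/poly_ind: q => [|p c IH]; first by rewrite comp_poly0 !hmx0.
by rewrite comp_polyD comp_polyM comp_polyX comp_polyC !hmxD !hmxM !hmxX !hmxC IH.
Qed.

Lemma cycp_invmx n (X : 'M[K]_n) f : X \in unitmx -> cycp X f ->
  cycp (invmx X) (recip f).
Proof.
move=> uX cX; have [u g] := cycp_gen cX; have [mf _] := cX.
have f0 : f`_0 != 0.
  move: uX; rewrite unitmxE (cycp_det cX) unitfE.
  by apply: contraNneq => ->; rewrite mulr0.
apply: (gen_cycp (gen_invmx uX g)); rewrite ?recip_monic ?size_recip //.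
  exact: cycp_size cX.
by rewrite hmx_recip // (cycp_hmx0 cX) mulmx0 scaler0 mulmx0.
Qed.

(** The Sylvester map [Z -> B Z - Z A] is injective: [B Z = Z A] gives [Z q(A) = q(B) Z = 0], and
    [q(A)] is invertible. Hence it is onto, and a preimage of [X] conjugates the corner away. *)
Lemma simx_lblock_coprime n1 n2 (A : 'M[K]_n1) (B : 'M[K]_n2) X p q :
  coprimep p q -> hmx A p = 0 -> hmx B q = 0 ->
  simx (block_mx A 0 X B) (block_mx A 0 0 B).
Proof.
move=> cpq hA hB.
pose phi (Z : 'M[K]_(n2, n1)) := B *m Z - Z *m A.
have phi_lin : linear phi.
  move=> c U V; rewrite /phi mulmxDr mulmxDl -scalemxAr -scalemxAl.
  by rewrite opprD addrACA scalerBr.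
pose phiL : {linear 'M[K]_(n2, n1) -> 'M[K]_(n2, n1)} :=
  HB.pack phi (GRing.isLinear.Build _ _ _ _ phi phi_lin).
have inj Z : phi Z = 0 -> Z = 0.
  move=> /eqP; rewrite subr_eq0 => /eqP e.
  have h := hmx_inter q e; rewrite hB mul0mx in h.
  have u := hmx_coprime_unit cpq hA.
  by rewrite -[Z](mulmxK u) -h mul0mx.
have uL : lin_mx phiL \in unitmx.
  rewrite -row_free_unit -kermx_eq0; apply/eqP/row_matrixP => i; rewrite row0.
  set r := row i _; have : r *m lin_mx phiL = 0 by rewrite -row_mul mulmx_ker row0.
  rewrite -[r]vec_mxK mul_vec_lin /= => /(congr1 vec_mx); rewrite mxvecK linear0.
  by move=> /inj ->; rewrite linear0.
have [Z ZE] : exists Z, phi Z = X.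
  exists (vec_mx (mxvec X *m invmx (lin_mx phiL))).
  by apply: (can_inj mxvecK); rewrite -(mul_vec_lin phiL) vec_mxK mulmxKV.
exists (block_mx 1%:M 0 (- Z) 1%:M), (block_mx 1%:M 0 Z 1%:M).
split.
- by rewrite mulmx_block !mulmx1 !mul1mx !mulmx0 ?mul0mx !addr0 !add0r addNr -scalar_mx_block.
- by rewrite mulmx_block !mulmx1 !mul1mx !mulmx0 ?mul0mx !addr0 !add0r subrr -scalar_mx_block.
rewrite !mulmx_block !mulmx1 !mul1mx !mulmx0 !mul0mx !addr0 !add0r.
by rewrite -ZE /phi mulmxN mulNmx addrAC subrr add0r.
Qed.

Lemma coprime_combine (a b q1 q2 : {poly K}) : coprimep a b ->
  exists q, a %| q - q1 /\ b %| q - q2.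
Proof.
move=> /Bezout_eq1_coprimepP[[u v] /= e]; exists (u * a * q2 + v * b * q1); split.
  have -> : u * a * q2 + v * b * q1 - q1 = a * (u * q2 - u * q1).
    by rewrite -[q1 in X in _ - X]mul1r -e; ring.
  exact: dvdp_mulr.
have -> : u * a * q2 + v * b * q1 - q2 = b * (v * q1 - v * q2).
  by rewrite -[q2 in X in _ - X]mul1r -e; ring.
exact: dvdp_mulr.
Qed.

(** By the Chinese remainder theorem the pair of two cyclic vectors is cyclic for the sum. *)
Lemma cycp_dblock n1 n2 (A : 'M[K]_n1) (B : 'M[K]_n2) a b :
  coprimep a b -> cycp A a -> cycp B b -> cycp (block_mx A 0 0 B) (a * b).
Proof.
move=> cab cA cB; have [u gu] := cycp_gen cA; have [v gv] := cycp_gen cB.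
apply: (@gen_cycp _ _ _ (row_mx u v)).
- move=> y; rewrite -[y]hsubmxK.
  have [q1 ->] := gu (lsubmx y); have [q2 ->] := gv (rsubmx y).
  have [q [h1 h2]] := coprime_combine q1 q2 cab; exists q.
  rewrite hmx_dblock mul_row_block !mulmx0 addr0 add0r.
  have e1 := hmx_dvd0 h1 (cycp_hmx0 cA).
  have e2 := hmx_dvd0 h2 (cycp_hmx0 cB).
  move: e1 e2; rewrite !hmxB => /eqP; rewrite subr_eq0 => /eqP ->.
  by move=> /eqP; rewrite subr_eq0 => /eqP ->.
- by rewrite monicMl; [case: cB | case: cA].
- have [ma _] := cA; have [mb _] := cB.
  rewrite size_mul ?(monic_neq0 ma) ?(monic_neq0 mb) //.
  by rewrite (cycp_size cA) (cycp_size cB) addnS.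
by rewrite hmx_dblock !hmxM (cycp_hmx0 cA) (cycp_hmx0 cB) mul0mx mulmx0 block_mx0 mulmx0.
Qed.

Lemma cycp_lblock n1 n2 (A : 'M[K]_n1) (B : 'M[K]_n2) X a b :
  coprimep a b -> cycp A a -> cycp B b -> cycp (block_mx A 0 X B) (a * b).
Proof.
move=> cab cA cB.
apply: cycp_sim (cycp_dblock cab cA cB); apply/simx_sym.
exact: simx_lblock_coprime cab (cycp_hmx0 cA) (cycp_hmx0 cB).
Qed.

Lemma simx_swap n1 n2 (A : 'M[K]_n1) (B : 'M[K]_n2) X Y :
  simx (block_mx A X Y B) (block_mx B Y X A).
Proof.
exists (block_mx 0 1%:M 1%:M 0), (block_mx 0 1%:M 1%:M 0).
by rewrite !mulmx_block !mulmx1 !mul1mx !mulmx0 !mul0mx !addr0 !add0r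
  -!scalar_mx_block.
Qed.

Lemma cycp_ublock n1 n2 (A : 'M[K]_n1) (B : 'M[K]_n2) X a b :
  coprimep a b -> cycp A a -> cycp B b -> cycp (block_mx A X 0 B) (a * b).
Proof.
move=> cab cA cB; rewrite mulrC; apply: cycp_sim (cycp_lblock X _ cB cA).
  exact: simx_swap.
by rewrite coprimep_sym.
Qed.


End CyclicMatrices.

(** * Cyclic vectors *)

Section CyclicVector.

Variable K : fieldType.

Lemma irreducible_factor (p : {poly K}) : (1 < size p)%N ->
  exists2 q : {poly K}, irreducible_poly q /\ q \is monic & q %| p.
Proof.
have [n] := ubnP (size p); elim: n p => // n IH p lepn p1.
have p0 : p != 0 by rewrite -size_poly_gt0 (ltn_trans _ p1).
have [irr|nirr] := EM (irreducible_poly p).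
  have l0 : (lead_coef p)^-1 != 0 by rewrite invr_eq0 lead_coef_eq0.
  exists ((lead_coef p)^-1 *: p); last by rewrite dvdpZl.
  split; last by rewrite monicE lead_coefZ mulVf ?lead_coef_eq0.
  split; first by rewrite size_scale.
  move=> q q1; rewrite dvdpZr // => /(irr.2 _ q1) h.
  by rewrite (eqp_trans h) // eqp_sym eqp_scale.
have [q [q1 qp nqp]] : exists q : {poly K}, [/\ size q != 1%N, q %| p & ~~ (q %= p)].
  apply: contrapT => h; apply: nirr; split=> // q q1 qp.
  by case: (boolP (q %= p)) => // ?; case: h; exists q.
have q0 : q != 0 by apply: contraNneq p0 => q0; move: qp; rewrite q0 dvd0p.
have sq1 : (1 < size q)%N by rewrite ltn_neqAle eq_sym q1 size_poly_gt0.
have sqp : (size q < size p)%N.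
  by rewrite ltn_neqAle dvdp_leq // andbT dvdp_size_eqp.
have [|r hr rq] := IH q _ sq1; first by rewrite (leq_trans sqp).
by exists r => //; apply: dvdp_trans rq qp.
Qed.

Lemma irreducible_part (p f : {poly K}) : irreducible_poly p -> f != 0 ->
  exists e, exists2 g, f = p ^+ e * g & coprimep p g.
Proof.
move=> irr; have [n] := ubnP (size f); elim: n f => // n IH f lefn f0.
case: (boolP (p %| f)) => [pf|npf]; last first.
  by exists 0%N, f; rewrite ?expr0 ?mul1r // irreducible_poly_coprime.
have p0 : p != 0 by rewrite -size_poly_gt0 (ltn_trans _ irr.1).
have [h hE] := dvdpP _ _ pf.
have h0 : h != 0 by apply: contraNneq f0 => h0; rewrite hE h0 mul0r.
have [|e [g gE cg]] := IH h _ h0.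
  have := lefn; rewrite hE size_mul //; have := irr.1.
  by rewrite -size_poly_gt0 in h0; move: (size p) (size h) h0 => *; lia.
by exists e.+1, g => //; rewrite hE gE exprS; ring.
Qed.

Lemma coprimep_irr (p g : {poly K}) : irreducible_poly p -> g != 0 ->
  (size g < size p)%N -> coprimep p g.
Proof.
move=> irr g0 lt; rewrite irreducible_poly_coprime //.
by apply/negP => /dvdp_leq; rewrite leqNgt lt => /(_ g0).
Qed.

Definition has_order n (X : 'M[K]_n) (u : 'rV_n) (d : {poly K}) : Prop :=
  forall q, (u *m hmx X q == 0) = (d %| q).

Lemma has_order_add n (X : 'M[K]_n) u v c d : coprimep c d ->
  has_order X u c -> has_order X v d -> has_order X (u + v) (c * d).
Proof.
move=> ccd hu hv q; apply/idP/idP; last first.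
  move=> cdq; rewrite mulmxDl.
  have /eqP -> : u *m hmx X q == 0.
    by rewrite hu (dvdp_trans _ cdq) // dvdp_mulr.
  have /eqP -> : v *m hmx X q == 0.
    by rewrite hv (dvdp_trans _ cdq) // dvdp_mull.
  by rewrite addr0.
rewrite mulmxDl addr_eq0 => /eqP e.
have ud : u *m hmx X (q * d) == 0.
  rewrite hmxM mulmxA e mulNmx -mulmxA hmx_comm mulmxA.
  have /eqP-> : v *m hmx X d == 0 by rewrite hv.
  by rewrite mul0mx oppr0.
have vc : v *m hmx X (q * c) == 0.
  have -> : v *m hmx X (q * c) = - (u *m hmx X q *m hmx X c).
    by rewrite e mulNmx opprK hmxM mulmxA.
  rewrite -mulmxA hmx_comm mulmxA.
  have /eqP-> : u *m hmx X c == 0 by rewrite hu.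
  by rewrite mul0mx oppr0.
rewrite hu Gauss_dvdpl // in ud.
rewrite hv Gauss_dvdpl ?(coprimep_sym d) // in vc.
by rewrite Gauss_dvdp // ud.
Qed.

(** Prime powers are treated one by one and the vectors added. Taking for [d] the whole minimal
    polynomial gives a cyclic vector when it equals the characteristic polynomial. *)
Lemma exists_order n (X : 'M[K]_n.+1) d : d \is monic -> d %| mxminpoly X ->
  exists u, has_order X u d.
Proof.
have [N] := ubnP (size d); elim: N d => // N IH d ledN md dX.
have d0 := monic_neq0 md.
case: (leqP (size d) 1) => d1.
  have {d1} d1 : d %= 1.
    rewrite -size_poly_eq1 eqn_leq d1 size_poly_gt0 //.
  by exists 0 => q; rewrite mul0mx eqxx (eqp_dvdl _ d1) dvd1p.
have [p [irr mp] pd] := irreducible_factor d1.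
have [e [g dE cpg]] := irreducible_part irr d0.
have p0 := monic_neq0 mp.
have e0 : (0 < e)%N.
  case: e dE => // dE; move: pd; rewrite dE expr0 mul1r => pg.
  move: cpg; rewrite irreducible_poly_coprime ?pg //.
have g0 : g != 0 by apply: contraNneq d0 => g0; rewrite dE g0 mulr0.
have mg : g \is monic by move: md; rewrite dE (monicMl _ (monic_exp e mp)).
have dXg : g %| d by rewrite dE dvdp_mull.
have sgd : (size g < size d)%N.
  have := size_exp p e; have := irr.1.
  rewrite dE size_mul ?expf_neq0 //; have : (0 < size g)%N by rewrite size_poly_gt0.
  case: e e0 {dE} => // e _; rewrite mulnS; move: ((size p).-1 * e)%N => y.
  by move: (size g) (size (p ^+ e.+1)) (size p) => *; lia.
have [|u hu] := IH g _ mg (dvdp_trans dXg dX); first exact: leq_trans sgd _.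
have [h hE] := dvdpP _ _ dX.
(* Otherwise the minimal polynomial [p ^+ e * g * h] would divide a polynomial of smaller degree. *)
have [x x0] : exists x : 'rV_n.+1, x *m hmx X (p ^+ e.-1 * (g * h)) != 0.
  apply: contrapT => nx.
  have z : hmx X (p ^+ e.-1 * (g * h)) = 0.
    apply/row_matrixP => i; rewrite row0 rowE; apply/eqP.
    by apply: contrapT => /negP ?; apply: nx; exists (delta_mx 0 i).
  have := mxminpoly_min z; rewrite hE dE -{1}(prednK e0) exprS.
  have -> : h * (p * p ^+ e.-1 * g) = p * (p ^+ e.-1 * (g * h)) by ring.
  have r0 : p ^+ e.-1 * (g * h) != 0.
    rewrite !mulf_neq0 ?expf_neq0 //; apply: contraNneq (monic_neq0 (mxminpoly_monic X)).
    by rewrite hE => ->; rewrite mul0r.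
  move=> /dvdp_leq => /(_ r0); rewrite size_mul //.
  by have := irr.1; rewrite -size_poly_gt0 in r0; move: (size p) (size _) r0 => *; lia.
pose w := x *m hmx X (g * h).
have hw : has_order X w (p ^+ e).
  move=> q; apply/idP/idP; last first.
    move=> /dvdpP[r ->]; rewrite /w -mulmxA -hmxM.
    have -> : g * h * (r * p ^+ e) = r * (h * d) by rewrite dE; ring.
    by rewrite -hE hmxM [hmx X (mxminpoly X)]mx_root_minpoly mulmx0 mulmx0.
  have [->|q0] := eqVneq q 0; first by rewrite dvdp0.
  have [j [q' qE cq]] := irreducible_part irr q0.
  move=> /eqP wq; rewrite qE; case: (leqP e j) => [ej|je].
    by rewrite dvdp_mulr // dvdp_exp2l.
  (* With [j < e], the polynomial [p ^+ e.-1] is a combination of [p ^+ e] and [q], so it would kill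
     [w], against the choice of [x]. *)
  have [[a b] /= ab] := Bezout_eq1_coprimepP _ _ cq.
  have ep : p ^+ e.-1 = p ^+ (e.-1 - j) * p ^+ j by rewrite -exprD; congr (_ ^+ _); lia.
  move: x0; rewrite mulrC hmxM mulmxA -/w.
  rewrite -[p ^+ e.-1]mulr1 -ab.
  have -> : p ^+ e.-1 * (a * p + b * q') = p ^+ e * a + q * (p ^+ (e.-1 - j) * b).
    have pe : p ^+ e = p * p ^+ e.-1 by rewrite -exprS prednK.
    by rewrite qE pe ep; ring.
  have wpe : w *m hmx X (p ^+ e) = 0.
    rewrite /w -mulmxA -hmxM.
    have -> : g * h * p ^+ e = h * d by rewrite dE; ring.
    by rewrite -hE [hmx X (mxminpoly X)]mx_root_minpoly mulmx0.
  by rewrite hmxD !hmxM mulmxDr !mulmxA wpe wq !mul0mx addr0 eqxx.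
exists (w + u); rewrite dE; apply: has_order_add => //.
by rewrite coprimep_expl.
Qed.

Lemma has_order_gen n (X : 'M[K]_n) u d : has_order X u d -> size d = n.+1 -> gen X u.
Proof.
move=> hu sd; suff uK : kryl X u \in unitmx.
  move=> y; exists (rVpoly (y *m invmx (kryl X u))).
  by rewrite -row_kryl_poly mulmxKV.
rewrite -row_free_unit -kermx_eq0; apply/eqP/row_matrixP => i; rewrite row0.
set r := row i _; have : r *m kryl X u = 0 by rewrite -row_mul mulmx_ker row0.
rewrite row_kryl_poly => /eqP; rewrite hu => /dvdp_leq h.
have [r0|r0] := eqVneq (rVpoly r) 0.
  by rewrite -(rVpolyK r) r0 linear0.
by have := leq_trans (h r0) (size_poly _ _); rewrite sd ltnn.
Qed.

Lemma cyclic_cycp n (X : 'M[K]_n.+1) : mxminpoly X = char_poly X ->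
  cycp X (char_poly X).
Proof.
move=> e; have [u hu] := exists_order (mxminpoly_monic X) (dvdpp _).
apply: (@gen_cycp_char _ _ _ u); apply: has_order_gen hu _.
by rewrite e size_char_poly.
Qed.

End CyclicVector.

(** * Vectors that are cyclic for two matrices at once *)

Section SimultaneousCyclicVector.

Variable K : fieldType.

Definition inG n (X : 'M[K]_n) (u y : 'rV[K]_n) : Prop := exists q, y = u *m hmx X q.

Lemma inG0 n (X : 'M[K]_n) u : inG X u 0.
Proof. by exists 0; rewrite hmx0 mulmx0. Qed.

Lemma inG_id n (X : 'M[K]_n) u : inG X u u.
Proof. by exists 1; rewrite hmx1 mulmx1. Qed.

Lemma inGD n (X : 'M[K]_n) u y z : inG X u y -> inG X u z -> inG X u (y + z).
Proof. by move=> [q ->] [r ->]; exists (q + r); rewrite hmxD mulmxDr. Qed.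

Lemma inGZ n (X : 'M[K]_n) u c y : inG X u y -> inG X u (c *: y).
Proof. by move=> [q ->]; exists (c *: q); rewrite hmxZ scalemxAr. Qed.

Lemma inGN n (X : 'M[K]_n) u y : inG X u y -> inG X u (- y).
Proof. by rewrite -scaleN1r; apply: inGZ. Qed.

Lemma inGB n (X : 'M[K]_n) u y z : inG X u y -> inG X u z -> inG X u (y - z).
Proof. by move=> hy hz; apply: inGD hy (inGN hz). Qed.

Lemma inGM n (X : 'M[K]_n) u y : inG X u y -> inG X u (y *m X).
Proof. by move=> [q ->]; exists (q * 'X); rewrite hmxM hmxX mulmxA. Qed.

Lemma inG_sum n (X : 'M[K]_n) u (I : finType) (P : pred I) (F : I -> 'rV_n) :
  (forall i, P i -> inG X u (F i)) -> inG X u (\sum_(i | P i) F i).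
Proof. by move=> h; apply: (big_ind (inG X u)) => //; [apply: inG0|apply: inGD]. Qed.

Lemma inG_delta n (X : 'M[K]_n) u : (forall i, inG X u (delta_mx 0 i)) -> gen X u.
Proof.
move=> h y; rewrite -/(inG X u y) [y]row_sum_delta.
by apply: inG_sum => i _; apply/inGZ/h.
Qed.

(** A nonzero diagonal entry is moved to the corner by a transposition. If the diagonal vanishes,
    conjugation by the elementary matrix [1 + E] copies a nonzero entry [N i j] to position
    [(j, j)]. *)
Lemma simx_nz_corner n (N : 'M[K]_n.+1) : N != 0 ->
  exists2 N' : 'M[K]_n.+1, simx N N' & N' 0 0 != 0.
Proof.
move=> N0.
have diag (M : 'M[K]_n.+1) i : M i i != 0 ->
    exists2 N' : 'M[K]_n.+1, simx M N' & N' 0 0 != 0.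
  move=> Mi; exists (tperm_mx i 0 *m M *m tperm_mx i 0).
    by apply: simx_conj; rewrite /tperm_mx -perm_mxM tperm2 perm_mx1.
  by rewrite -xcolE -xrowE !mxE tpermR.
have [[i Ni]|nd] := EM (exists i, N i i != 0); first exact: diag Ni.
have [i [j Nij]] : exists i j, N i j != 0.
  apply: contrapT => h; move/eqP: N0; apply; apply/matrixP => i j; rewrite mxE.
  by apply/eqP; apply: contrapT => /negP ?; apply: h; exists i, j.
have z k : N k k = 0.
  by apply/eqP; apply: contrapT => /negP ?; apply: nd; exists k.
have ij : i != j by apply: contraNneq Nij => ->; rewrite z.
pose E : 'M[K]_n.+1 := delta_mx j i.
have EE : E *m E = 0 by rewrite mul_delta_mx_0.
have s : simx N ((1%:M + E) *m N *m (1%:M - E)).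
  apply: simx_conj.
    by rewrite mulmxDr mulmx1 mulmxBl mul1mx EE subr0 subrK.
  by rewrite mulmxBr mulmx1 mulmxDl mul1mx EE addr0 addrK.
have [|N' sN' h] := diag ((1%:M + E) *m N *m (1%:M - E)) j.
  rewrite mulmxDl mul1mx mulmxBr mulmx1 !mxE z add0r.
  rewrite (bigD1 i) //= !mxE !eqxx mul1r big1 ?addr0; last first.
    by move=> k ki; rewrite !mxE (negbTE ki) andbF mul0r.
  rewrite big1 ?subr0 // => k _.
  by rewrite !mxE (eq_sym j i) (negbTE ij) andbF mulr0.
by exists N' => //; apply: simx_trans s sN'.
Qed.

Lemma simx_diag_conj n1 n2 A X Y (B : 'M[K]_n2) (T T' : 'M[K]_n2) :
  T *m T' = 1%:M -> T' *m T = 1%:M ->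
  simx (block_mx A X Y B : 'M_(n1 + n2)) (block_mx A (X *m T) (T' *m Y) (T' *m B *m T)).
Proof.
move=> h1 h2; exists (block_mx 1%:M 0 0 T), (block_mx 1%:M 0 0 T').
rewrite !mulmx_block !mulmx0 !mul0mx !mulmx1 !mul1mx !addr0 !add0r h1 h2.
by rewrite -!scalar_mx_block !mulmxA h1 !mul1mx.
Qed.

(** Similarity replaces pivoting: once the corner is nonzero, one elimination step leaves a Schur
    complement [S], and the conjugation that factors [S] extends by 1 to the whole matrix. *)
Lemma simx_LU n (N : 'M[K]_n) : N \in unitmx ->
  exists L, exists U : 'M[K]_n,
    [/\ simx N (L *m U), is_trig_mx L & is_trig_mx U^T].
Proof.
elim: n N => [|n IH] N uN.
  exists 1%:M, N; rewrite mul1mx; split; first exact: simx_refl.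
    by apply/is_trig_mxP => -[].
  by apply/is_trig_mxP => -[].
have N0 : N != 0.
  by apply: contraTneq uN => ->; rewrite unitmxE det0 unitr0.
have [N' sN nz] := simx_nz_corner N0.
have uN' := simx_unitmx sN uN.
rewrite -[N'](@submxK _ 1 n 1 n) in sN uN' nz.
set c := ulsubmx _ in sN uN' nz; set r := ursubmx _ in sN uN' nz.
set l := dlsubmx _ in sN uN' nz; set B := drsubmx _ in sN uN' nz.
have {}nz : c 0 0 != 0 by rewrite -(block_mxEul c r l B) ; move: nz;
  congr (block_mx _ _ _ _ _ _ != 0); apply: val_inj.
pose S := B - (c 0 0)^-1 *: (l *m r).
have cE : c = (c 0 0)%:M by exact: mx11_scalar.
have fac : block_mx c r l B =
    block_mx 1%:M 0 ((c 0 0)^-1 *: l) 1%:M *m block_mx c r 0 S.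
  rewrite mulmx_block !mul1mx !mul0mx !addr0; congr block_mx.
    by rewrite [in X in _ *m X]cE mul_mx_scalar scalerA divff // scale1r.
  by rewrite /S -scalemxAl addrC subrK.
have uS : S \in unitmx.
  move: uN'; rewrite fac unitmx_mul => /andP[_].
  by rewrite unitmxE (det_ublock c r S) unitrM => /andP[_]; rewrite -unitmxE.
have [L' [U' [[T [T' [h1 h2 h3]]] tL tU]]] := IH _ uS.
exists (block_mx 1%:M 0 (T' *m ((c 0 0)^-1 *: l)) L' : 'M_(1 + n)).
exists (block_mx c (r *m T) 0 U' : 'M_(1 + n)).
split.
- refine (simx_trans sN _).
  refine (simx_trans (@simx_diag_conj 1 _ c r l B _ _ h1 h2) _).
  rewrite (@mulmx_block _ 1 n 1 n 1 n) !mul1mx !mul0mx !addr0.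
  have -> : T' *m ((c 0 0)^-1 *: l) *m c = T' *m l.
    by rewrite [in X in _ *m X]cE mul_mx_scalar -scalemxAr scalerA divff // scale1r.
  have -> : L' *m U' = T' *m S *m T by rewrite -mulmxA h3 mulmxA h2 mul1mx.
  have -> : T' *m ((c 0 0)^-1 *: l) *m (r *m T) + T' *m S *m T = T' *m B *m T.
    rewrite /S mulmxBr mulmxBl -!scalemxAr -!scalemxAl -!mulmxA.
    by rewrite addrC subrK.
  by rewrite mulmx0 addr0; apply: simx_refl.
- rewrite (@is_trig_block_mx _ 1 n 1 n) // eqxx tL andbT; apply/is_trig_mxP => i j.
  by rewrite !ord1.
rewrite (@tr_block_mx _ 1 n 1 n) (@is_trig_block_mx _ 1 n 1 n) // trmx0 eqxx tU andbT.
by apply/is_trig_mxP => i j; rewrite !ord1.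
Qed.

Lemma trig_unit_diag n (L : 'M[K]_n) i : is_trig_mx L -> L \in unitmx -> L i i != 0.
Proof.
by move=> tL; rewrite unitmxE det_trig // unitfE => /prodf_neq0; apply.
Qed.

Definition cshift n : 'M[K]_n.+1 := perm_mx (perm (@ordS_inj n.+1)).

Lemma delta_cshift n (i : 'I_n.+1) :
  delta_mx 0 i *m cshift n = delta_mx 0 (ordS i) :> 'rV[K]_n.+1.
Proof. by rewrite -rowE /cshift; apply/rowP => j; rewrite !mxE permE eq_sym. Qed.

(** Row [j] of [L] ends at its nonzero diagonal entry, so after the shift the image of basis vector
    [j] is a nonzero multiple of vector [j + 1] plus earlier ones; the basis is reached in
    increasing order. *)
Lemma gen_lower_shift n (L : 'M[K]_n.+1) : is_trig_mx L -> L \in unitmx ->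
  gen (L *m cshift n) (delta_mx 0 0).
Proof.
move=> tL uL; apply: inG_delta => i.
have [k] := ubnP (nat_of_ord i); elim: k i => // k IH i lek.
case: (posnP i) => [i0|i0].
  have -> : i = 0 by apply: val_inj.
  exact: inG_id.
have lt : (i.-1 < n.+1)%N by rewrite (leq_ltn_trans (leq_pred _)).
pose j := Ordinal lt.
have Lj := trig_unit_diag j tL uL.
have sj : ordS j = i.
  by apply: val_inj; rewrite /= prednK // modn_small.
have e : (delta_mx 0 j : 'rV_n.+1) *m (L *m cshift n) =
   L j j *: delta_mx 0 i + \sum_(l | l != j) L j l *: delta_mx 0 (ordS l).
  rewrite mulmxA -rowE [row j L]row_sum_delta mulmx_suml (bigD1 j) //=.
  rewrite -scalemxAl delta_cshift sj !mxE; congr (_ + _).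
  by apply: eq_bigr => l _; rewrite -scalemxAl delta_cshift mxE.
have -> : (delta_mx 0 i : 'rV_n.+1) = (L j j)^-1 *: (delta_mx 0 j *m (L *m cshift n) -
    \sum_(l | l != j) L j l *: delta_mx 0 (ordS l)).
  by rewrite e addrK scalerA mulVf // scale1r.
apply/inGZ/inGB.
  by apply/inGM/IH => /=; rewrite -ltnS prednK.
apply: inG_sum => l lj; case: (ltnP l j) => [ltlj|lejl].
  apply/inGZ/IH; rewrite /= modn_small; last by rewrite ltnS (leq_trans ltlj) // -ltnS.
  by move: ltlj lek i0 => /= *; lia.
have -> : L j l = 0.
  by apply/(is_trig_mxP tL); rewrite ltn_neqAle lejl andbT eq_sym.
by rewrite scale0r; apply: inG0.
Qed.

(** Here the basis is reached in decreasing order: vector 0 wraps around to the last one, and vector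
    [i + 1] is sent to a multiple of vector [i] plus later ones. *)
Lemma gen_upper_shift n (U : 'M[K]_n.+1) : is_trig_mx U^T -> U \in unitmx ->
  gen (invmx (cshift n) *m U) (delta_mx 0 0).
Proof.
move=> tU uU; have uS : cshift n \in unitmx by apply: unitmx_perm.
have dS (i : 'I_n.+1) : delta_mx 0 (ordS i) *m invmx (cshift n) = delta_mx 0 i :> 'rV[K]_n.+1.
  by rewrite -delta_cshift mulmxK.
have step (i : 'I_n.+1) : inG (invmx (cshift n) *m U) (delta_mx 0 0) (delta_mx 0 (ordS i)) ->
    (forall l : 'I_n.+1, (i < l)%N -> inG (invmx (cshift n) *m U) (delta_mx 0 0) (delta_mx 0 l)) ->
    inG (invmx (cshift n) *m U) (delta_mx 0 0) (delta_mx 0 i).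
  move=> h hl.
  have Ui : U i i != 0.
    by have := trig_unit_diag i tU; rewrite unitmx_tr => /(_ uU); rewrite mxE.
  have e : (delta_mx 0 (ordS i) : 'rV_n.+1) *m (invmx (cshift n) *m U) =
     U i i *: delta_mx 0 i + \sum_(l | l != i) U i l *: delta_mx 0 l.
    rewrite mulmxA dS -rowE [row i U]row_sum_delta (bigD1 i) //= mxE.
    by congr (_ + _); apply: eq_bigr => l _; rewrite mxE.
  have -> : (delta_mx 0 i : 'rV_n.+1) = (U i i)^-1 *: (delta_mx 0 (ordS i) *m (invmx (cshift n) *m U) -
      \sum_(l | l != i) U i l *: delta_mx 0 l).
    by rewrite e addrK scalerA mulVf // scale1r.
  apply/inGZ/inGB; first exact: inGM.
  apply: inG_sum => l li; case: (ltnP i l) => [ltil|leli].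
    exact/inGZ/hl.
  have -> : U i l = 0.
    by have /is_trig_mxP /(_ l i) := tU; rewrite mxE => ->//; rewrite ltn_neqAle li leli.
  by rewrite scale0r; apply: inG0.
apply: inG_delta => i; have [k] := ubnP (n - i)%N; elim: k i => // k IH i lek.
apply: step; last by move=> l il; apply: IH; have := ltn_ord l; lia.
case: (ltnP i n) => ni.
  by apply: IH; rewrite /= modn_small ?ltnS //; lia.
have -> : ordS i = 0.
  have -> : i = ord_max by apply: val_inj => /=; have := ltn_ord i; lia.
  by apply: val_inj; rewrite /= modnn.
exact: inG_id.
Qed.

(* With [N] similar to a product [L *m U] of triangular matrices and [S] the
   cyclic shift, both [invmx U *m S] and [L *m S] move along a coordinate flag. *)
Lemma common_cyclic_vector n (N : 'M[K]_n.+1) d : N \in unitmx -> d != 0 ->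
  exists Th : 'M[K]_n.+1, exists w,
    [/\ \det Th = d, gen Th w & gen (N *m Th) w].
Proof.
move=> uN d0; have [L [U0 [sN tL tU0]]] := simx_LU uN.
have : L *m U0 \in unitmx := simx_unitmx sN uN.
rewrite unitmx_mul => /andP[uL uU0].
have uS : cshift n \in unitmx by apply: unitmx_perm.
have dS : \det (cshift n) != 0 by rewrite -unitfE -unitmxE.
have dU : \det U0 != 0 by rewrite -unitfE -unitmxE.
(* The product [L *m U0] does not change when [D x] and its inverse are inserted between the
   factors; this freedom is used to give [Th] the determinant [d]. *)
pose x := d * \det U0 / \det (cshift n).
have x0 : x != 0 by rewrite !mulf_neq0 ?invr_eq0.
pose rD (y : K) : 'rV[K]_n.+1 := \row_i (if i == 0 then y else 1).
pose D y := diag_mx (rD y).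
have DD : D x *m D x^-1 = 1%:M.
  rewrite mulmx_diag -diag_const_mx; congr diag_mx; apply/rowP => i; rewrite !mxE.
  by case: eqP; rewrite ?mulr1 // divff.
have [uDx uDv] := mulmx1_unit DD.
have dD : \det (D x^-1) = x^-1.
  rewrite det_diag (bigD1 0) //= mxE eqxx big1 ?mulr1 // => i i0.
  by rewrite mxE (negbTE i0).
pose U := D x^-1 *m U0.
have uU : U \in unitmx by rewrite unitmx_mul uDv.
have tU : is_trig_mx U^T.
  rewrite /U trmx_mul tr_diag_mx; apply/is_trig_mxP => i j ij.
  rewrite mxE big1 // => l _; rewrite mxE /D !mxE.
  have [->|lj] := eqVneq l j; last by rewrite mulr0n mulr0.
  by have /is_trig_mxP /(_ i j ij) := tU0; rewrite mxE => ->; rewrite mul0r.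
have tLD : is_trig_mx (L *m D x).
  apply/is_trig_mxP => i j ij; rewrite mxE big1 // => l _; rewrite !mxE.
  have [->|lj] := eqVneq l j; last by rewrite mulr0n mulr0.
  by have /is_trig_mxP -> := tL; rewrite ?mul0r.
pose Th0 := invmx U *m cshift n.
have g1 : gen Th0 (delta_mx 0 0).
  have -> : Th0 = invmx (invmx (cshift n) *m U).
    have e : Th0 *m (invmx (cshift n) *m U) = 1%:M.
      by rewrite /Th0 mulmxA mulmxK // mulVmx.
    have [_ u2] := mulmx1_unit e.
    by rewrite -[LHS](mulmxK u2) e mul1mx.
  apply: gen_invmx; last exact: gen_upper_shift.
  by rewrite unitmx_mul unitmx_inv uS.
have g2 : gen (L *m U0 *m Th0) (delta_mx 0 0).
  have -> : L *m U0 *m Th0 = L *m D x *m cshift n.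
    rewrite /Th0 !mulmxA; congr (_ *m _); rewrite -[RHS](mulmxK uU) /U.
    by rewrite !mulmxA -(mulmxA L (D x)) DD mulmx1.
  by apply: gen_lower_shift; rewrite // unitmx_mul uL.
have [T [T' [h1 h2 h3]]] := sN.
exists (T *m Th0 *m T'), (delta_mx 0 0 *m T'); split.
- have dT : \det T * \det T' = 1 by rewrite -det_mulmx h1 det1.
  rewrite (det_mulmx (T *m Th0)) (det_mulmx T) mulrAC dT mul1r /Th0 det_mulmx det_inv.
  by rewrite /U det_mulmx dD /x; field; rewrite dS dU d0.
- apply: (gen_sim h2 h1) g1; rewrite !mulmxA h2 mul1mx //.
apply: (gen_sim h2 h1) g2.
by rewrite !mulmxA -(mulmxA T' N) h3 !mulmxA h2 mul1mx.
Qed.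

(** [v] is the last vector of the basis dual to the Krylov basis of [rho]. *)
Definition dual_pair k (P : 'M[K]_k) (rho : 'rV_k) (v : 'cV_k) : Prop :=
  forall q : {poly K}, (size q <= k)%N -> rho *m hmx P q *m v = (q`_k.-1)%:M.

Lemma gen_dual k (P : 'M[K]_k) rho : (0 < k)%N -> gen P rho ->
  exists v, dual_pair P rho v.
Proof.
move=> k0 gP; have uKr := gen_kryl gP; have ltk : (k.-1 < k)%N by rewrite prednK.
exists (invmx (kryl P rho) *m delta_mx (Ordinal ltk) 0) => q sq.
rewrite -{1}(poly_rV_K sq) -row_kryl_poly mulmxA mulmxK // -colE.
by apply/matrixP => i j; rewrite !ord1 !mxE.
Qed.

(** Duality is symmetric under transposition, so [rho] comes from [gen_dual] for [P^T]. It is cyclic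
    because a nonzero [q] killing it, multiplied by a power of [x] up to degree [n], would have
    leading coefficient 0. *)
Lemma dual_cyclic_vector n (P : 'M[K]_n.+1) (v : 'cV[K]_n.+1) : gen P^T v^T ->
  exists2 rho : 'rV[K]_n.+1, gen P rho & dual_pair P rho v.
Proof.
move=> g; have [v' hv'] := gen_dual (ltn0Sn n) g; set rho := v'^T.
have hr : dual_pair P rho v.
  move=> q sq; move/(congr1 trmx): (hv' q sq).
  by rewrite hmx_tr !trmx_mul !trmxK tr_scalar_mx mulmxA.
exists rho => //.
suff uKr : kryl P rho \in unitmx.
  move=> y; exists (rVpoly (y *m invmx (kryl P rho))).
  by rewrite -row_kryl_poly mulmxKV.
rewrite -row_free_unit -kermx_eq0; apply/eqP/row_matrixP => i; rewrite row0.
set r := row i _; have : r *m kryl P rho = 0 by rewrite -row_mul mulmx_ker row0.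
rewrite row_kryl_poly; set q := rVpoly r => hq.
have [q0|q0] := eqVneq q 0; first by rewrite -(rVpolyK r) -/q q0 linear0.
have sq : (size q <= n.+1)%N by apply: size_poly.
have sq0 : (0 < size q)%N by rewrite size_poly_gt0.
have := hr (q * 'X^(n.+1 - size q)); rewrite size_mulXn // subnK // => /(_ (leqnn _)).
rewrite hmxM mulmxA hq !mul0mx => /matrixP /(_ 0 0) /eqP; rewrite !mxE eqxx mulr1n.
rewrite coefMXn ifF; last by lia.
have -> : (n - (n.+1 - size q) = (size q).-1)%N by lia.
by rewrite eq_sym -/(lead_coef q) lead_coef_eq0 (negbTE q0).
Qed.

End SimultaneousCyclicVector.

(** * Pole placement *)

Section PolePlacement.

Variable K : fieldType.

(* In a module where [e_(i+1) = x e_i - g_i], [c(x) e_0] is congruent to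
   [Eop g c] modulo [c] applied to the shift of the [e_i]. *)
Definition Eop (g : nat -> {poly K}) (c : {poly K}) : {poly K} :=
  \sum_(j < size c) c`_j *: \sum_(i < j) g i * 'X^(j.-1 - i).

(** For monic [c] the cofactors of the [g i] are monic of strictly decreasing degrees, which makes
    [Eop g c = t] a triangular system for [g]. *)
Lemma Eop_drop g c : Eop g c = \sum_(i < (size c).-1) g i * drop_poly i.+1 c.
Proof.
rewrite /Eop.
have -> : \sum_(j < size c) c`_j *: (\sum_(i < j) g i * 'X^(j.-1 - i)) =
  \sum_(j < size c) \sum_(i < (size c).-1 | (i < j)%N) c`_j *: (g i * 'X^(j.-1 - i)).
  apply: eq_bigr => j _; rewrite scaler_sumr.
  rewrite (big_ord_widen_cond (size c).-1 xpredT (fun i => c`_j *: (g i * 'X^(j.-1 - i)))) //.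
  by have := ltn_ord j; lia.
rewrite (exchange_big_dep xpredT) //=; apply: eq_bigr => i _.
have -> : drop_poly i.+1 c = \sum_(j < size c | (i < j)%N) c`_j *: 'X^(j.-1 - i).
  have lti := ltn_ord i.
  rewrite -(big_mkord (fun j => (i < j)%N) (fun j => c`_j *: 'X^(j.-1 - i))).
  rewrite (@big_cat_nat _ _ _ i.+1) /=; [|by []|by lia].
  rewrite big_nat_cond big1 ?add0r; last by move=> j h; exfalso; move: h; lia.
  rewrite big_nat_cond (eq_bigl (fun j => (i.+1 <= j < size c)%N && true)); last first.
    by move=> j /=; case: (ltnP i j) => _; rewrite ?andbT ?andbF.
  rewrite -big_nat_cond.
  rewrite -[X in \sum_(X <= _ < _) _]add0n big_addn big_mkord.
  rewrite -[in LHS](coefK (drop_poly _ _)) poly_def size_drop_poly.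
  apply: eq_bigr => j _; rewrite coef_drop_poly.
  by rewrite addnS /= addnK.
rewrite mulr_sumr; apply: eq_bigr => j _.
by rewrite scalerAr.
Qed.

Section Companion.

Variables (k1 k2 : nat) (P : 'M[K]_k1) (rho : 'rV[K]_k1) (v : 'cV[K]_k1).
Variables (Gam : 'M[K]_k2) (w : 'rV[K]_k2) (p c : {poly K}).
Variables (G : 'M[K]_(k2, k1)) (g : nat -> {poly K}).
Hypothesis k1_gt0 : (0 < k1)%N.
Hypothesis genP : gen P rho.
Hypothesis rhov : forall q : {poly K}, (size q <= k1)%N ->
  rho *m hmx P q *m v = (q`_k1.-1)%:M.
Hypothesis pmon : p \is monic.
Hypothesis psize : size p = k1.+1.
Hypothesis rhop : rho *m hmx P p = 0.
Hypothesis uGam : Gam \in unitmx.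
Hypothesis genw : gen Gam w.
Hypothesis cmon : c \is monic.
Hypothesis csize : size c = k2.+1.
Hypothesis wc : w *m hmx Gam c = 0.
Hypothesis gsize : forall i, (size (g i) <= k1)%N.
Hypothesis gE : forall i, (i < k2)%N -> w *m Gam ^+ i *m G = rho *m hmx P (g i).

(** Up to conjugation this is the block triangular matrix with diagonal [P], [Gam] and corner [G],
    times a unipotent factor that depends on [v] and [w] only. *)
Let H : 'M[K]_(k1 + k2) :=
  block_mx (P - v *m w *m G) (- (v *m w *m Gam)) G Gam.
Let u : 'rV[K]_(k1 + k2) := row_mx rho 0.

(** Before degree [k1] is reached [v] only meets zero coefficients, so the terms of [H] through [v]
    do not act and [u] moves as [rho] does under [P]. *)
Lemma pole_step (q : {poly K}) : (size q <= k1)%N ->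
  u *m hmx H q = row_mx (rho *m hmx P q) 0.
Proof.
elim/poly_ind: q => [|q a IH] sq; first by rewrite !hmx0 !mulmx0 row_mx0.
have sq' : (size q < k1)%N \/ q = 0.
  have [->|q0] := eqVneq q 0; first by right.
  by left; move: sq; rewrite size_MXaddC (negbTE q0).
have sq2 : (size q <= k1)%N by case: sq' => [/ltnW//|->]; rewrite size_poly0.
have z : rho *m hmx P q *m v = 0.
  rewrite rhov //; have -> : q`_k1.-1 = 0.
    by case: sq' => [lt|->]; rewrite ?coef0 // nth_default // -ltnS prednK.
  by rewrite raddf0.
rewrite !hmxD !hmxM !hmxX !hmxC !mulmxDr !mulmxA IH // /H mul_row_block.
rewrite mulmxBr mulmxN !mulmxA z !mul0mx subr0 oppr0 !addr0.
by rewrite /u !mul_mx_scalar scale_row_mx scaler0 add_row_mx addr0.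
Qed.

(** [v] acts exactly once, on the leading coefficient of [p]; since [P] alone returns to 0, only the
    term through [w] remains. *)
Lemma pole_wrap : u *m hmx H p = - (row_mx 0 w *m H).
Proof.
have [q [a pE]] : exists q, exists a, p = q * 'X + a%:P.
  elim/poly_ind: p => [|q a _]; first by exists 0, 0; rewrite mul0r add0r.
  by exists q, a.
have q0 : q != 0.
  apply/eqP => q0; have := psize; rewrite pE q0 mul0r add0r.
  by have := size_polyC_leq1 a; have := k1_gt0; lia.
have sq : size q = k1.
  by have := psize; rewrite pE size_MXaddC (negbTE q0) /= => -[].
have lq : q`_k1.-1 = 1.
  have := pmon; rewrite monicE /lead_coef psize pE coefD coefMX coefC /=.
  by rewrite eqn0Ngt k1_gt0 /= addr0 => /eqP.
have rv : rho *m hmx P q *m v = 1%:M by rewrite rhov ?sq ?lq.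
have rp := rhop; rewrite pE hmxD hmxM hmxX hmxC mulmxDr mulmxA in rp.
rewrite pE hmxD hmxM hmxX hmxC mulmxDr mulmxA pole_step ?sq // /H !mul_row_block.
rewrite mulmxBr mulmxN !mulmxA rv !mul1mx !mul0mx !addr0 !add0r.
rewrite /u mul_mx_scalar scale_row_mx scaler0 add_row_mx addr0.
rewrite addrAC -mul_mx_scalar rp add0r opp_row_mx //.
Qed.

Lemma pole_pow j : (j <= k2)%N ->
  row_mx 0 w *m H ^+ j = row_mx 0 (w *m Gam ^+ j) +
     u *m hmx H (\sum_(i < j) g i * 'X^(j.-1 - i)).
Proof.
elim: j => [|j IH] lej.
  by rewrite !expr0 !mulmx1 big_ord0 hmx0 mulmx0 addr0.
rewrite exprSr -[_ * H]/(_ *m H) mulmxA IH 1?ltnW // mulmxDl.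
rewrite {1}/H mul_row_block !mul0mx !add0r gE // -mulmxA -[_ *m Gam]/(_ * _) -exprSr.
have -> : row_mx (rho *m hmx P (g j)) (w *m Gam ^+ j.+1) =
   row_mx 0 (w *m Gam ^+ j.+1) + u *m hmx H (g j).
  by rewrite pole_step // add_row_mx add0r addr0.
rewrite -addrA; congr (_ + _); rewrite -mulmxA -[X in _ + _ *m (_ *m X)](hmxX H) -hmxM -mulmxDr -hmxD.
congr (_ *m hmx H _); rewrite big_ord_recr /= subnn expr0 mulr1 addrC; congr (_ + _).
rewrite mulr_suml; apply: eq_bigr => i _; rewrite -mulrA -exprSr.
by congr (_ * 'X^ _); have := ltn_ord i; lia.
Qed.

Lemma pole_c : row_mx 0 w *m hmx H c = u *m hmx H (Eop g c).
Proof.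
have -> : hmx H c = \sum_(j < size c) c`_j *: H ^+ j by exact: hmxE.
rewrite mulmx_sumr.
rewrite (eq_bigr (fun j : 'I_(size c) => row_mx 0 (w *m (c`_j *: Gam ^+ j)) +
   u *m hmx H (c`_j *: (\sum_(i < j) g i * 'X^(j.-1 - i))))); last first.
  move=> j _; rewrite -scalemxAr pole_pow; last by rewrite -ltnS -csize.
  by rewrite scalerDr hmxZ -!scalemxAr scale_row_mx scaler0.
rewrite big_split /= /Eop hmx_sum mulmx_sumr.
suff -> : \sum_(i < size c) row_mx 0 (w *m (c`_i *: Gam ^+ i)) = 0 :> 'rV[K]_(k1 + k2).
  by rewrite add0r.
have -> : \sum_(i < size c) row_mx 0 (w *m (c`_i *: Gam ^+ i)) =
   row_mx 0 (\sum_(i < size c) w *m (c`_i *: Gam ^+ i)) :> 'rV[K]_(k1 + k2).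
  elim/big_ind2: _ => [|x1 x2 y1 y2 -> ->|//]; first by rewrite row_mx0.
  by rewrite add_row_mx addr0.
by rewrite -mulmx_sumr -hmxE wc row_mx0.
Qed.

Lemma pole_gen : gen H u.
Proof.
have in1 y : inG H u (row_mx y 0).
  have [q sq ->] := gen_small y genP.
  by exists q; rewrite pole_step.
have in2 q : inG H u (row_mx 0 (w *m Gam *m hmx Gam q)).
  have base : inG H u (row_mx 0 (w *m Gam)).
    have : inG H u (row_mx 0 w *m H).
      by exists (- p); rewrite hmxN mulmxN pole_wrap opprK.
    rewrite {1}/H mul_row_block !mul0mx !add0r => h.
    have := inGB h (in1 (w *m G)).
    by rewrite opp_row_mx add_row_mx subrr oppr0 addr0.
  elim/poly_ind: q => [|q a IH]; first by rewrite hmx0 mulmx0 row_mx0; apply: inG0.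
  rewrite hmxD hmxM hmxX hmxC mulmxDr mulmxA.
  have -> : row_mx 0 (w *m Gam *m hmx Gam q *m Gam + w *m Gam *m a%:M) =
     (row_mx 0 (w *m Gam *m hmx Gam q) *m H - row_mx (w *m Gam *m hmx Gam q *m G) 0)
       + a *: row_mx 0 (w *m Gam) :> 'rV[K]_(k1 + k2).
    rewrite {1}/H mul_row_block !mul0mx !add0r opp_row_mx add_row_mx scale_row_mx.
    by rewrite add_row_mx subrr scaler0 oppr0 !addr0 mul_mx_scalar.
  by apply: inGD; [apply: inGB; [apply: inGM|] | apply: inGZ].
move=> y; rewrite -/(inG H u y) -[y]hsubmxK.
have -> : row_mx (lsubmx y) (rsubmx y) = row_mx (lsubmx y) 0 + row_mx 0 (rsubmx y).
  by rewrite add_row_mx add0r addr0.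
apply: inGD (in1 _) _.
have [q qE] := genw (rsubmx y *m invmx Gam).
have -> : rsubmx y = w *m Gam *m hmx Gam q by rewrite -mulmxA -hmxS mulmxA -qE mulmxKV.
exact: in2.
Qed.

(** By [pole_wrap] and [pole_c], [u p(H) c(H)] equals [- u (Eop g c)(H) H], so this polynomial kills
    the generator [u]. It is monic of full degree because the second summand has smaller degree. *)
Lemma pole_placement : cycp H (p * c + 'X * Eop g c).
Proof.
have p0 := monic_neq0 pmon; have c0 := monic_neq0 cmon.
have spc : size (p * c) = (k1 + k2).+1.
  by rewrite size_mul // psize csize addnS.
have sE : (size ('X * Eop g c)%R < (k1 + k2).+1)%N.
  rewrite mulrC; apply: leq_ltn_trans (size_polyMleq _ _) _.
  rewrite size_polyX addn2 /= ltnS.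
  rewrite Eop_drop csize /=; apply: leq_ltn_trans (size_sum _ _ _) _.
  apply: (@leq_ltn_trans (k1 + k2).-1); last by have := k1_gt0; lia.
  apply/bigmax_leqP => i _; apply: leq_trans (size_polyMleq _ _) _.
  rewrite size_drop_poly csize; have := gsize i; have := ltn_ord i.
  by move: (size (g i)) => *; lia.
apply: (gen_cycp pole_gen).
- by rewrite monicE lead_coefDl ?spc // lead_coefM (monicP pmon) (monicP cmon) mulr1.
- by rewrite size_polyDl spc.
rewrite hmxD hmxM mulmxDr mulmxA pole_wrap mulNmx -mulmxA -hmxS mulmxA pole_c.
by rewrite mulrC hmxM hmxX mulmxA addNr.
Qed.

End Companion.

(** Dividing [t] by [drop_poly 1 c] gives [g 0], whose size fits by the bound on [t]. The remainder
    is expanded in the other [drop_poly i.+1 c], monic of all lower degrees, with constant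
    coefficients. *)
Lemma Eop_surj k1 k2 (c t : {poly K}) : (0 < k1)%N -> (0 < k2)%N ->
  c \is monic -> size c = k2.+1 -> (size t <= (k1 + k2).-1)%N ->
  exists2 g : nat -> {poly K}, forall i, (size (g i) <= k1)%N & Eop g c = t.
Proof.
move=> k1_gt0 k2_gt0 mc sc st.
have hmon i : (i < k2)%N -> drop_poly i.+1 c \is monic /\
    size (drop_poly i.+1 c) = (k2 - i)%N.
  move=> ik; have sz : size (drop_poly i.+1 c) = (k2 - i)%N.
    by rewrite size_drop_poly sc; lia.
  split=> //; rewrite monicE /lead_coef sz coef_drop_poly.
  have -> : ((k2 - i).-1 + i.+1 = k2)%N by lia.
  by move: mc; rewrite monicE /lead_coef sc.
have low j : (j < k2)%N -> forall s : {poly K}, (size s <= j)%N ->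
  exists a : nat -> K, s = \sum_(i < k2 | (k2 - j <= i)%N) (a i)%:P * drop_poly i.+1 c.
  elim: j => [|j IH] jk s ss.
    exists (fun=> 0); rewrite big1 ?(size_poly_leq0P _ ss) //.
      by move=> i _; rewrite mul0r.
  pose i0 := (k2 - j.+1)%N.
  have lti0 : (i0 < k2)%N by rewrite /i0; lia.
  have [hm hs] := hmon _ lti0.
  have hs' : size (drop_poly i0.+1 c) = j.+1 by rewrite hs /i0; lia.
  pose s' := s - (s`_j)%:P * drop_poly i0.+1 c.
  have [|a aE] := IH (ltnW jk) s'.
    apply/leq_sizeP => l; rewrite leq_eqVlt => /orP[/eqP <-|lt].
      rewrite coefB coefCM; move: hm; rewrite monicE /lead_coef hs' => /eqP ->.
      by rewrite mulr1 subrr.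
    have e1 : s`_l = 0 by rewrite nth_default // (leq_trans ss).
    have e2 : (drop_poly i0.+1 c)`_l = 0 by rewrite nth_default // hs'.
    by rewrite coefB coefCM e1 e2 mulr0 subrr.
  exists (fun i => if i == i0 then s`_j else a i).
  rewrite (bigD1 (Ordinal lti0)) /=; last by rewrite /i0.
  rewrite eqxx -[LHS](subrK ((s`_j)%:P * drop_poly i0.+1 c)) addrC; congr (_ + _).
  rewrite -/s' aE; apply: eq_big => [i|i h].
    rewrite -val_eqE /= /i0; lia.
  by rewrite ifF //; apply/negbTE; rewrite /i0; lia.
have [m0 s0] := hmon 0%N k2_gt0; rewrite subn0 in s0.
set h0 := drop_poly 1 c in m0 s0.
have h00 : h0 != 0 by apply: monic_neq0.
have sr : (size (t %% h0)%R <= k2.-1)%N.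
  by rewrite -ltnS prednK // -s0 ltn_modp.
have [|a aE] := low k2.-1 _ _ sr; first by rewrite prednK.
exists (fun i => if i == 0%N then t %/ h0 else (a i)%:P).
  move=> i; case: eqP => _; last by rewrite (leq_trans (size_polyC_leq1 _)).
  by rewrite size_divp // s0 leq_subLR (leq_trans st) //; move: k2_gt0; clear; lia.
rewrite Eop_drop sc /= (bigD1 (Ordinal k2_gt0)) //= -/h0.
rewrite [RHS](divp_eq t h0); congr (_ + _); rewrite [RHS]aE.
apply: eq_big => [i|i h]; first by rewrite -val_eqE /=; lia.
by rewrite -val_eqE /= in h; rewrite (negbTE h).
Qed.

Definition glue k1 k2 (P : 'M[K]_k1) (Gam : 'M[K]_k2) (G : 'M[K]_(k2, k1))
    (v : 'cV_k1) (w : 'rV_k2) : 'M[K]_(k1 + k2) :=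
  block_mx (P - v *m w *m G) (- (v *m w *m Gam)) G Gam.

Lemma Eop_add g g' c : Eop (fun i => g i + g' i) c = Eop g c + Eop g' c.
Proof.
by rewrite !Eop_drop -big_split /=; apply: eq_bigr => i _; rewrite mulrDl.
Qed.

Definition gmat k1 k2 (P : 'M[K]_k1) (Gam : 'M[K]_k2) rho w (g : nat -> {poly K}) :=
  invmx (kryl Gam w) *m \matrix_(i < k2) (rho *m hmx P (g i)).

Lemma gmatE k1 k2 (P : 'M[K]_k1) (Gam : 'M[K]_k2) rho w g i : gen Gam w ->
  (i < k2)%N -> w *m Gam ^+ i *m gmat P Gam rho w g = rho *m hmx P (g i).
Proof.
move=> gw ik; have -> : w *m Gam ^+ i = row (Ordinal ik) (kryl Gam w) by rewrite rowK.
by rewrite -row_mul mulmxA mulmxV ?gen_kryl // mul1mx rowK.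
Qed.

Lemma pole_exact k1 k2 (P : 'M[K]_k1) (Gam : 'M[K]_k2) rho v w (b : {poly K})
    (g : nat -> {poly K}) :
  (0 < k1)%N -> gen P rho -> dual_pair P rho v ->
  Gam \in unitmx -> gen Gam w -> (forall i, (size (g i) <= k1)%N) ->
  b = char_poly P * char_poly Gam + 'X * Eop g (char_poly Gam) ->
  cycp (glue P Gam (gmat P Gam rho w g) v w) b.
Proof.
move=> k1_gt0 gP rv uG gw gs ->; apply: pole_placement => //.
- exact: char_poly_monic.
- exact: size_char_poly.
- by rewrite hmx_char mulmx0.
- exact: char_poly_monic.
- exact: size_char_poly.
- by rewrite hmx_char mulmx0.
by move=> i; apply: gmatE.
Qed.

Lemma pole_remainder k1 k2 (P : 'M[K]_k1) (Gam : 'M[K]_k2) (b : {poly K}) :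
  b \is monic -> size b = (k1 + k2).+1 ->
  b`_0 = (char_poly P)`_0 * (char_poly Gam)`_0 ->
  let t := drop_poly 1 (b - char_poly P * char_poly Gam) in
  b = char_poly P * char_poly Gam + 'X * t /\ (size t <= (k1 + k2).-1)%N.
Proof.
move=> mb sb; set p := char_poly P; set c := char_poly Gam => b0 t.
have mp : p \is monic := char_poly_monic _.
have mc : c \is monic := char_poly_monic _.
have spc : size (p * c) = (k1 + k2).+1.
  by rewrite size_mul ?monic_neq0 // !size_char_poly addnS.
have mpc : p * c \is monic by rewrite monicMl.
split.
  have := poly_take_drop 1 (b - p * c); rewrite -/t.
  have -> : take_poly 1 (b - p * c) = 0.
    apply/polyP => -[|i]; rewrite coef_take_poly //= !coef0 //.
    by rewrite coefB b0 coef0M subrr.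
  by rewrite add0r expr1 [t * _]mulrC => ->; rewrite addrC subrK.
rewrite size_drop_poly; suff : (size (b - p * c)%R <= k1 + k2)%N by lia.
apply/leq_sizeP => j; rewrite leq_eqVlt => /orP[/eqP <-|lt].
  move: mb mpc; rewrite !monicE /lead_coef sb spc coefB => /eqP -> /eqP ->.
  by rewrite subrr.
by rewrite coefB !nth_default ?subrr ?sb ?spc.
Qed.

Lemma pole_exists k1 k2 (P : 'M[K]_k1) (Gam : 'M[K]_k2) rho v w b :
  (0 < k1)%N -> (0 < k2)%N -> gen P rho -> dual_pair P rho v ->
  Gam \in unitmx -> gen Gam w -> b \is monic -> size b = (k1 + k2).+1 ->
  b`_0 = (char_poly P)`_0 * (char_poly Gam)`_0 ->
  exists G, cycp (glue P Gam G v w) b.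
Proof.
move=> k1_gt0 k2_gt0 gP rv uG gw mb sb b0.
have [tE st] := pole_remainder mb sb b0.
have [g gs gE] := Eop_surj k1_gt0 k2_gt0 (char_poly_monic Gam) (size_char_poly Gam) st.
by exists (gmat P Gam rho w g); apply: pole_exact => //; rewrite gE.
Qed.

End PolePlacement.

(** * Products of two cyclic classes *)

Section ProductsOfCyclicClasses.

Variable K : fieldType.

Definition inprod n (f f' : {poly K}) (N : 'M[K]_n) : Prop :=
  exists X, exists Y, [/\ N = X *m Y, cycp X f & cycp Y f'].

(** The signs [(-1) ^+ n] of the two determinants cancel, so the constant coefficients multiply to
    the determinant of the product. *)
Definition admissible n (f f' : {poly K}) (d : K) : Prop :=
  [/\ f \is monic, f' \is monic, size f = n.+1, size f' = n.+1
    & f`_0 * f'`_0 = d /\ d != 0].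

Lemma admissible_neq0 n f f' d : admissible n f f' d -> f`_0 != 0 /\ f'`_0 != 0.
Proof. by case=> _ _ _ _ [e d0]; apply/andP; rewrite -negb_or -mulf_eq0 e. Qed.

Lemma admissible_recip0 n f f' : admissible n f f' 1 -> (recip f')`_0 = f`_0.
Proof.
move=> ad; have [_ f'0] := admissible_neq0 ad; have [_ mf' _ _ [e _]] := ad.
by rewrite recip_coef0 // -[LHS]mul1r -e mulfK.
Qed.

Lemma inprod_sim n n' (N : 'M[K]_n) (N' : 'M[K]_n') f f' :
  simx N N' -> inprod f f' N -> inprod f f' N'.
Proof.
move=> s [X [Y [NE cX cY]]]; have [X' [Y' [sX sY N'E]]] := simx_mul s NE.
by exists X', Y'; split=> //; [apply: cycp_sim sX cX | apply: cycp_sim sY cY].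
Qed.

Lemma unit_block_lower n1 n2 (A : 'M[K]_n1) (B : 'M[K]_n2) X :
  (block_mx A 0 X B \in unitmx) = (A \in unitmx) && (B \in unitmx).
Proof. by rewrite !unitmxE det_lblock unitrM. Qed.

Lemma glue_sim k1 k2 (P : 'M[K]_k1) (Gam : 'M[K]_k2) G v w :
  simx (glue P Gam G v w) (block_mx P 0 G Gam *m block_mx 1%:M (- (v *m w)) 0 1%:M).
Proof.
pose U := block_mx 1%:M (- (v *m w)) 0 1%:M : 'M[K]_(k1 + k2).
pose U' := block_mx 1%:M (v *m w) 0 1%:M : 'M[K]_(k1 + k2).
exists U, U'; split.
- by rewrite mulmx_block !mulmx1 !mul1mx !mul0mx !mulmx0 !addr0 !add0r subrr -scalar_mx_block.
- by rewrite mulmx_block !mulmx1 !mul1mx !mul0mx !mulmx0 !addr0 !add0r addNr -scalar_mx_block.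
rewrite mulmxA; congr (_ *m _); rewrite /glue mulmx_block !mul1mx !mul0mx !add0r.
by rewrite !mulNmx.
Qed.

(** [Z] and [N *m Z] share the right factor [U], hence are glued with the same [v] and [w], while
    [G] and [G'] are independent. The corner of [N] is what carries [G] to [G']; then [X = N *m Z]
    and [Y] is the inverse of [Z]. *)
Lemma glue_inprod k1 k2 (N1 P : 'M[K]_k1) (N2 Gam : 'M[K]_k2) G G' v w f f' :
  P \in unitmx -> f' \is monic -> f'`_0 != 0 ->
  cycp (glue P Gam G v w) (recip f') ->
  cycp (glue (N1 *m P) (N2 *m Gam) G' v w) f ->
  inprod f f' (block_mx N1 0 ((G' - N2 *m G) *m invmx P) N2).
Proof.
move=> uP mf' f'0 c2 c1; set N := block_mx N1 _ _ _.
pose U := block_mx 1%:M (- (v *m w)) 0 1%:M : 'M[K]_(k1 + k2).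
pose Z := block_mx P 0 G Gam *m U.
have cZ : cycp Z (recip f') by apply: cycp_sim (glue_sim _ _ _ _ _) c2.
have NZ : N *m Z = block_mx (N1 *m P) 0 G' (N2 *m Gam) *m U.
  rewrite /Z mulmxA; congr (_ *m _); rewrite /N mulmx_block.
  by rewrite !mul0mx !mulmx0 !addr0 add0r mulmxKV // subrK.
have uZ : Z \in unitmx.
  rewrite unitmxE (cycp_det cZ) recip_coef0 // unitfE mulf_neq0 ?signr_eq0 //.
  by rewrite invr_eq0.
exists (N *m Z), (invmx Z); split; first by rewrite mulmxK.
  by rewrite NZ; apply: cycp_sim (glue_sim _ _ _ _ _) c1.
by have := cycp_invmx uZ cZ; rewrite recipK.
Qed.

(** The two gluings must share the column [v], but each may have its own row. Transposing and
    inverting turns this into a common cyclic vector of [Th] and [invmx N^T *m Th]. *)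
Lemma common_cyclic_covector n (N : 'M[K]_n.+1) : N \in unitmx ->
  exists P : 'M[K]_n.+1, exists v : 'cV[K]_n.+1, exists rho, exists rho',
    [/\ P \in unitmx, gen P rho, gen (N *m P) rho',
      dual_pair P rho v & dual_pair (N *m P) rho' v].
Proof.
move=> uN; have uN' : invmx N^T \in unitmx by rewrite unitmx_inv unitmx_tr.
have [Th [w [dT g1 g2]]] := common_cyclic_vector uN' (oner_neq0 K).
have uT : Th \in unitmx by rewrite unitmxE dT unitr1.
pose P := (invmx Th)^T.
have e1 : P^T = invmx Th by rewrite trmxK.
have e2 : (N *m P)^T = invmx (invmx N^T *m Th).
  rewrite trmx_mul e1.
  have e : invmx Th *m N^T *m (invmx N^T *m Th) = 1%:M.
    by rewrite mulmxA mulmxK ?mulVmx // unitmx_tr.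
  have [_ u2] := mulmx1_unit e.
  by rewrite -[LHS](mulmxK u2) e mul1mx.
have [|rho gr hr] := @dual_cyclic_vector _ _ P w^T.
  by rewrite trmxK e1; apply: gen_invmx.
have [|rho' gr' hr'] := @dual_cyclic_vector _ _ (N *m P) w^T.
  by rewrite trmxK e2; apply: gen_invmx => //; rewrite unitmx_mul uN'.
exists P, w^T, rho, rho'; split => //.
by rewrite unitmx_tr unitmx_inv.
Qed.

Lemma inprod_triangular k1 k2 (N1 : 'M[K]_k1) (N2 : 'M[K]_k2) f f' :
  (0 < k1)%N -> (0 < k2)%N -> admissible (k1 + k2) f f' (\det N1 * \det N2) ->
  exists Q, inprod f f' (block_mx N1 0 Q N2).
Proof.
move=> k1_gt0 k2_gt0 ad; have [f0 f'0] := admissible_neq0 ad.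
have [mf mf' sf sf' [ff' dN]] := ad.
have [u1 u2] : N1 \in unitmx /\ N2 \in unitmx.
  by move: dN; rewrite mulf_eq0 negb_or => /andP[d1 d2]; rewrite !unitmxE !unitfE.
case: k1 k1_gt0 => // k1 _ in N1 ad sf sf' ff' dN u1 *.
case: k2 k2_gt0 => // k2 _ in N2 ad sf sf' ff' dN u2 *.
have [P [v [rho [rho' [uP gP gP' rv rv']]]]] := common_cyclic_covector u1.
have dP : \det P != 0 by rewrite -unitfE -unitmxE.
(* The determinant of [Gam] that the constant coefficient of [recip f'] dictates; the condition for
   [f] then follows from admissibility. *)
pose d := (-1) ^+ (k1.+1 + k2.+1) / (f'`_0 * \det P).
have d0 : d != 0 by rewrite mulf_neq0 ?signr_eq0 // invr_eq0 mulf_neq0.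
have [Gam [w [dG g1 g2]]] := common_cyclic_vector u2 d0.
have uG : Gam \in unitmx by rewrite unitmxE dG unitfE.
have s0 := sqr_sign K (k1.+1 + k2.+1).
have c0 : (recip f')`_0 = (char_poly P)`_0 * (char_poly Gam)`_0.
  rewrite recip_coef0 // !char_poly_det dG mulrACA -exprD /d.
  by set s := (-1) ^+ _ in s0 *; rewrite -[LHS]mul1r -s0; field; rewrite dP f'0.
have c1 : f`_0 = (char_poly (N1 *m P))`_0 * (char_poly (N2 *m Gam))`_0.
  rewrite !char_poly_det !det_mulmx mulrACA -exprD dG /d.
  rewrite -[LHS](mulfK f'0) ff'.
  by set s := (-1) ^+ _ in s0 *; rewrite -[LHS]mul1r -s0; field; rewrite dP f'0.
have [G cG] := pole_exists (ltn0Sn _) (ltn0Sn _) gP rv uG g1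
  (recip_monic mf' f'0) (etrans (size_recip mf' f'0) sf') c0.
have uNG : N2 *m Gam \in unitmx by rewrite unitmx_mul u2.
have [G' cG'] := pole_exists (ltn0Sn _) (ltn0Sn _) gP' rv' uNG g2 mf sf c1.
by exists ((G' - N2 *m G) *m invmx P); apply: glue_inprod uP mf' f'0 cG cG'.
Qed.

(* Sylvester's equation removes the corner both from [N] and from the triangular
   matrix of [inprod_triangular], so the two are similar. *)
Lemma inprod_coprime n (N : 'M[K]_n) k1 k2 (N1 : 'M[K]_k1) (N2 : 'M[K]_k2) Q p q f f' :
  (0 < k1)%N -> (0 < k2)%N -> simx N (block_mx N1 0 Q N2) ->
  coprimep p q -> hmx N1 p = 0 -> hmx N2 q = 0 ->
  admissible n f f' (\det N) -> inprod f f' N.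
Proof.
move=> k1_gt0 k2_gt0 sN cpq h1 h2 ad; have nE := simx_size sN; subst n.
rewrite (simx_det sN) det_lblock in ad.
have [Q' cQ'] := inprod_triangular k1_gt0 k2_gt0 ad.
apply: inprod_sim cQ'; apply: simx_trans (simx_lblock_coprime _ cpq h1 h2) _.
exact: simx_trans (simx_sym (simx_lblock_coprime Q cpq h1 h2)) (simx_sym sN).
Qed.

Definition LUsim n m k (M : 'M[K]_n) (P : 'M[K]_m) (N : 'M[K]_k) : Prop :=
  exists A, exists B, exists C, [/\ simx M (block_mx A B C N), N \in unitmx
    & P = A - B *m invmx N *m C].

(** The LU factorization is written with an upper triangular left factor and a lower triangular
    right one. Coprimality makes their corners irrelevant for the classes. *)
Lemma LU_inprod n m k (M : 'M[K]_n) (P : 'M[K]_m) (N : 'M[K]_k) a b a' b' :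
  LUsim M P N -> coprimep a b -> coprimep a' b' ->
  inprod a a' P -> inprod b b' N -> inprod (a * b) (a' * b') M.
Proof.
move=> [A [B [C [sM uN PE]]]] cab cab' [X1 [Y1 [PXY cX1 cY1]]] [X2 [Y2 [NXY cX2 cY2]]].
have : N \in unitmx by [].
rewrite NXY unitmx_mul => /andP[uX uY].
apply: inprod_sim (simx_sym sM) _.
exists (block_mx X1 (B *m invmx Y2) 0 X2), (block_mx Y1 0 (invmx X2 *m C) Y2).
split; [|exact: cycp_ublock|exact: cycp_lblock].
rewrite mulmx_block !mul0mx !mulmx0 !add0r -PXY PE mulmxKV // mulKVmx // -NXY.
congr block_mx; rewrite -[LHS](subrK (B *m invmx N *m C)); congr (_ + _).
have -> : invmx N = invmx Y2 *m invmx X2; last by rewrite !mulmxA.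
have e : invmx Y2 *m invmx X2 *m N = 1%:M.
  by rewrite NXY mulmxA -(mulmxA (invmx Y2)) mulVmx // mulmx1 mulVmx.
by rewrite -[RHS](mulmxK uN) e mul1mx.
Qed.

Lemma LUsim_sim n n' m k (M : 'M[K]_n) (M' : 'M[K]_n') (P : 'M[K]_m) (N : 'M[K]_k) :
  simx M M' -> LUsim M' P N -> LUsim M P N.
Proof.
move=> s [A [B [C [sM uN PE]]]]; exists A, B, C; split=> //.
exact: simx_trans s sM.
Qed.

Lemma LUsim_det n m k (M : 'M[K]_n) (P : 'M[K]_m) (N : 'M[K]_k) :
  LUsim M P N -> \det M = \det P * \det N.
Proof.
move=> [A [B [C [sM uN PE]]]]; have nE := simx_size sM; subst n.
rewrite (simx_det sM).
have -> : block_mx A B C N =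
   block_mx 1%:M (B *m invmx N) 0 1%:M *m block_mx P 0 C N.
  rewrite mulmx_block !mul1mx !mul0mx !add0r mulmxKV //.
  by rewrite PE subrK.
by rewrite det_mulmx det_ublock !det1 !mul1r det_lblock.
Qed.

Lemma LUsim_full n (N : 'M[K]_n) : N \in unitmx -> LUsim N (0 : 'M[K]_0) N.
Proof.
move=> uN; exists 0, 0, 0; split=> //; last by rewrite [RHS]thinmx0.
exists (row_mx 0 1%:M), (col_mx 0 1%:M); split.
- by rewrite mul_row_col mul0mx mulmx1 add0r.
- rewrite mul_col_row !mul0mx mulmx0 mul1mx (scalar_mx_block 0 n 1).
  by congr block_mx; rewrite -?scalar_mx_block // [RHS]thinmx0.
by rewrite mul_row_block !mul0mx !mul1mx !add0r mul_mx_row mulmx0 mulmx1.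
Qed.

Lemma LUsim_none n (P : 'M[K]_n) : LUsim P P (0 : 'M[K]_0).
Proof.
exists P, 0, 0; split; last by rewrite mulmx0 subr0.
  exists (row_mx 1%:M 0), (col_mx 1%:M 0); split.
  - by rewrite mul_row_col mul0mx mulmx1 addr0.
  - rewrite mul_col_row !mul0mx mulmx0 mul1mx (scalar_mx_block n 0 1).
    by congr block_mx; rewrite -?scalar_mx_block // [RHS]thinmx0.
  by rewrite mul_row_block !mul0mx !mul1mx !addr0 mul_mx_row mulmx0 mulmx1.
by rewrite unitmxE det_mx00 unitr1.
Qed.

(** After exchanging the two middle blocks ([R1], [R2]), the lower right block and its inverse are
    block triangular, hence so is the Schur complement, with [P1] and [P2] on its diagonal. *)
Lemma LUsim_block n1 n2 m1 m2 k1 k2 (M1 : 'M[K]_n1) (M2 : 'M[K]_n2) X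
    (P1 : 'M[K]_m1) (P2 : 'M[K]_m2) (N1 : 'M[K]_k1) (N2 : 'M[K]_k2) :
  LUsim M1 P1 N1 -> LUsim M2 P2 N2 ->
  exists Y, exists Z, LUsim (block_mx M1 0 X M2) (block_mx P1 0 Y P2) (block_mx N1 0 Z N2).
Proof.
move=> [A1 [B1 [C1 [[T1 [T1' [p1 q1 s1]]] u1 E1]]]].
move=> [A2 [B2 [C2 [[T2 [T2' [p2 q2 s2]]] u2 E2]]]].
pose Y := T2' *m X *m T1.
pose a := ulsubmx Y; pose b := ursubmx Y; pose c := dlsubmx Y; pose e := drsubmx Y.
pose A := block_mx A1 0 a A2; pose B := block_mx B1 0 b B2.
pose C := block_mx C1 0 c C2; pose N := block_mx N1 0 e N2.
have uN : N \in unitmx by rewrite unit_block_lower u1.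
pose W := - (invmx N2 *m e *m invmx N1).
have iN : invmx N = block_mx (invmx N1) 0 W (invmx N2).
  have h : block_mx (invmx N1) 0 W (invmx N2) *m N = 1%:M.
    rewrite mulmx_block !mul0mx !mulmx0 !addr0 !add0r !mulVmx //.
    by rewrite /W mulNmx mulmxKV // addNr -scalar_mx_block.
  by rewrite -[RHS](mulmxK uN) h mul1mx.
have PE : exists y, A - B *m invmx N *m C = block_mx P1 0 y P2.
  rewrite iN /A /B /C !mulmx_block !mul0mx !mulmx0 !addr0 !add0r opp_block_mx add_block_mx.
  by rewrite !mul0mx subr0 addr0 -E1 -E2; eexists.
have [y yE] := PE; exists y, e, A, B, C; split=> //.
pose simp := (mulmx1, mul1mx, mul0mx, mulmx0, addr0, add0r).
apply: (@simx_trans _ _ _ _ _ (block_mx (block_mx A1 B1 C1 N1) 0 Y (block_mx A2 B2 C2 N2))).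
  exists (block_mx T1 0 0 T2), (block_mx T1' 0 0 T2').
  rewrite !mulmx_block !simp p1 p2 q1 q2 s1 s2 -!scalar_mx_block; split=> //.
  by rewrite /Y !mulmxA p2 mul1mx.
pose R1 : 'M[K]_((m1 + k1) + (m2 + k2), (m1 + m2) + (k1 + k2)) :=
  block_mx (block_mx 1%:M 0 0 0) (block_mx 0 0 1%:M 0)
           (block_mx 0 1%:M 0 0) (block_mx 0 0 0 1%:M).
pose R2 : 'M[K]_((m1 + m2) + (k1 + k2), (m1 + k1) + (m2 + k2)) :=
  block_mx (block_mx 1%:M 0 0 0) (block_mx 0 0 1%:M 0)
           (block_mx 0 1%:M 0 0) (block_mx 0 0 0 1%:M).
exists R1, R2; rewrite /R1 /R2 /A /B /C /N; split.
- by rewrite !mulmx_block !simp !add_block_mx !simp !block_mx0 -!scalar_mx_block.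
- by rewrite !mulmx_block !simp !add_block_mx !simp !block_mx0 -!scalar_mx_block.
rewrite -[Y]submxK -/a -/b -/c -/e.
by rewrite !mulmx_block !simp !add_block_mx !simp.
Qed.

End ProductsOfCyclicClasses.

(** * Invariant subspaces and LU-splittings of primary matrices *)

Section BlockDecompositions.

Variable K : fieldType.

(** The Schur complement of a glued matrix is [P], whatever the corner [G]. Pole placement chooses
    [G] so that the glued matrix is similar to [C]; only the constant coefficients have to match. *)
Lemma LUsim_cycp n m k (C : 'M[K]_n) (P : 'M[K]_m) (N : 'M[K]_k) b p c :
  (0 < m)%N -> (0 < k)%N -> n = (m + k)%N -> cycp C b -> cycp P p -> cycp N c ->
  b`_0 = p`_0 * c`_0 -> c`_0 != 0 -> LUsim C P N.
Proof.
move=> m0 k0 nE cC cP cN b0 c0.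
have uN := cycp_unit cN c0.
have [rho gP] := cycp_gen cP; have [w gN] := cycp_gen cN.
have [v hv] := gen_dual m0 gP.
have sb : size b = (m + k).+1 by rewrite (cycp_size cC) nE.
have [mb _] := cC.
have [G cG] : exists G, cycp (glue P N G v w) b.
  by apply: pole_exists gP hv uN gN mb sb _ => //; rewrite (cycp_char cP) (cycp_char cN).
exists (P - v *m w *m G), (- (v *m w *m N)), G; split=> //.
  exact: cycp_transport cC cG.
by rewrite !mulNmx opprK mulmxK // subrK.
Qed.

(* The quadratic [x ^+ 2 - t * x + s] annihilates the matrix on the left, so that
   the two diagonal blocks determine each other. *)
Lemma LUsim_quadratic k (t s : K) (N : 'M[K]_k) : N \in unitmx ->
  LUsim (block_mx 0 1%:M (- s)%:M t%:M : 'M_(k + k)) (s *: invmx N) N.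
Proof.
move=> uN; pose Z := N - t%:M.
exists (- Z), 1%:M, (- (s%:M + N *m Z)); split=> //; last first.
  rewrite mul1mx mulmxN opprK mulmxDr mulKmx // addrCA addNr addr0.
  by rewrite mul_mx_scalar.
pose simp := (mulmx1, mul1mx, mul0mx, mulmx0, addr0, add0r).
exists (block_mx 1%:M 0 (- Z) 1%:M : 'M_(k + k)), (block_mx 1%:M 0 Z 1%:M : 'M_(k + k)).
rewrite !mulmx_block !simp subrr addNr -!scalar_mx_block; split=> //.
congr block_mx; last by rewrite /Z opprB subrK.
have -> (Y : 'M_k) : - Y *m - Y - (s%:M + N *m Y) = (- s)%:M - (N - Y) *m Y.
  by rewrite mulmxN mulNmx opprK mulmxBl opprD opprB raddfN /= addrCA.
by rewrite {1}/Z subKr mulmxN.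
Qed.

Lemma complement_rows n r (U : 'M[K]_(r, n)) : row_free U ->
  exists s, exists V : 'M[K]_(s, n), exists T' : 'M[K]_(n, r + s),
    col_mx U V *m T' = 1%:M /\ T' *m col_mx U V = 1%:M.
Proof.
move=> fU; exists (\rank (U^C)%MS), (row_base (U^C)%MS).
set V := row_base _; pose T := col_mx U V; exists (pinvmx T).
have nE : (r + \rank (U^C)%MS = n)%N.
  have /eqP rU := fU; rewrite mxrank_compl rU subnKC //.
  by rewrite -[X in (X <= _)%N]rU rank_leq_col.
have fT : row_full T.
  rewrite -sub1mx -addsmxE; apply: submx_trans (_ : (U + U^C <= _)%MS).
    by rewrite sub1mx addsmx_compl_full.
  by apply: addsmxS => //; rewrite eq_row_base.
have frT : row_free T by apply/eqP; rewrite [RHS]nE; apply/eqP.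
by rewrite mulmxVp // mulVpmx.
Qed.

Lemma simx_rows n n' (M : 'M[K]_n) (B : 'M[K]_n') (T : 'M[K]_(n', n)) T' :
  T *m T' = 1%:M -> T' *m T = 1%:M -> T *m M = B *m T -> simx M B.
Proof.
move=> h1 h2 h; exists T', T; split=> //.
by rewrite -[LHS]mul1mx -h2 -!mulmxA (mulmxA T) h -mulmxA h1 mulmx1.
Qed.

Lemma simx_submodule n r (M : 'M[K]_n) (U : 'M[K]_(r, n)) M1 :
  row_free U -> U *m M = M1 *m U ->
  exists s, exists X, exists M2 : 'M[K]_s, simx M (block_mx M1 0 X M2).
Proof.
move=> fU UM; have [s [V [T' [h1 h2]]]] := complement_rows fU; exists s.
pose B := V *m M *m T'; exists (lsubmx B), (rsubmx B).
apply: (simx_rows h1 h2); rewrite block_mxEv hsubmxK mul_col_mx mul_col_mx.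
by rewrite mul_row_col mul0mx addr0 UM /B -[_ *m T' *m _]mulmxA h2 mulmx1.
Qed.

Lemma hmx_lblock0 n n1 n2 (M : 'M[K]_n) (M1 : 'M[K]_n1) (M2 : 'M[K]_n2) X q :
  simx M (block_mx M1 0 X M2) -> hmx M q = 0 -> hmx M1 q = 0 /\ hmx M2 q = 0.
Proof.
move=> s h; have := simx_hmx0 s h; have [Y ->] := hmx_lblock M1 M2 X q.
by rewrite -block_mx0 => /eq_block_mx[].
Qed.

Lemma hmx_lblock0M n1 n2 (M1 : 'M[K]_n1) (M2 : 'M[K]_n2) X p q :
  hmx M1 p = 0 -> hmx M2 q = 0 -> hmx (block_mx M1 0 X M2) (p * q) = 0.
Proof.
move=> h1 h2; rewrite mulrC hmxM.
have [Y ->] := hmx_lblock M1 M2 X p; have [Z ->] := hmx_lblock M1 M2 X q.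
by rewrite mulmx_block h1 h2 !mulmx0 !mul0mx !addr0 block_mx0.
Qed.

Lemma row_free_inj0 m n (U : 'M[K]_(m, n)) :
  (forall r : 'rV_m, r *m U = 0 -> r = 0) -> row_free U.
Proof.
move=> h; rewrite -kermx_eq0; apply/eqP/row_matrixP => i; rewrite row0.
by apply: h; rewrite -row_mul mulmx_ker row0.
Qed.

Lemma row_free4 n (u1 u2 u3 u4 : 'rV[K]_n) :
  (forall x1 x2 x3 x4, x1 *: u1 + x2 *: u2 + (x3 *: u3 + x4 *: u4) = 0 ->
     [/\ x1 = 0, x2 = 0, x3 = 0 & x4 = 0]) ->
  row_free (col_mx (col_mx u1 u2) (col_mx u3 u4)).
Proof.
move=> indep; apply: row_free_inj0 => r.
rewrite -[r]hsubmxK mul_row_col -[lsubmx r]hsubmxK -[rsubmx r]hsubmxK !mul_row_col.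
rewrite [lsubmx (lsubmx r)]mx11_scalar [rsubmx (lsubmx r)]mx11_scalar.
rewrite [lsubmx (rsubmx r)]mx11_scalar [rsubmx (rsubmx r)]mx11_scalar !mul_scalar_mx.
by move=> /indep[-> -> -> ->]; rewrite raddf0 !row_mx0.
Qed.

Lemma simx_order n (M : 'M[K]_n) (u : 'rV_n) (q : {poly K}) : q \is monic ->
  u *m hmx M q = 0 ->
  (forall h : {poly K}, (size h < size q)%N -> u *m hmx M h = 0 -> h = 0) ->
  exists s, exists X, exists M2 : 'M[K]_s, simx M (block_mx (companionmx q) 0 X M2).
Proof.
move=> mq uq hq; set d := (size q).-1.
apply: (@simx_submodule _ _ _ (\matrix_(i < d) (u *m M ^+ i))); last exact: kryl_companion.
apply: row_free_inj0 => r hr.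
have rE : r *m (\matrix_(i < d) (u *m M ^+ i)) = u *m hmx M (rVpoly r).
  rewrite mulmx_sum_row /rVpoly poly_def hmx_sum mulmx_sumr.
  by apply: eq_bigr => i _; rewrite rowK valK hmxZ hmxXn -scalemxAr.
have := hq (rVpoly r); rewrite -rE hr => /(_ _ erefl) h.
rewrite -(rVpolyK r) h ?linear0 //.
by apply: leq_ltn_trans (size_poly _ _) _; rewrite prednK // size_poly_gt0 monic_neq0.
Qed.

Lemma nilpotent_not_unit n (M : 'M[K]_n) p e : (0 < n)%N ->
  hmx M (p ^+ e) = 0 -> hmx M p \notin unitmx.
Proof.
case: n M => // n M _ h; apply/negP => u; suff : hmx M (p ^+ e) \in unitmx.
  by rewrite h unitmxE det0 unitr0.
elim: {h} e => [|e IH]; first by rewrite expr0 hmx1 unitmx1.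
by rewrite exprS hmxM unitmx_mul u.
Qed.

Lemma simx_irreducible n (M : 'M[K]_n) p e : irreducible_poly p -> p \is monic ->
  (0 < n)%N -> hmx M (p ^+ e) = 0 ->
  exists s, exists X, exists M2 : 'M[K]_s,
    simx M (block_mx (companionmx p) 0 X M2) /\ hmx M2 (p ^+ e) = 0.
Proof.
move=> irr mp n0 h; have := nilpotent_not_unit n0 h.
rewrite -row_free_unit -kermx_eq0 => /rowV0Pn[u /sub_kermxP up u0].
have [|s [X [M2 sM]]] := @simx_order _ M u p mp up.
  move=> g sg ug; apply/eqP; apply: contraNT u0 => g0.
  have [[a b] /= ab] := Bezout_eq1_coprimepP _ _ (coprimep_irr irr g0 sg).
  have := congr1 (fun z => u *m hmx M z) ab.
  rewrite hmx1 mulmx1 hmxD mulmxDr (mulrC a) (mulrC b) !hmxM !mulmxA up ug.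
  by rewrite !mul0mx addr0 => <-.
exists s, X, M2; split=> //.
by have [] := hmx_lblock0 sM h.
Qed.

Lemma companion_hmx0 (p : {poly K}) : p \is monic -> hmx (companionmx p) p = 0.
Proof. by move=> mp; apply: cycp_hmx0 (cycp_companion mp). Qed.

Lemma primary_dim n (M : 'M[K]_n) p e : irreducible_poly p -> p \is monic ->
  hmx M (p ^+ e) = 0 -> exists l, n = ((size p).-1 * l)%N.
Proof.
move=> irr mp; have [N] := ubnP n; elim: N n M => // N IH n M ltn h.
case: (posnP n) => [->|n0]; first by exists 0%N; rewrite muln0.
have [s [X [M2 [sM h2]]]] := simx_irreducible irr mp n0 h.
have nE := simx_size sM; have d0 : (0 < (size p).-1)%N.
  by have := irr.1; case: (size p) => [|[]].
have [|l lE] := IH s M2 _ h2.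
  rewrite nE in ltn; rewrite -ltnS (leq_trans _ ltn) // ltnS.
  by rewrite -[X in (X < _)%N]add0n ltn_add2r.
by exists l.+1; rewrite mulnS -lE.
Qed.

Lemma unipotent_det n (M : 'M[K]_n) e : hmx M (('X - 1) ^+ e) = 0 -> \det M = 1.
Proof.
have irr : irreducible_poly ('X - 1 : {poly K}) by apply: irredp_XsubC.
have mp : ('X - 1 : {poly K}) \is monic by apply: monicXsubC.
have [N] := ubnP n; elim: N n M => // N IH n M ltn h.
case: (posnP n) => [n0|n0]; first by subst n; rewrite det_mx00.
have [s [X [M2 [sM h2]]]] := simx_irreducible irr mp n0 h.
have nE := simx_size sM; have sz : size ('X - 1 : {poly K}) = 2 by apply: size_XsubC.
have eM2 : \det M2 = 1.
  by apply: IH h2; move: nE ltn; rewrite sz => ->; lia.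
subst n; rewrite (simx_det sM) det_lblock eM2 mulr1.
rewrite (cycp_det (cycp_companion mp)) sz expr1 coefB coefX coef1 /=.
by rewrite sub0r mulrNN mulr1.
Qed.

Lemma block_mx_empty n (A : 'M[K]_0) B C (D : 'M[K]_n) :
  block_mx A B C D = D :> 'M_(0 + n).
Proof. by rewrite /block_mx col_flat_mx row_thin_mx. Qed.

Lemma LUsim_block_right n n1 n2 m k (M : 'M[K]_n) (M1 : 'M[K]_n1) (M2 : 'M[K]_n2) X
    (P : 'M[K]_m) (N : 'M[K]_k) :
  simx M (block_mx M1 0 X M2) -> M1 \in unitmx -> LUsim M2 P N ->
  exists Z, LUsim M P (block_mx M1 0 Z N).
Proof.
move=> s u L; have [Y [Z]] := LUsim_block X (LUsim_full u) L.
by rewrite block_mx_empty => /(LUsim_sim s); exists Z.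
Qed.

Lemma LUsim_block_left n n1 n2 m k (M : 'M[K]_n) (M1 : 'M[K]_n1) (M2 : 'M[K]_n2) X
    (P : 'M[K]_m) (N : 'M[K]_k) :
  simx M (block_mx M1 0 X M2) -> LUsim M2 P N ->
  exists Y, LUsim M (block_mx M1 0 Y P) N.
Proof.
move=> s L; have [Y [Z]] := LUsim_block X (LUsim_none M1) L.
by rewrite block_mx_empty => /(LUsim_sim s); exists Y.
Qed.

(** Companion blocks of [p] are peeled off and each goes whole to one side. The exponent may grow at
    each peeling, hence the new [e']. *)
Lemma primary_split n m k u v (M : 'M[K]_n) p e : irreducible_poly p -> p \is monic ->
  M \in unitmx -> hmx M (p ^+ e) = 0 -> n = (m + k)%N ->
  m = ((size p).-1 * u)%N -> k = ((size p).-1 * v)%N ->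
  exists P : 'M[K]_m, exists N : 'M[K]_k, exists e',
    [/\ LUsim M P N, hmx P (p ^+ e') = 0 & hmx N (p ^+ e') = 0].
Proof.
move=> irr mp; have d0 : (0 < (size p).-1)%N by have := irr.1; case: (size p) => [|[]].
have step n' (M' : 'M[K]_n') : M' \in unitmx -> hmx M' (p ^+ e) = 0 -> (0 < n')%N ->
    exists s, exists X, exists M2 : 'M[K]_s,
    [/\ simx M' (block_mx (companionmx p) 0 X M2), hmx M2 (p ^+ e) = 0,
     companionmx p \in unitmx, M2 \in unitmx & n' = ((size p).-1 + s)%N].
  move=> uM h n0; have [s [X [M2 [sM h2]]]] := simx_irreducible irr mp n0 h.
  have := simx_unitmx sM uM; rewrite unit_block_lower => /andP[uC uM2].
  by exists s, X, M2; split=> //; apply: simx_size sM.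
elim: v n m k M => [|v IHv] n m k M.
  elim: u n m k M => [|u IHu] n m k M uM h nE mE kE.
    rewrite !muln0 in mE kE; subst m k n.
    exists 0, 0, 0%N; split; try by rewrite thinmx0.
    by have := LUsim_full uM; rewrite (thinmx0 M).
  have [|s [X [M2 [sM h2 uC uM2 sE]]]] := step _ _ uM h.
    by rewrite nE mE mulnS; lia.
  have sE2 : s = ((size p).-1 * u + k)%N by move: nE; rewrite sE mE mulnS; lia.
  have [P [N [e' [LU hP hN]]]] := IHu _ _ _ _ uM2 h2 sE2 erefl kE.
  rewrite mulnS in mE; subst m.
  have [Y L] := LUsim_block_left sM LU.
  exists (block_mx (companionmx p) 0 Y P), N, e'.+1; rewrite exprS; split=> //.
    by apply: hmx_lblock0M => //; apply: companion_hmx0.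
  by rewrite hmxM hN mulmx0.
move=> uM h nE mE kE; have [|s [X [M2 [sM h2 uC uM2 sE]]]] := step _ _ uM h.
  by rewrite nE kE mulnS; lia.
have sE2 : s = (m + (size p).-1 * v)%N by move: nE; rewrite sE kE mulnS; lia.
have [P [N [e' [LU hP hN]]]] := IHv _ _ _ _ uM2 h2 sE2 mE erefl.
rewrite mulnS in kE; subst k.
have [Z L] := LUsim_block_right sM uC LU.
exists P, (block_mx (companionmx p) 0 Z N), e'.+1; rewrite exprS; split=> //.
  by rewrite hmxM hP mulmx0.
by apply: hmx_lblock0M => //; apply: companion_hmx0.
Qed.

End BlockDecompositions.

(** * Unipotent matrices *)

Section UnipotentMatrices.

Variable K : fieldType.

Lemma exists_cycp k (p : {poly K}) : p \is monic -> size p = k.+1 ->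
  exists P : 'M[K]_k, cycp P p.
Proof.
move=> mp sp; have := cycp_companion mp; have : (size p).-1 = k by rewrite sp.
by move: (companionmx p); move: (size p).-1 => d P dk cP; subst d; exists P.
Qed.

Lemma XnaddC (n : nat) (a : K) : (0 < n)%N ->
  [/\ 'X^n + a%:P \is monic, size ('X^n + a%:P) = n.+1 & ('X^n + a%:P)`_0 = a].
Proof.
move=> n0; have s : size ('X^n + a%:P) = n.+1 by rewrite size_XnaddC.
split=> //; last by rewrite coefD coefXn coefC /= eq_sym eqn0Ngt n0 add0r.
by rewrite monicE /lead_coef s /= coefD coefXn coefC eqxx eqn0Ngt n0 addr0.
Qed.

(** With identity diagonal blocks both gluings use the same [P] and [Gam], so the corner only sees
    the difference [d] of the two families [g]. A binomial for [Gam] turns each [drop_poly i.+1]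
    into a pure power; up to invertible factors the corner is then the matrix of coefficients of the
    [d i]. *)
Lemma inprod_unipotent k1 k2 f f' (d : nat -> {poly K}) : (0 < k1)%N -> (0 < k2)%N ->
  admissible (k1 + k2) f f' 1 -> (forall i, (size (d i) <= k1)%N) ->
  \sum_(i < k2) d i * 'X^(k2.-1 - i) = drop_poly 1 (f - recip f') ->
  exists A : 'M[K]_k2, exists B : 'M[K]_k1, [/\ A \in unitmx, B \in unitmx &
    inprod f f' (block_mx 1%:M 0 (A *m (\matrix_(i < k2) poly_rV (d i)) *m B) 1%:M)].
Proof.
move=> k1_gt0 k2_gt0 ad sd dE; have [f0 f'0] := admissible_neq0 ad.
have r0 := admissible_recip0 ad; have [mf mf' sf sf' _] := ad.
have [mp sp p0] := XnaddC 1 k1_gt0; have [mc sc c0] := XnaddC f`_0 k2_gt0.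
have [P cP] := exists_cycp mp sp; have [Gam cG] := exists_cycp mc sc.
have [rho gP] := cycp_gen cP; have [w gG] := cycp_gen cG.
have uP : P \in unitmx by rewrite (cycp_unit cP) // p0 oner_neq0.
have uG : Gam \in unitmx by rewrite (cycp_unit cG) // c0.
have [v hv] := gen_dual k1_gt0 gP.
have mr := recip_monic mf' f'0.
have sr : size (recip f') = (k1 + k2).+1 by rewrite size_recip.
have e1 : f`_0 = (char_poly P)`_0 * (char_poly Gam)`_0.
  by rewrite (cycp_char cP) (cycp_char cG) p0 c0 mul1r.
have [tE st] := pole_remainder mr sr (etrans r0 e1).
have [g gs gE] := Eop_surj k1_gt0 k2_gt0 (char_poly_monic Gam) (size_char_poly Gam) st.
have c2 := pole_exact k1_gt0 gP hv uG gG gs (etrans tE (congr1 (fun z => _ + 'X * z) (esym gE))).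
have gs' i : (size (g i + d i)%R <= k1)%N.
  by rewrite (leq_trans (size_polyD _ _)) // geq_max gs sd.
have dropG (i : 'I_k2) : drop_poly i.+1 (char_poly Gam) = 'X^(k2.-1 - i).
  rewrite (cycp_char cG); apply/polyP => j; have hi := ltn_ord i.
  rewrite coef_drop_poly coefD coefC !coefXn addnS /= addr0.
  by congr (_%:R); apply/f_equal; apply/eqP/eqP; lia.
have EE : Eop d (char_poly Gam) = drop_poly 1 (f - recip f').
  rewrite Eop_drop size_char_poly /= -dE; apply: eq_bigr => i _.
  by rewrite dropG.
have fE : f = char_poly P * char_poly Gam +
    'X * Eop (fun i => g i + d i) (char_poly Gam).
  rewrite Eop_add gE EE mulrDr addrA -tE.
  have := poly_take_drop 1 (f - recip f').
  have -> : take_poly 1 (f - recip f') = 0.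
    apply/polyP => -[|i]; rewrite coef_take_poly //= !coef0 //.
    by rewrite coefB r0 subrr.
  by rewrite add0r expr1 mulrC => ->; rewrite addrC subrK.
have c1 := pole_exact k1_gt0 gP hv uG gG gs' fE.
exists (invmx (kryl Gam w)), (kryl P rho *m invmx P); split.
- by rewrite unitmx_inv gen_kryl.
- by rewrite unitmx_mul gen_kryl // unitmx_inv.
have := @glue_inprod K _ _ 1%:M P 1%:M Gam _ _ v w f f' uP mf' f'0 c2.
rewrite !mul1mx => /(_ _ c1); congr (inprod _ _ (block_mx _ _ _ _)).
rewrite mulmxA /gmat -mulmxBr -!mulmxA; congr (_ *m _).
rewrite !mulmxA; congr (_ *m _).
apply/row_matrixP => i; rewrite row_mul linearB /= !rowK hmxD mulmxDr addrAC subrr add0r.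
by rewrite row_kryl_poly poly_rV_K.
Qed.

Lemma row_space_equiv m n (A B : 'M[K]_(m, n)) : row_free A -> row_free B ->
  exists2 g, g \in unitmx & A *m g = B.
Proof.
move=> fA fB; have e : A *m (pinvmx A *m B) = B by rewrite mulmxA mulmxVp // mul1mx.
have [|g ug eg] := @complete_unitmx K m n A (pinvmx A *m B); last first.
  by exists g => //; rewrite -eg.
by rewrite e; move: fA fB => /eqP -> /eqP ->.
Qed.

Lemma simx_square_zero n (M : 'M[K]_n) : (M - 1%:M) *m (M - 1%:M) = 0 ->
  exists s, exists2 Q : 'M[K]_(s, \rank (M - 1%:M)), row_free Q^T &
    simx M (block_mx 1%:M 0 Q 1%:M).
Proof.
have : M = 1%:M + (M - 1%:M) by rewrite addrC subrK.
move: (M - 1%:M) => R ME RR.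
pose U := row_base R; have fU : row_free U by apply: row_base_free.
have [s [V [T' [h1 h2]]]] := complement_rows fU; exists s.
have URz : U *m R = 0.
  have /submxP[D ->] : (U <= R)%MS by rewrite eq_row_base.
  by rewrite -mulmxA RR mulmx0.
have /submxP[Q QE] : (V *m R <= U)%MS by rewrite eq_row_base submxMl.
exists Q; last first.
  apply: (simx_rows h1 h2); rewrite mul_col_mx mul_block_col !mul1mx mul0mx addr0.
  by rewrite ME !mulmxDr !mulmx1 URz addr0 QE addrC.
rewrite /row_free mxrank_tr.
have -> : \rank Q = \rank (Q *m U) by rewrite mxrankMfree.
have -> : \rank (Q *m U) = \rank (col_mx U V *m R).
  by rewrite mul_col_mx URz -QE rank_col_0mx.
rewrite eqn_leq mxrankM_maxr /=.
by rewrite -[X in (\rank X <= _)%N](mul1mx R) -h2 -mulmxA mxrankM_maxr.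
Qed.

(** A square-zero [M - 1] is determined up to similarity by its rank, so a corner of full column
    rank suffices. In the coefficient matrix [d i] is row [i] and [C j] is column [j] read
    backwards. *)
Lemma inprod_square_zero n (M : 'M[K]_n) f f' k2 (C : nat -> {poly K}) :
  let rho := \rank (M - 1%:M) in
  (M - 1%:M) *m (M - 1%:M) = 0 -> n = (rho + k2)%N -> (0 < rho)%N -> (0 < k2)%N ->
  admissible n f f' 1 -> (forall j, (j < rho)%N -> size (C j) <= k2)%N ->
  \sum_(j < rho) C j * 'X^j = drop_poly 1 (f - recip f') ->
  (forall y : nat -> K, \sum_(j < rho) y j *: C j = 0 -> forall j, (j < rho)%N -> y j = 0) ->
  inprod f f' M.
Proof.
move=> rho RR nE r0 k0 ad sC CE Cfree.
have [s [Q0 fQ0 sM]] := simx_square_zero RR.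
have sE : s = k2 by apply/eqP; rewrite -(eqn_add2l rho) -nE (simx_size sM).
subst s; rewrite -/rho in Q0 fQ0 sM.
pose d i := \poly_(j < rho) (C j)`_(k2.-1 - i).
have sd i : (size (d i) <= rho)%N by apply: size_poly.
rewrite nE in ad.
have [|A [B [uA uB ip]]] := inprod_unipotent r0 k0 ad sd.
  rewrite -CE /d; under eq_bigr => i _ do rewrite poly_def mulr_suml.
  rewrite exchange_big /=; apply: eq_bigr => j _.
  rewrite -[C j in RHS](coefK (C j)) poly_def.
  rewrite (big_ord_widen k2 (fun i => (C j)`_i *: 'X^i)) ?sC // [in RHS]big_mkcond /=.
  rewrite mulr_suml (reindex_inj rev_ord_inj) /=; apply: eq_bigr => i _.
  have -> : (k2.-1 - (k2 - i.+1) = i)%N by have := ltn_ord i; lia.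
  case: ltnP => h; first by rewrite -!scalerAl mulrC.
  by rewrite nth_default // scale0r !mul0r.
set D := (\matrix_(i < k2) _) in ip.
have fD : row_free (A *m D *m B)^T.
  apply: row_free_inj0 => r /(congr1 trmx); rewrite trmx_mul trmxK trmx0 -!mulmxA.
  move=> /(congr1 (mulmx (invmx A))); rewrite mulKmx // mulmx0.
  set z := B *m r^T => Dz.
  suff z0 : z = 0 by rewrite -[r]trmxK -[r^T](mulKmx uB) -/z z0 mulmx0 trmx0.
  pose y j := if insub j is Some i then z i 0 else 0.
  have yE (i : 'I_rho) : y i = z i 0 by rewrite /y valK.
  apply/colP => i; rewrite [RHS]mxE -yE; apply: (Cfree y); last exact: ltn_ord.
  apply/polyP => l; rewrite coef0 coef_sum.
  case: (ltnP l k2) => lk; last first.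
    by rewrite big1 // => j _; rewrite coefZ nth_default ?mulr0 // (leq_trans (sC _ _)).
  have lt2 : (k2.-1 - l < k2)%N by lia.
  have := congr1 (fun Z : 'cV_k2 => Z (Ordinal lt2) 0) Dz; rewrite !mxE => e.
  rewrite -[RHS]e; apply: eq_bigr => j _; rewrite !mxE coefZ yE coef_poly ltn_ord mulrC.
  congr (_ * _); last by rewrite [LHS]mxE.
  by congr (_`_ _); rewrite /=; lia.
have [g ug gE] := row_space_equiv fQ0 fD.
apply: inprod_sim ip; apply/simx_sym/(simx_trans sM).
have ugT : g^T \in unitmx by rewrite unitmx_tr.
have QE : A *m D *m B = g^T *m Q0 by rewrite -[LHS]trmxK -gE trmx_mul trmxK.
have := @simx_diag_conj K rho k2 1%:M 0 Q0 1%:M _ _ (mulVmx ugT) (mulmxV ugT).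
by rewrite mul0mx mulmx1 mulmxV // QE.
Qed.

End UnipotentMatrices.

(** * Polynomial expansions with independent coefficients *)

Section IndependentColumns.

Variable K : fieldType.

(* Expansions of [D] with independent coefficients [C j] are exactly what makes the
   corner block in [inprod_unipotent] have full rank [rho]. *)
Definition free_columns (rho q : nat) (D : {poly K}) : Prop :=
  exists C : nat -> {poly K},
  [/\ forall j, (j < rho)%N -> (size (C j) <= q)%N, \sum_(j < rho) C j * 'X^j = D
   & forall y : nat -> K, \sum_(j < rho) y j *: C j = 0 -> forall j, (j < rho)%N -> y j = 0].

Lemma poly_split_top q (D : {poly K}) n : (size D <= q + n)%N ->
  D = take_poly q D + \sum_(i < n) D`_(q + i) *: 'X^(q + i).
Proof.
move=> sD; apply/polyP => i; rewrite coefD coef_take_poly coef_sum.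
under eq_bigr do rewrite coefZ coefXn.
case: ltnP => iq.
  rewrite big1 ?addr0 // => j _; rewrite (_ : (i == q + j)%N = false) ?mulr0 //.
  by apply/negbTE; lia.
rewrite add0r; case: (ltnP (i - q) n) => lin; last first.
  rewrite nth_default ?big1 //; last by apply: leq_trans sD _; lia.
  move=> j _; rewrite (_ : (i == q + j)%N = false) ?mulr0 //.
  by apply/negbTE; have := ltn_ord j; lia.
rewrite (bigD1 (Ordinal lin)) //= subnKC // eqxx mulr1 big1 ?addr0 // => j.
rewrite -val_eqE /= => jn; rewrite (_ : (i == q + j)%N = false) ?mulr0 //.
by apply/negbTE; move/eqP: jn => jn; apply/eqP => e; apply: jn; lia.
Qed.

Lemma size_monom (a : K) n q : (n < q)%N -> (size (a *: 'X^n : {poly K}) <= q)%N.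
Proof. by move=> h; rewrite (leq_trans (size_scale_leq _ _)) // size_polyXn. Qed.

(** The columns [L - x r] and [d x^(q-1) + r] have a free parameter [r]. The choice [r = 1] fails
    only if the first is a multiple of the second, which pins down [L]; then [r = x] works for
    [d = 0] and [r = 0] for nonzero [d]. *)
Lemma free_columns2 q (D : {poly K}) : (3 <= q)%N -> (size D <= q.+1)%N -> free_columns 2 q D.
Proof.
move=> q3 sD; have DE : D = take_poly q D + D`_q *: 'X^q.
  by rewrite {1}(@poly_split_top q D 1) ?addn1 // big_ord1 addn0.
set L := take_poly q D in DE; have sL : (size L <= q)%N by apply: size_take_poly.
set d := D`_q in DE.
have mk (r : {poly K}) : (size r < q)%N ->
   (forall y0 y1 : K, y0 *: (L - 'X * r) + y1 *: (d *: 'X^(q.-1) + r) = 0 -> y0 = 0 /\ y1 = 0) ->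
   free_columns 2 q D.
  move=> sr ind; exists (fun j => if j == 0%N then L - 'X * r else d *: 'X^(q.-1) + r).
  split.
  - move=> [|j] _ /=.
      rewrite (leq_trans (size_polyD _ _)) // geq_max sL size_polyN mulrC.
      by rewrite (leq_trans (size_polyMleq _ _)) // size_polyX addn2.
    rewrite (leq_trans (size_polyD _ _)) // geq_max (ltnW sr) andbT.
    by apply: size_monom; lia.
  - rewrite !big_ord_recl big_ord0 /= /bump /= expr0 mulr1 expr1 addr0 DE.
    have -> : 'X^q = 'X * 'X^(q.-1) :> {poly K} by rewrite -exprS prednK //; lia.
    by rewrite -!mul_polyC; ring.
  move=> y; rewrite !big_ord_recl big_ord0 /= /bump /= addr0 => /ind[h0 h1].
  by move=> [|[|j]].
have coefE0 (p : {poly K}) (c : K) : c *: p = 0 -> p != 0 -> c = 0.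
  by move=> /eqP; rewrite scaler_eq0 => /orP[/eqP //|/eqP ->]; rewrite eqxx.
have [e|ne] := eqVneq (L - 'X * 1) (L`_0 *: (d *: 'X^(q.-1) + 1)); last first.
  apply: (mk 1); first by rewrite size_poly1; lia.
  move=> y0 y1 h; have := congr1 (fun p : {poly K} => p`_0) h.
  rewrite coefD !coefZ coefB coefXM coefD coefZ coefXn coef1 coef0 /=.
  rewrite (_ : (0 == q.-1)%N = false) ?mulr0 ?add0r ?subr0 ?mulr1; last by apply/negbTE; lia.
  move=> /eqP; rewrite addrC addr_eq0 => /eqP y1E.
  have y00 : y0 = 0.
    apply: (coefE0 (L - 'X * 1 - L`_0 *: (d *: 'X^(q.-1) + 1))); last by rewrite subr_eq0.
    by rewrite scalerBr -[RHS]h y1E scaleNr scalerA.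
  by rewrite y1E y00 mul0r oppr0.
have LE : L = 'X + L`_0 *: (d *: 'X^(q.-1) + 1) by rewrite -e mulr1 addrC subrK.
have L1 : L`_1 = 1.
  rewrite LE coefD coefX !coefZ coefD coefZ coefXn coef1 /=.
  by rewrite (_ : (1 == q.-1)%N = false) ?mulr0 ?addr0 ?mulr0 ?addr0 //; apply/negbTE; lia.
have [d0|d0] := eqVneq d 0.
  apply: (mk 'X); first by rewrite size_polyX; lia.
  move=> y0 y1; rewrite d0 scale0r add0r => h.
  have L2 : L`_2 = 0.
    by rewrite LE d0 coefD coefX !coefZ coefD coefZ coef1 /=; ring.
  have := congr1 (fun p : {poly K} => p`_2) h.
  rewrite coefD !coefZ coefB coefXM !coefX coef0 L2 /= => e2.
  have y00 : y0 = 0 by rewrite -[LHS]opprK -[in RHS]oppr0 -e2; ring.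
  split=> //.
  move: h; rewrite y00 scale0r add0r => /coefE0; apply.
  by rewrite polyX_eq0.
apply: (mk 0); first by rewrite size_poly0; lia.
move=> y0 y1; rewrite mulr0 subr0 addr0 => h.
have := congr1 (fun p : {poly K} => p`_1) h.
rewrite coefD !coefZ coefXn coef0 L1 (_ : (1 == q.-1)%N = false); last by apply/negbTE; lia.
rewrite !mulr0 mulr1 addr0 => y00; split=> //; move: h; rewrite y00 scale0r add0r => /coefE0; apply.
by rewrite scaler_eq0 negb_or d0 monic_neq0 ?monicXn.
Qed.

(** The linear coefficient of [D] is shared between the two columns by means of [t]; the expression
    in [t] is the determinant of their coefficients. *)
Lemma free_columns22 (D : {poly K}) t : (size D <= 3)%N -> t ^+ 2 - D`_1 * t + D`_0 * D`_2 != 0 ->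
  free_columns 2 2 D.
Proof.
move=> sD tn.
pose C0 := (D`_0)%:P + (D`_1 - t)%:P * 'X : {poly K}; pose C1 := t%:P + (D`_2)%:P * 'X : {poly K}.
exists (fun j => if j == 0%N then C0 else C1); split.
- by move=> [|j] _ /=; apply: size_two_term.
- rewrite !big_ord_recl big_ord0 /= /bump /= expr0 mulr1 expr1 addr0.
  rewrite /C0 /C1 [RHS](_ : D = (D`_0)%:P + (D`_1)%:P * 'X + (D`_2)%:P * 'X ^+ 2).
    by rewrite !polyCB; ring.
  apply/polyP => i; rewrite !mul_polyC !(coefD, coefZ, coefC, coefX, coefXn).
  case: i => [|[|[|i]]] /=; rewrite ?(mulr0, mulr1, addr0, add0r) //.
  by rewrite nth_default // (leq_trans sD).
move=> y; rewrite !big_ord_recl big_ord0 /= /bump /= addr0 => h.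
have e0 := congr1 (fun p : {poly K} => p`_0) h; have e1 := congr1 (fun p : {poly K} => p`_1) h.
rewrite /C0 /C1 !mul_polyC !(coefD, coefZ, coefC, coefX, coef0) /= in e0 e1.
rewrite !(mulr0, mulr1, addr0, add0r) in e0 e1.
have z0 : y 0%N * (t ^+ 2 - D`_1 * t + D`_0 * D`_2) = 0.
  transitivity ((y 0%N * D`_0 + y 1%N * t) * D`_2 - (y 0%N * (D`_1 - t) + y 1%N * D`_2) * t).
    by ring.
  by rewrite e0 e1 !mul0r subrr.
have z1 : y 1%N * (t ^+ 2 - D`_1 * t + D`_0 * D`_2) = 0.
  transitivity ((y 0%N * (D`_1 - t) + y 1%N * D`_2) * D`_0 - (y 0%N * D`_0 + y 1%N * t) * (D`_1 - t)).
    by ring.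
  by rewrite e0 e1 !mul0r subrr.
move=> [|[|j]] // _; [move/eqP: z0|move/eqP: z1]; rewrite mulf_eq0 (negbTE tn) orbF => /eqP //.
Qed.

(** For [2 <= j] column [j] supplies the coefficient of [D] in degree [q + j - 1] and carries a
    monomial ['X^(q - j)] that none of the other columns with index at least 2 has, at the price of
    an extra ['X^q] in the sum. The parameters [r0] and [s] cancel in the sum and serve to make
    columns 0 and 1 independent of the rest. *)
Lemma free_columns3 rho q (D : {poly K}) : (3 <= rho)%N -> (rho <= q)%N ->
  (size D <= (rho + q).-1)%N -> free_columns rho q D.
Proof.
move=> r3 rq sD.
pose d j := D`_(q + j).-1.
set L := take_poly q D; have sL : (size L <= q)%N by apply: size_take_poly.
(* Removes the [rho - 2] extra copies of ['X^q]. *)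
pose a := d 1%N - (rho - 2)%:R.
pose C r0 s j : {poly K} :=
  if j == 0%N then L - r0 *: 'X - s *: 'X^(q.-1)
  else if j == 1%N then a *: 'X^(q.-1) + r0%:P + s *: 'X^(q - 2)
  else d j *: 'X^(q.-1) + 'X^(q - j).
(* [phi] kills [C j] for [2 <= j], so that independence reduces to a 2 x 2
   determinant in the values of [phi] and of the constant coefficient. *)
pose phi (p : {poly K}) : K := p`_q.-1 - \sum_(2 <= j < rho) d j * p`_(q - j).
have phiD p1 p2 : phi (p1 + p2) = phi p1 + phi p2.
  rewrite /phi coefD; under eq_bigr do rewrite coefD mulrDr.
  by rewrite big_split /= opprD addrACA.
have phiZ c p : phi (c *: p) = c * phi p.
  rewrite /phi coefZ; under eq_bigr do rewrite coefZ mulrCA.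
  by rewrite -mulr_sumr mulrBr.
have phiN p : phi (- p) = - phi p by rewrite -scaleN1r phiZ mulN1r.
have phi_top : phi 'X^(q.-1) = 1.
  rewrite /phi coefXn eqxx big_nat big1 ?subr0 // => j hj.
  by rewrite coefXn (_ : (q - j == q.-1)%N = false) ?mulr0 //; apply/negbTE; lia.
have phi_mid j : (2 <= j < rho)%N -> phi 'X^(q - j) = - d j.
  move=> hj; rewrite /phi coefXn (_ : (q.-1 == q - j)%N = false) ?sub0r; last by apply/negbTE; lia.
  congr (- _); rewrite (bigD1_seq j) ?iota_uniq ?mem_index_iota //=.
  rewrite coefXn eqxx mulr1 big_nat_cond big1 ?addr0 // => l hl.
  rewrite coefXn (_ : (q - l == q - j)%N = false) ?mulr0 //; apply/negbTE/negP => /eqP e.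
  by case/andP: hl => hl /eqP; apply; lia.
have phiC c : phi c%:P = 0.
  rewrite /phi coefC (_ : (q.-1 == 0)%N = false) ?sub0r; last by apply/negbTE; lia.
  rewrite big_nat big1 ?oppr0 // => j hj.
  by rewrite coefC (_ : (q - j == 0)%N = false) ?mulr0 //; apply/negbTE; lia.
have phi_rest r0 s j : (2 <= j < rho)%N -> phi (C r0 s j) = 0.
  move=> hj; rewrite /C !ifF; try by apply/negbTE; lia.
  by rewrite phiD phiZ phi_top phi_mid // mulr1 subrr.
pose E r0 := phi (L - r0 *: 'X).
have phi0 r0 s : phi (C r0 s 0%N) = E r0 - s.
  by rewrite /C /= phiD -/(E r0) phiN phiZ phi_top mulr1.
have phi1 r0 s : phi (C r0 s 1%N) = a - s * d 2.
  rewrite /C /= !phiD !phiZ phiC phi_top phi_mid; last by lia.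
  by rewrite mulr1 addr0 mulrN.
(* The expression is affine in [s], of slope -1 for [r0 = 0] if [D_0 d_2 = 1], and of slope
   [1 - D_0 d_2] for [r0 = 1]. A nonzero slope makes it nonzero at 0 or at 1. *)
have [r0 [s dn]] : exists r0 s, D`_0 * (a - s * d 2) - r0 * (E r0 - s) != 0.
  have [e|ne] := eqVneq (D`_0 * d 2) 1.
    have D0 : D`_0 != 0 by apply/eqP => z; have := oner_neq0 K; rewrite -e z mul0r eqxx.
    have d2 : d 2 != 0 by apply/eqP => z; have := oner_neq0 K; rewrite -e z mulr0 eqxx.
    exists 0; have [a0|a0] := eqVneq a 0.
      by exists 1; rewrite mul0r subr0 a0 sub0r mul1r mulf_neq0 // oppr_eq0.
    by exists 0; rewrite !mul0r !subr0 mulf_neq0.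
  exists 1; have [z|nz] := eqVneq (D`_0 * a - E 1) 0.
    exists 1; rewrite !mul1r.
    have -> : D`_0 * (a - d 2) - (E 1 - 1) = (D`_0 * a - E 1) + (1 - D`_0 * d 2) by ring.
    by rewrite z add0r subr_eq0 eq_sym.
  by exists 0; rewrite !mul0r !subr0 mul1r.
exists (C r0 s); split.
- move=> j jr; rewrite /C; case: eqP => j0; last case: eqP => j1.
  + rewrite (leq_trans (size_polyD _ _)) // geq_max size_polyN size_monom ?andbT; last by lia.
    rewrite (leq_trans (size_polyD _ _)) // geq_max sL size_polyN /=.
    by rewrite -['X]expr1 size_monom //; lia.
  + rewrite (leq_trans (size_polyD _ _)) // geq_max size_monom ?andbT; last by lia.
    rewrite (leq_trans (size_polyD _ _)) // geq_max size_monom; last by lia.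
    by rewrite (leq_trans (size_polyC_leq1 _)) //; lia.
  rewrite (leq_trans (size_polyD _ _)) // geq_max size_monom; last by lia.
  by rewrite size_polyXn; lia.
- rewrite -(big_mkord xpredT (fun j => C r0 s j * 'X^j)) big_ltn; last by lia.
  rewrite big_ltn; last by lia.
  have -> : \sum_(2 <= i < rho) C r0 s i * 'X^i =
     \sum_(2 <= i < rho) (d i *: 'X^((q + i).-1) + 'X^q).
    apply: eq_big_nat => i hi; rewrite /C !ifF; try by apply/negbTE; lia.
    rewrite mulrDl -scalerAl -!exprD; congr (_ *: 'X^ _ + 'X^ _); lia.
  rewrite big_split /= sumr_const_nat.
  have qE : (q.-1.+1 = q)%N by lia.
  have -> : C r0 s 1%N * 'X^1 = a *: 'X^q + r0 *: 'X + s *: 'X^(q.-1).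
    rewrite /C /= expr1 !mulrDl -!scalerAl -!exprSr qE mul_polyC.
    by congr (_ + _ *: 'X^ _); lia.
  rewrite /C /= expr0 mulr1 /a.
  rewrite [RHS](@poly_split_top q D rho.-1); last by lia.
  rewrite -(big_mkord xpredT (fun i => D`_(q + i) *: 'X^(q + i))) -/L.
  rewrite [in RHS]big_ltn; last by lia.
  rewrite addn0 big_add1.
  under eq_bigr do rewrite /d addnS /=.
  rewrite {1}/d addn1 /=.
  set S := \sum_(_ <= _ < _) _; rewrite scalerBl scaler_nat; set w := _ *+ _.
  by rewrite -!mul_polyC; ring.
move=> y h.
have hphi : y 0%N * (E r0 - s) + y 1%N * (a - s * d 2) = 0.
  have phi_sum n : phi (\sum_(j < n) y j *: C r0 s j) = \sum_(j < n) y j * phi (C r0 s j).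
    elim: n => [|n IH]; first by rewrite !big_ord0 phiC.
    by rewrite !big_ord_recr /= phiD IH phiZ.
  have := phi_sum rho; rewrite h phiC -(big_mkord xpredT (fun j => y j * phi (C r0 s j))).
  rewrite big_ltn; last by lia.
  rewrite big_ltn; last by lia.
  rewrite big_nat big1 ?addr0 ?phi0 ?phi1 // => j hj.
  by rewrite phi_rest // mulr0.
have Xn0 l : (0 < l)%N -> ('X^l : {poly K})`_0 = 0 by case: l => // l; rewrite coefXn.
have h0 : y 0%N * D`_0 + y 1%N * r0 = 0.
  have := congr1 (fun p : {poly K} => p`_0) h; rewrite coef0 coef_sum.
  rewrite -(big_mkord xpredT (fun j => (y j *: C r0 s j)`_0)) big_ltn; last by lia.
  rewrite big_ltn; last by lia.
  rewrite big_nat big1 ?addr0; last first.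
    move=> j hj; rewrite /C !ifF; try by apply/negbTE; lia.
    by rewrite coefZ coefD coefZ !Xn0 ?mulr0 ?addr0 ?mulr0 //; lia.
  rewrite /C /= !coefZ !(coefD, coefN, coefZ, coefC, coefX) /= !Xn0; try lia.
  rewrite coef_take_poly ifT; last by lia.
  by rewrite !mulr0 oppr0 !addr0 add0r.
have z0 : y 0%N * (D`_0 * (a - s * d 2) - r0 * (E r0 - s)) = 0.
  transitivity ((y 0%N * D`_0 + y 1%N * r0) * (a - s * d 2) -
     (y 0%N * (E r0 - s) + y 1%N * (a - s * d 2)) * r0); first by ring.
  by rewrite h0 hphi !mul0r subrr.
have z1 : y 1%N * (D`_0 * (a - s * d 2) - r0 * (E r0 - s)) = 0.
  transitivity ((y 0%N * (E r0 - s) + y 1%N * (a - s * d 2)) * D`_0 -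
     (y 0%N * D`_0 + y 1%N * r0) * (E r0 - s)); first by ring.
  by rewrite h0 hphi !mul0r subrr.
have y0 : y 0%N = 0 by apply/eqP; move/eqP: z0; rewrite mulf_eq0 (negbTE dn) orbF.
have y1 : y 1%N = 0 by apply/eqP; move/eqP: z1; rewrite mulf_eq0 (negbTE dn) orbF.
move=> [|[|j]] // jr.
have := congr1 (fun p : {poly K} => p`_(q - j.+2)) h; rewrite coef0 coef_sum.
rewrite (bigD1 (Ordinal jr)) //= big1 ?addr0; last first.
  move=> [l lr]; rewrite -val_eqE /= => lj; rewrite coefZ.
  case: l lr lj => [|[|l]] lr lj; rewrite ?y0 ?y1 ?mul0r //.
  rewrite /C /= coefD coefZ !coefXn.
  have -> : (q - j.+2 == q.-1)%N = false by apply/negbTE; lia.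
  have -> : (q - j.+2 == q - l.+2)%N = false by apply/negbTE; move/eqP: lj => lj; lia.
  by rewrite mulr0 addr0 mulr0.
rewrite coefZ /C /= coefD coefZ !coefXn eqxx (_ : (q - j.+2 == q.-1)%N = false).
  by rewrite mulr0 add0r mulr1.
by apply/negbTE; lia.
Qed.

Lemma free_columns_exist rho q (D : {poly K}) : (2 <= rho)%N -> (rho <= q)%N ->
  (size D <= (rho + q).-1)%N ->
  [\/ (3 <= q)%N | exists t, t ^+ 2 - D`_1 * t + D`_0 * D`_2 != 0] ->
  free_columns rho q D.
Proof.
move=> r2 rq sD; have [r3|r3] := leqP 3 rho; first by move=> _; apply: free_columns3.
have rE : rho = 2 by lia.
subst rho; have [q3|q3] := leqP 3 q; first by move=> _; apply: free_columns2.
have qE : q = 2 by lia.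
by subst q; case=> [//|[t ht]]; apply: free_columns22 ht.
Qed.

End IndependentColumns.

(** * Unipotent matrices with one Jordan block of size 3 and otherwise trivial blocks *)

Section JordanBlock.

Variable K : fieldType.

Definition J2 : 'M[K]_(1 + 1) := block_mx 1%:M 1%:M 0 1%:M.

Lemma gen_bottom_row (X : 'M[K]_(1 + 1)) : row_mx 0 1%:M *m X = row_mx 1%:M 0 ->
  gen X (row_mx 0 1%:M).
Proof.
move=> wX y; rewrite -[y]hsubmxK [lsubmx y]mx11_scalar [rsubmx y]mx11_scalar.
move: (lsubmx y 0 0) (rsubmx y 0 0) => a b.
exists (b%:P + a%:P * 'X); rewrite hmxD hmxM !hmxC hmxX mulmxDr mulmxA !mul_mx_scalar -scalemxAl wX.
by rewrite !scale_row_mx add_row_mx !scaler0 addr0 add0r !scalemx1.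
Qed.

(** For [c] of degree 2 there is freedom left: [t] forces only the top coefficient of [g 0], and
    [g 1] absorbs the rest. As [2 <= k1], the constant coefficient of [g 0] is not the top one. *)
Lemma Eop_surj2 k1 (c t : {poly K}) (eps : K) : (2 <= k1)%N -> c \is monic -> size c = 3 ->
  (size t <= k1.+1)%N ->
  exists g : nat -> {poly K},
    [/\ forall i, (size (g i) <= k1)%N, Eop g c = t & (g 0%N)`_0 = eps].
Proof.
move=> k2 mc sc st.
pose g0 := t`_k1 *: 'X^(k1.-1) + eps%:P : {poly K}.
have s0 : (size g0 <= k1)%N.
  rewrite (leq_trans (size_polyD _ _)) // geq_max size_monom ?(leq_trans (size_polyC_leq1 _)) //; lia.
have dE : drop_poly 1 c = 'X + (c`_1)%:P.
  apply/polyP => i; rewrite coef_drop_poly coefD coefX coefC.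
  have c2 := monic_top mc sc.
  case: i => [|[|i]] /=; rewrite ?addn1 ?c2 ?add0r ?addr0 //.
  by rewrite nth_default // sc.
pose g i := if i == 0%N then g0 else if i == 1%N then t - g0 * ('X + (c`_1)%:P) else 0.
exists g; split.
- move=> [|[|i]]; rewrite /g /= ?size_poly0 //.
  apply/leq_sizeP => j kj; rewrite coefB mulrDr coefD coefMX mulrC mul_polyC coefZ.
  rewrite (leq_sizeP _ _ s0 j) // mulr0 addr0.
  have -> : (j == 0%N) = false by apply/negbTE; lia.
  rewrite /g0 coefD coefZ coefXn coefC (_ : (j.-1 == 0%N) = false) ?addr0; last by apply/negbTE; lia.
  have [->|jk] := eqVneq j k1; first by rewrite eqxx mulr1 subrr.
  rewrite (_ : (j.-1 == k1.-1) = false) ?mulr0 ?subr0; last by apply/negbTE; lia.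
  by rewrite nth_default // (leq_trans st) //; lia.
- rewrite Eop_drop sc !big_ord_recl big_ord0 /= /bump /= dE.
  have -> : drop_poly 2 c = 1.
    apply/polyP => i; rewrite coef_drop_poly coef1.
    case: i => [|i]; first exact: monic_top mc sc.
    by rewrite nth_default // sc; lia.
  by rewrite /g /=; ring.
rewrite /g /= /g0 coefD coefZ coefXn coefC (_ : (0 == k1.-1)%N = false) ?mulr0 ?add0r //.
by apply/negbTE; lia.
Qed.

(** [J2] fixes the row [w], which is therefore cyclic for both [Gam] and [J2 *m Gam], and the bottom
    row of the corner is [rho (g' 0 - g 0)(P) P^-1]. The constant coefficients 0 and 1 of [g 0] and
    [g' 0] make it nonzero. *)
Lemma inprod_jordan k1 f f' : (2 <= k1)%N -> admissible (k1 + (1 + 1)) f f' 1 ->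
  exists Q0, exists Q1 : 'rV[K]_k1, Q1 != 0 /\
    inprod f f' (block_mx 1%:M 0 (col_mx Q0 Q1) J2).
Proof.
move=> k12 ad; have k1_gt0 : (0 < k1)%N by apply: ltnW.
have [f0 f'0] := admissible_neq0 ad; have r0 := admissible_recip0 ad.
have [mf mf' sf sf' _] := ad.
have [mp sp p0] := XnaddC (1 : K) k1_gt0.
have [P cP] := exists_cycp mp sp; have [rho gP] := cycp_gen cP.
have uP : P \in unitmx by rewrite (cycp_unit cP) // p0 oner_neq0.
have [v hv] := gen_dual k1_gt0 gP.
pose w : 'rV[K]_(1 + 1) := row_mx 0 1%:M.
pose Gam : 'M[K]_(1 + 1) := block_mx 0 (- f`_0)%:M 1%:M 0.
have wG : w *m Gam = row_mx 1%:M 0.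
  by rewrite /w /Gam mul_row_block !mul0mx !add0r mul1mx mulmx0.
have wJ : w *m J2 = w by rewrite /w /J2 mul_row_block !mul0mx !add0r mulmx0 mul1mx.
have wJG : w *m (J2 *m Gam) = row_mx 1%:M 0 by rewrite mulmxA wJ.
have gG := gen_bottom_row wG; have gJG := gen_bottom_row wJG.
have dG : \det Gam = f`_0.
  have e : Gam *m block_mx 1%:M 0 1%:M 1%:M =
      block_mx 1%:M 0 (- (f`_0)^-1)%:M 1%:M *m block_mx (- f`_0)%:M (- f`_0)%:M 0 (- 1)%:M.
    rewrite /Gam !mulmx_block !mulmx0 !mulmx1 !mul0mx !mul1mx !addr0 !add0r.
    by rewrite -!scalar_mxM mulrNN mulVf // -raddfD /= subrr raddf0.
  have := congr1 determinant e; rewrite !det_mulmx !det_lblock det_ublock !det1 !mulr1 !mul1r.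
  by rewrite !det_scalar1 mulrNN mulr1.
have dJ : \det J2 = 1 by rewrite det_ublock !det1 mulr1.
have uG : Gam \in unitmx by rewrite unitmxE dG unitfE.
have uJG : J2 *m Gam \in unitmx by rewrite unitmx_mul uG unitmxE dJ unitr1.
have cc X : \det X = f`_0 -> (char_poly (X : 'M[K]_(1 + 1)))`_0 = f`_0.
  by rewrite char_coef0 expr2 mulrNN mulr1 mul1r.
have e1 : (recip f')`_0 = (char_poly P)`_0 * (char_poly Gam)`_0.
  by rewrite (cycp_char cP) p0 mul1r cc // r0.
have e2 : f`_0 = (char_poly P)`_0 * (char_poly (J2 *m Gam))`_0.
  by rewrite (cycp_char cP) p0 mul1r cc // det_mulmx dJ mul1r.
have mr := recip_monic mf' f'0.
have sr : size (recip f') = (k1 + (1 + 1)).+1 by rewrite size_recip.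
have [tE st] := pole_remainder mr sr e1; have [tE' st'] := pole_remainder mf sf e2.
have k1E : ((k1 + (1 + 1)).-1 = k1.+1)%N by lia.
rewrite k1E in st st'.
have [g [gs gE g0]] := Eop_surj2 0 k12 (char_poly_monic Gam) (size_char_poly Gam) st.
have [g' [gs' gE' g0']] :=
  Eop_surj2 1 k12 (char_poly_monic (J2 *m Gam)) (size_char_poly (J2 *m Gam)) st'.
have c1 := pole_exact k1_gt0 gP hv uG gG gs (etrans tE (congr1 (fun z => _ + 'X * z) (esym gE))).
have c2 := pole_exact k1_gt0 gP hv uJG gJG gs'
  (etrans tE' (congr1 (fun z => _ + 'X * z) (esym gE'))).
set G := gmat P Gam rho _ g in c1; set G' := gmat P (J2 *m Gam) rho _ g' in c2.
have := @glue_inprod K _ _ 1%:M P J2 Gam G G' v w f f' uP mf' f'0 c1.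
rewrite !mul1mx => /(_ c2) ip.
exists (usubmx ((G' - J2 *m G) *m invmx P)), (dsubmx ((G' - J2 *m G) *m invmx P)).
rewrite vsubmxK; split=> //.
set Q := _ *m _; have -> : dsubmx Q = w *m Q.
  by rewrite -{2}[Q]vsubmxK mul_row_col mul0mx add0r mul1mx.
rewrite /Q mulmxA mulmxBr (mulmxA w J2 G) wJ.
have wGE : w *m G = rho *m hmx P (g 0%N) by have := @gmatE K _ _ P Gam rho w g 0 gG isT; rewrite expr0 mulmx1.
have wGE' : w *m G' = rho *m hmx P (g' 0%N).
  by have := @gmatE K _ _ P (J2 *m Gam) rho w g' 0 gJG isT; rewrite expr0 mulmx1.
rewrite wGE wGE' -mulmxBr -hmxB; apply/eqP => z.
have : rho *m hmx P (g' 0%N - g 0%N) = 0 by rewrite -[LHS](mulmxKV uP) z mul0mx.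
move/(gen_min gP) => /(_ _)/(congr1 (fun q : {poly K} => q`_0)).
rewrite coefB g0 g0' subr0 coef0 => e; have := oner_neq0 K; rewrite e ?eqxx //.
by rewrite (leq_trans (size_polyD _ _)) // geq_max size_polyN gs gs'.
Qed.

Lemma simx_row_basis n r (T : 'M[K]_(r, n)) (M : 'M[K]_n) B :
  row_free T -> r = n -> T *m M = B *m T -> simx M B.
Proof. by move=> fT rn; subst r; rewrite row_free_unit in fT; apply: simx_unit. Qed.

Lemma simx_corner k1 (Q0 Q1 : 'rV[K]_k1) :
  simx (block_mx 1%:M 0 (col_mx Q0 Q1) J2) (block_mx 1%:M 0 (col_mx 0 Q1) J2).
Proof.
apply: (@simx_unit _ _ _ _ (block_mx 1%:M 0 (col_mx 0 Q0) 1%:M)).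
  by rewrite unit_block_lower !unitmx1.
rewrite !mulmx_block !mul1mx !mul0mx !mulmx1 !mulmx0 !addr0 !add0r.
congr (block_mx _ _ _ _); rewrite /J2 mul_block_col !mul1mx !mul0mx !add0r !add_col_mx !add0r.
by rewrite addrC.
Qed.

(** A basis of [kermx R] together with [u] and [u *m R] brings [M] to the shape of [inprod_jordan].
    There the upper row of the corner can be removed, and all nonzero lower rows are equivalent. *)
Lemma inprod_rank2 n (M : 'M[K]_n) f f' : let R := M - 1%:M in
  \rank R = 2 -> R *m R != 0 -> R *m R *m R = 0 -> (4 <= n)%N ->
  admissible n f f' 1 -> inprod f f' M.
Proof.
move=> R rR R2 R3 n4 ad.
have MR : M = 1%:M + R by rewrite /R addrC subrK.
have [i ui] : exists i, row i (R *m R) != 0.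
  apply: contrapT => /forallNP h; move/eqP: R2; apply; apply/row_matrixP => i; rewrite row0.
  by apply/eqP/negPn/negP/h.
pose u : 'rV[K]_n := delta_mx 0 i.
have uR2 : u *m R *m R != 0 by rewrite -mulmxA -rowE.
pose k1 := \rank (kermx R).
have k1E : k1 = (n - 2)%N by rewrite /k1 mxrank_ker rR.
pose U := row_base (kermx R).
have UR : U *m R = 0 by apply/sub_kermxP; rewrite eq_row_base.
have [x xE] : exists x, u *m R *m R = x *m U.
  apply/submxP; rewrite eq_row_base; apply/sub_kermxP.
  by rewrite -!mulmxA (mulmxA R R R) R3 mulmx0.
have x0 : x != 0 by apply: contraNneq uR2 => z; rewrite xE z mul0mx.
pose T := col_mx U (col_mx u (u *m R)).
have fT : row_free T.
  apply: row_free_inj0 => r; rewrite -[r]hsubmxK mul_row_col.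
  rewrite -[rsubmx r]hsubmxK mul_row_col [lsubmx (rsubmx r)]mx11_scalar [rsubmx (rsubmx r)]mx11_scalar.
  move: (lsubmx r) (lsubmx (rsubmx r) 0 0) (rsubmx (rsubmx r) 0 0) => r1 a b.
  rewrite !mul_scalar_mx => h.
  have a0 : a = 0.
    have := congr1 (fun z => z *m R *m R) h; rewrite !mulmxDl -!scalemxAl !mul0mx.
    rewrite -(mulmxA r1) UR mulmx0 mul0mx add0r.
    have -> : u *m R *m R *m R = 0 by rewrite -!mulmxA (mulmxA R R R) R3 mulmx0.
    by rewrite scaler0 addr0 => /eqP; rewrite scaler_eq0 (negbTE uR2) orbF => /eqP.
  have b0 : b = 0.
    have := congr1 (fun z => z *m R) h; rewrite !mulmxDl -!scalemxAl !mul0mx.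
    rewrite -(mulmxA r1) UR mulmx0 add0r a0 scale0r add0r => /eqP.
    by rewrite scaler_eq0 (negbTE uR2) orbF => /eqP.
  move: h; rewrite a0 b0 !scale0r !addr0 => h.
  have r10 : r1 = 0 by apply/(row_free_inj (row_base_free (kermx R))); rewrite h mul0mx.
  by rewrite r10 raddf0 !row_mx0.
have nE : (k1 + (1 + 1) = n)%N by rewrite k1E; lia.
have sM : simx M (block_mx 1%:M 0 (col_mx 0 x) J2).
  apply: (simx_row_basis fT nE).
  rewrite /T mul_col_mx mul_block_col mul1mx mul0mx addr0 MR mulmxDr mulmx1 UR addr0.
  congr (col_mx _ _); rewrite /J2 mul_col_mx mul_block_col mul_col_mx add_col_mx.
  rewrite (mulmxDr u) (mulmxDr (u *m R)) !mulmx1 !mul0mx !mul1mx !add0r -xE.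
  by congr (col_mx _ _); rewrite addrC.
rewrite -nE in ad.
have [|Q0 [Q1 [Q1n ip]]] := inprod_jordan _ ad; first by lia.
have fr (z : 'rV[K]_k1) : z != 0 -> row_free z by rewrite /row_free rank_rV => ->.
have [g ug gE] := row_space_equiv (fr _ x0) (fr _ Q1n).
apply: inprod_sim ip; apply: simx_trans (simx_corner _ _) (simx_trans _ (simx_sym sM)).
apply/simx_sym.
apply: (@simx_unit _ _ _ _ (block_mx (invmx g) 0 0 1%:M)).
  by rewrite unit_block_lower unitmx_inv ug unitmx1.
rewrite !mulmx_block !mul1mx !mul0mx !mulmx1 !mulmx0 !addr0 !add0r.
by rewrite mul_col_mx mul0mx -gE mulmxK.
Qed.

End JordanBlock.

(** * Small blocks, cyclic targets and transvections *)

Section CyclicTargets.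

Variable K : fieldType.

Lemma inprod1 (N : 'M[K]_1) f f' : admissible 1 f f' (\det N) -> inprod f f' N.
Proof.
move=> [mf mf' sf sf' [e _]].
have [X cX] := exists_cycp mf sf; have [Y cY] := exists_cycp mf' sf'.
exists X, Y; split=> //; apply/matrixP => i j; rewrite !ord1 -!det_mx11 det_mulmx.
by rewrite (cycp_det cX) (cycp_det cY) mulrACA expr1 mulrNN mulr1 mul1r e.
Qed.

Lemma simx_lblock_empty n (N : 'M[K]_n) Z (N2 : 'M[K]_0) : simx (block_mx N 0 Z N2) N.
Proof.
apply: simx_trans (simx_swap _ _ _ _) _.
by rewrite block_mx_empty; apply: simx_refl.
Qed.

(** One side of an LU-splitting: a prepared block [N1] and a primary rest [N2]. The last hypothesis
    takes over when the rest is empty. *)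
Lemma inprod_side r k2 (N1 : 'M[K]_r) (N2 : 'M[K]_k2) Z c p e f f' : (0 < r)%N ->
  hmx N1 c = 0 -> hmx N2 (p ^+ e) = 0 -> coprimep c p ->
  admissible (r + k2) f f' (\det N1 * \det N2) ->
  (k2 = 0%N -> admissible r f f' (\det N1) -> inprod f f' N1) ->
  inprod f f' (block_mx N1 0 Z N2).
Proof.
move=> r0 c1 c2 cc ad h; have [z|k0] := posnP k2.
  subst k2; rewrite det_mx00 mulr1 addn0 in ad.
  by apply: inprod_sim (h erefl ad); apply/simx_sym/simx_lblock_empty.
by apply: (inprod_coprime r0 k0 (simx_refl _) (coprimep_expr e cc)) => //; rewrite det_lblock.
Qed.

Lemma gen_dim1 (X : 'M[K]_1) : gen X 1%:M.
Proof.
move=> y; exists (y 0 0)%:P; rewrite hmxC mul1mx.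
by apply/rowP => i; rewrite !ord1 !mxE mulr1n.
Qed.

Lemma gen_top_row (X : 'M[K]_(1 + 1)) p q : q != 0 ->
  row_mx 1%:M 0 *m X = row_mx p%:M q%:M -> gen X (row_mx 1%:M 0).
Proof.
move=> q0 wX y; rewrite -[y]hsubmxK [lsubmx y]mx11_scalar [rsubmx y]mx11_scalar.
move: (lsubmx y 0 0) (rsubmx y 0 0) => s t.
exists ((s - t / q * p)%:P + (t / q)%:P * 'X).
rewrite hmxD hmxM !hmxC hmxX mulmxDr mulmxA !mul_mx_scalar -scalemxAl wX.
rewrite !scale_row_mx add_row_mx scaler0 add0r !scale_scalar_mx -raddfD /= mulr1.
by rewrite subrK divfK.
Qed.

(** [B] sends the first basis row to the second, so the first row is cyclic for [B *m Y] once the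
    lower right entry of [Y] is nonzero. The companion form of [f'] achieves this unless its linear
    coefficient is 0; then another matrix of trace 0 is taken. *)
Lemma inprod_cyclic2 f f' d : admissible (1 + 1) f f' d ->
  exists nu, exists2 N : 'M[K]_(1 + 1), cycp N nu & inprod f f' N.
Proof.
move=> [mf mf' sf sf' _].
have hq (X : 'M[K]_(1 + 1)) g (u : 'rV_(1 + 1)) : g \is monic -> size g = 3 ->
    u *m hmx X g = u *m X *m X + g`_1 *: (u *m X) + g`_0 *: u.
  move=> mg sg; rewrite {1}(monic_quadratic mg sg) !hmxD hmxM !hmxC hmxXn hmxX !mulmxDr addrA addrAC.
  by rewrite mul_mx_scalar mul_scalar_mx -scalemxAr expr2 mulmxA.
pose B : 'M[K]_(1 + 1) := block_mx 0 1%:M (- f`_0)%:M (- f`_1)%:M.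
have eB : row_mx 1%:M 0 *m B = row_mx 0%:M 1%:M.
  by rewrite /B mul_row_block !mul1mx !mul0mx !addr0 raddf0.
have cB : cycp B f.
  apply: (gen_cycp (gen_top_row (oner_neq0 K) eB)) => //; rewrite hq // eB raddf0 /B mul_row_block.
  rewrite !mul0mx !mul1mx !add0r !scale_row_mx !add_row_mx !scaler0 !addr0 !scale_scalar_mx !mulr1.
  by rewrite -!raddfD /= !addNr raddf0 row_mx0.
have mk (Y : 'M[K]_(1 + 1)) : drsubmx Y 0 0 != 0 -> cycp Y f' ->
    exists nu, exists2 N : 'M[K]_(1 + 1), cycp N nu & inprod f f' N.
  move=> y0 cY; exists (char_poly (B *m Y)), (B *m Y); last by exists B, Y.
  apply: gen_cycp_char (row_mx 1%:M 0) _; apply: (gen_top_row (p := dlsubmx Y 0 0) y0).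
  rewrite mulmxA eB -{1}[Y]submxK mul_row_block raddf0 !mul0mx !mul1mx !add0r.
  by congr row_mx; apply: mx11_scalar.
have [z|nz] := eqVneq f'`_1 0.
  pose Y : 'M[K]_(1 + 1) := block_mx 1%:M 1%:M (- 1 - f'`_0)%:M (- 1)%:M.
  apply: (mk Y); first by rewrite block_mxKdr mxE oppr_eq0 oner_eq0.
  have eY : row_mx 1%:M 0 *m Y = row_mx 1%:M 1%:M.
    by rewrite /Y mul_row_block !mul1mx !mul0mx !addr0.
  apply: (gen_cycp (gen_top_row (oner_neq0 K) eY)) => //; rewrite hq // eY z scale0r addr0.
  rewrite /Y mul_row_block !mul1mx !scale_row_mx !add_row_mx scaler0 addr0.
  by rewrite -[RHS]row_mx0; congr row_mx; apply/matrixP => i j; rewrite !mxE !ord1 /=; ring.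
pose Y : 'M[K]_(1 + 1) := block_mx 0 1%:M (- f'`_0)%:M (- f'`_1)%:M.
apply: (mk Y); first by rewrite block_mxKdr mxE mulr1n oppr_eq0.
have eY : row_mx 1%:M 0 *m Y = row_mx 0%:M 1%:M.
  by rewrite /Y mul_row_block !mul1mx !mul0mx !addr0 raddf0.
apply: (gen_cycp (gen_top_row (oner_neq0 K) eY)) => //; rewrite hq // eY raddf0 /Y mul_row_block.
rewrite !mul0mx !mul1mx !add0r !scale_row_mx !add_row_mx !scaler0 !addr0 !scale_scalar_mx !mulr1.
by rewrite -!raddfD /= !addNr raddf0 row_mx0.
Qed.

(** The two lowest coefficients are free. The value 1 is there to keep [c] from being a root, which
    makes [q] coprime to [x - c] over every field. *)
Lemma exists_monic_value n (s c : K) : (1 < n)%N -> c != 0 ->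
  exists q : {poly K}, [/\ q \is monic, size q = n.+1, q`_0 = s & q.[c] = 1].
Proof.
move=> n1 c0; pose x := (1 - s - c ^+ n) / c.
pose q : {poly K} := 'X^n + (x *: 'X + s%:P).
have sl : (size (x *: 'X + s%:P : {poly K})%R < n.+1)%N.
  apply: (@leq_ltn_trans 2); last by rewrite ltnS.
  rewrite (leq_trans (size_polyD _ _)) // geq_max (leq_trans (size_scale_leq _ _)) ?size_polyX //.
  by rewrite (leq_trans (size_polyC_leq1 _)).
have sq : size q = n.+1 by rewrite /q size_polyDl size_polyXn.
exists q; split=> //.
- by rewrite monicE /q lead_coefDl ?size_polyXn // lead_coefXn.
- rewrite /q coefD coefXn coefD coefZ coefX coefC /= (_ : (0 == n)%N = false).
    by rewrite mulr0 !add0r.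
  by apply/negbTE; lia.
by rewrite /q hornerD hornerXn hornerD hornerZ hornerX hornerC /x divfK //; ring.
Qed.

Lemma coprimep_XsubCl (c : K) (q : {poly K}) : q.[c] != 0 -> coprimep ('X - c%:P) q.
Proof. by move=> h; rewrite coprimep_sym coprimep_XsubC. Qed.

(** For a side without primary rest the prepared block has to be a product by itself. From size 3 on
    it is the sum of the entry 1 and a cyclic block without eigenvalue 1. *)
Lemma inprod_cyclic k f f' d : (0 < k)%N -> admissible k f f' d ->
  exists nu, exists2 N : 'M[K]_k, cycp N nu & inprod f f' N.
Proof.
case: k => [//|[|[|k]]] _ ad.
- have [mf mf' sf sf' _] := ad.
  have [X cX] := exists_cycp mf sf; have [Y cY] := exists_cycp mf' sf'.
  exists (char_poly (X *m Y)), (X *m Y); last by exists X, Y.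
  exact: gen_cycp_char (gen_dim1 _).
- exact: inprod_cyclic2 ad.
have [_ _ _ _ [_ d0]] := ad.
have [q [mq sq q0 q1]] := @exists_monic_value k.+2 ((-1) ^+ k.+2 * d) 1 isT (oner_neq0 K).
have [N2 cN2] := exists_cycp mq sq.
have [m1 s1 z1] := @XnaddC K 1 (- 1) isT.
have [N1 cN1] := exists_cycp m1 s1.
have cc : coprimep ('X^1 + (-1)%:P) q.
  by rewrite polyCN; apply: coprimep_XsubCl; rewrite q1 oner_neq0.
exists (('X^1 + (-1)%:P) * q), (block_mx N1 0 0 N2 : 'M_(1 + k.+2)).
  exact: (@cycp_dblock K 1 k.+2 N1 N2 _ _ cc cN1 cN2).
apply: (@inprod_coprime K _ _ 1 k.+2 N1 N2 0 _ _ f f' _ _ (simx_refl _) cc) => //.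
- exact: cycp_hmx0 cN1.
- exact: cycp_hmx0 cN2.
rewrite det_lblock (cycp_det cN1) (cycp_det cN2) z1 q0 expr1 mulrNN mulr1 mul1r mulrA.
by rewrite -exprMn mulrNN mulr1 expr1n mul1r.
Qed.

Lemma recip_quadratic (f : {poly K}) : f \is monic -> size f = 3 -> f`_0 = 1 -> recip f = f.
Proof.
move=> mf sf f0; have f2 := monic_top mf sf.
apply/polyP => i; rewrite coef_poly sf f0 divr1; case: ltnP => h; last by rewrite nth_default ?sf.
by case: i h => [|[|[|i]]] //= _; rewrite ?f0 ?f2.
Qed.

Lemma inprod_invmx n (N : 'M[K]_n) (f f' : {poly K}) : f`_0 != 0 -> f'`_0 != 0 ->
  inprod f f' N -> inprod (recip f') (recip f) (invmx N).
Proof.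
move=> f0 f'0 [X [Y [-> cX cY]]].
have uX := cycp_unit cX f0; have uY := cycp_unit cY f'0.
exists (invmx Y), (invmx X); split; [|exact: cycp_invmx|exact: cycp_invmx].
have uXY : X *m Y \in unitmx by rewrite unitmx_mul uX.
apply: (can_inj (mulKmx uXY)); rewrite mulmxV // -mulmxA (mulmxA Y) mulmxV // mul1mx mulmxV //.
Qed.

(* [M = X Y] iff [X = M Y^-1], and here [X] is the matrix that splits with
   coprime annihilators. *)
Lemma inprod_of_cyclic n (M : 'M[K]_n) m k (a b f' chi : {poly K}) :
  (0 < m)%N -> (0 < k)%N -> a \is monic -> b \is monic ->
  size a = m.+1 -> size b = k.+1 -> coprimep a b -> cycp M chi -> n = (m + k)%N ->
  admissible n (a * b) f' (\det M) -> inprod (a * b) f' M.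
Proof.
move=> m0 k0 ma mb sa sb cab cM nE ad; have [ab0 f'0] := admissible_neq0 ad.
have [mab mf' sab sf' [e dM]] := ad.
subst n.
have [A cA] := exists_cycp ma sa; have [B cB] := exists_cycp mb sb.
have cX := cycp_dblock cab cA cB.
have mchi : chi \is monic by case: cM.
have [|X [Y [XE cX' cY]]] := @inprod_coprime K _ _ m k A B 0 a b chi (recip f') m0 k0
   (simx_refl _) cab (cycp_hmx0 cA) (cycp_hmx0 cB).
  split; rewrite ?(cycp_size cM) ?size_recip ?recip_monic //.
  have s0 := sqr_sign K (m + k).
  rewrite (cycp_det cX); split; last by rewrite mulf_neq0 ?signr_eq0.
  rewrite recip_coef0 //.
  have := cycp_det cM; rewrite -e => h.
  have -> : chi`_0 = (-1) ^+ (m + k) * ((a * b)`_0 * f'`_0) by rewrite h mulrA s0 mul1r.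
  by rewrite -!mulrA mulfV // mulr1.
have mr := recip_monic mf' f'0.
have uY : Y \in unitmx by apply: (cycp_unit cY); rewrite recip_coef0 // invr_eq0.
apply: (inprod_sim (cycp_transport cX' cM)).
exists (block_mx A 0 0 B), (invmx Y); split=> //; first by rewrite XE mulmxK.
by rewrite -(recipK mf' f'0); apply: cycp_invmx.
Qed.

Lemma square_zero_sim n n' (M : 'M[K]_n) (M' : 'M[K]_n') : n = n' ->
  (M - 1%:M) *m (M - 1%:M) = 0 -> (M' - 1%:M) *m (M' - 1%:M) = 0 ->
  \rank (M - 1%:M) = \rank (M' - 1%:M) -> simx M M'.
Proof.
move=> e; subst n' => h h' rE.
have [s [Q fQ sM]] := simx_square_zero h; have [s' [Q' fQ' sM']] := simx_square_zero h'.
rewrite -rE in Q' fQ' sM'.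
have sE : s = s' by apply/eqP; rewrite -(eqn_add2l (\rank (M - 1%:M))) -(simx_size sM) -(simx_size sM').
subst s'; have [g ug gE] := row_space_equiv fQ fQ'.
apply: simx_trans sM _; apply/simx_sym/(simx_trans sM').
have ugT : g^T \in unitmx by rewrite unitmx_tr.
have QE : Q' = g^T *m Q by rewrite -[LHS]trmxK -gE trmx_mul trmxK.
have := @simx_diag_conj K _ s 1%:M 0 Q 1%:M _ _ (mulVmx ugT) (mulmxV ugT).
by rewrite mul0mx mulmx1 mulmxV // -QE => /simx_sym.
Qed.

(** For mutually inverse classes the difference behind [inprod_unipotent] is 0. Here [X] and [Y^-1]
    have the same diagonal blocks and differ in a corner, which coprimality makes harmless. *)
Lemma inprod_transvection n (M : 'M[K]_n) m k (a b f' : {poly K}) :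
  (0 < m)%N -> (0 < k)%N -> a \is monic -> b \is monic ->
  size a = m.+1 -> size b = k.+1 -> coprimep a b -> n = (m + k)%N ->
  (a * b)`_0 != 0 -> f' = recip (a * b) ->
  (M - 1%:M) *m (M - 1%:M) = 0 -> \rank (M - 1%:M) = 1 -> inprod (a * b) f' M.
Proof.
case: m => // m; case: k => // k _ _ ma mb sa sb cab nE ab0 -> R2 rR; subst n.
have [A cA] := exists_cycp ma sa; have [B cB] := exists_cycp mb sb.
pose S : 'M[K]_(m.+1, k.+1) := delta_mx 0 0.
pose M' := block_mx 1%:M S 0 1%:M.
have RE : M' - 1%:M = block_mx 0 S 0 0.
  by rewrite /M' scalar_mx_block opp_block_mx add_block_mx !subrr !subr0.
apply: (@inprod_sim _ _ _ M').
  apply/simx_sym; apply: square_zero_sim => //.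
    by rewrite RE mulmx_block !mulmx0 !mul0mx !addr0 block_mx0.
  by rewrite RE rR /block_mx row_mx0 rank_col_mx0 rank_row_0mx mxrank_delta.
exists (block_mx A (S *m B) 0 B), (invmx (block_mx A 0 0 B)).
have cZ := cycp_dblock cab cA cB; have uZ := cycp_unit cZ ab0.
split; [|exact: cycp_ublock|exact: cycp_invmx].
apply: (can_inj (mulmxK uZ)); rewrite -mulmxA mulVmx // mulmx1 /M'.
by rewrite mulmx_block !mulmx0 !mul0mx !mul1mx !addr0 !add0r.
Qed.

End CyclicTargets.

(** * Reduction to primary matrices *)

Section Reductions.

Variable K : fieldType.

(** [c^d f(x / c)] with [d] the degree of [f]: it belongs to [c *: X] when [f] belongs to [X]. *)
Definition scalep (c : K) (f : {poly K}) : {poly K} :=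
  c ^+ (size f).-1 *: (f \Po (c^-1 *: 'X)).

Lemma size_scaleX (c : K) : c != 0 -> size (c *: 'X : {poly K}) = 2.
Proof. by move=> c0; rewrite size_scale // size_polyX. Qed.

Lemma size_scalep c f : c != 0 -> size (scalep c f) = size f.
Proof.
by move=> c0; rewrite size_scale ?expf_neq0 // size_comp_poly2 // size_scaleX ?invr_eq0.
Qed.

Lemma scalep_monic c f : c != 0 -> f \is monic -> scalep c f \is monic.
Proof.
move=> c0 /monicP mf; apply/monicP; rewrite lead_coefZ lead_coef_comp ?size_scaleX ?invr_eq0 //.
by rewrite mf mul1r lead_coefZ lead_coefX mulr1 -exprMn divff // expr1n.
Qed.

Lemma scalepM c f g : c != 0 -> f \is monic -> g \is monic ->
  scalep c (f * g) = scalep c f * scalep c g.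
Proof.
move=> c0 mf mg; rewrite /scalep comp_polyM size_mul ?monic_neq0 // -scalerAl -scalerAr scalerA.
rewrite -exprD; congr (_ ^+ _ *: _).
have := size_poly_eq0 f; have := size_poly_eq0 g; rewrite !(negbTE (monic_neq0 _)) //.
by move: (size f) (size g) => x y; case: x y => [|x] [|y] //= _ _; rewrite addnS.
Qed.

Lemma scalepK c f : c != 0 -> scalep c (scalep c^-1 f) = f.
Proof.
move=> c0; rewrite {1}/scalep size_scalep ?invr_eq0 // /scalep comp_polyZ -comp_polyA.
rewrite comp_polyZ comp_polyX invrK (scalerA c) divff // scale1r comp_polyXr scalerA.
by rewrite -exprMn divff // expr1n scale1r.
Qed.

Lemma scalep_coef0 c f : (scalep c f)`_0 = c ^+ (size f).-1 * f`_0.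
Proof. by rewrite coefZ -!horner_coef0 horner_comp hornerZ hornerX mulr0. Qed.

Lemma coprimep_scalep c f g : c != 0 -> coprimep f g -> coprimep (scalep c f) (scalep c g).
Proof.
move=> c0 h; rewrite /scalep coprimepZl ?expf_neq0 // coprimepZr ?expf_neq0 //.
exact: coprimep_comp_poly.
Qed.

Lemma hmx_scale n (X : 'M[K]_n) c q : c != 0 -> hmx (c *: X) (q \Po (c^-1 *: 'X)) = hmx X q.
Proof.
move=> c0; rewrite hmx_comp_scale -comp_polyA comp_polyZ comp_polyX scalerA mulVf //.
by rewrite scale1r comp_polyXr.
Qed.

Lemma cycp_scale n (X : 'M[K]_n) c f : c != 0 -> cycp X f -> cycp (c *: X) (scalep c f).
Proof.
move=> c0 cX; have [u gu] := cycp_gen cX; have mf : f \is monic by case: cX.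
apply: (@gen_cycp _ _ _ u); rewrite ?scalep_monic ?size_scalep ?(cycp_size cX) //.
  by move=> y; have [q ->] := gu y; exists (q \Po (c^-1 *: 'X)); rewrite hmx_scale.
by rewrite hmxZ hmx_scale // (cycp_hmx0 cX) scaler0 mulmx0.
Qed.

Lemma inprod_scale n (N : 'M[K]_n) c f f' : c != 0 ->
  inprod f f' N -> inprod (scalep c f) f' (c *: N).
Proof.
move=> c0 [X [Y [-> cX cY]]]; exists (c *: X), Y; split=> //; first by rewrite scalemxAl.
exact: cycp_scale.
Qed.

Lemma coprime_kernels n (M : 'M[K]_n.+1) p q : coprimep p q -> hmx M (p * q) = 0 ->
  exists n1, exists n2, exists M1 : 'M[K]_n1, exists M2 : 'M[K]_n2,
    [/\ simx M (block_mx M1 0 0 M2), hmx M1 p = 0 & hmx M2 q = 0].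
Proof.
move=> cpq pq0.
have part (r : {poly K}) : exists M1 : 'M[K]_(\rank (kermxpoly M r)),
    row_base (kermxpoly M r) *m M = M1 *m row_base (kermxpoly M r) /\ hmx M1 r = 0.
  set U := row_base _; have Ur : U *m hmx M r = 0.
    by apply/sub_kermxP; rewrite eq_row_base.
  have [M1 E] : exists M1, U *m M = M1 *m U.
    apply/submxP; rewrite eq_row_base; apply/sub_kermxP.
    by rewrite -mulmxA -hmxS mulmxA -[X in X *m _]/(U *m hmx M r) Ur mul0mx.
  exists M1; split=> //; apply: (row_free_inj (row_base_free (kermxpoly M r))).
  by rewrite mul0mx (hmx_inter r (esym E)).
have [M1 [E1 h1]] := part p; have [M2 [E2 h2]] := part q.
exists _, _, M1, M2; split=> //.
have TM : col_mx (row_base (kermxpoly M p)) (row_base (kermxpoly M q)) *m M =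
    block_mx M1 0 0 M2 *m col_mx (row_base (kermxpoly M p)) (row_base (kermxpoly M q)).
  by rewrite mul_col_mx E1 E2 mul_block_col !mul0mx addr0 add0r.
have full : (kermxpoly M p + kermxpoly M q :=: 1%:M)%MS.
  apply: eqmx_trans (eqmx_sym (kermxpolyM M cpq)) _; apply: kermxpoly_min.
  exact: mxminpoly_min.
have dir : (kermxpoly M p :&: kermxpoly M q = 0)%MS by apply/eqP; rewrite mxdirect_kermxpoly.
have rE : (\rank (kermxpoly M p) + \rank (kermxpoly M q) = n.+1)%N.
  by rewrite -mxrank_sum_cap dir mxrank0 addn0 full mxrank1.
apply: (simx_row_basis _ rE TM).
rewrite /row_free -addsmxE (adds_eqmx (eq_row_base _) (eq_row_base _)).
by rewrite full mxrank1 rE.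
Qed.

Lemma inprod_nonprimary n (M : 'M[K]_n.+1) p q f f' : coprimep p q -> hmx M (p * q) = 0 ->
  hmx M p != 0 -> hmx M q != 0 -> admissible n.+1 f f' (\det M) -> inprod f f' M.
Proof.
move=> cpq pq0 p0 q0 ad.
have [n1 [n2 [M1 [M2 [sM h1 h2]]]]] := coprime_kernels cpq pq0.
have n10 : (0 < n1)%N.
  rewrite lt0n; apply: contraNneq q0 => z; subst n1; rewrite block_mx_empty in sM.
  by apply/eqP/(simx_hmx0 (simx_sym sM)).
have n20 : (0 < n2)%N.
  rewrite lt0n; apply: contraNneq p0 => z; subst n2.
  by apply/eqP; apply: (simx_hmx0 (simx_sym (simx_trans sM (simx_lblock_empty _ _ _)))).
exact: inprod_coprime n10 n20 sM cpq h1 h2 ad.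
Qed.

Lemma minpoly_cases n (M : 'M[K]_n.+1) :
  (exists p, exists q, [/\ coprimep p q, hmx M (p * q) = 0, hmx M p != 0 & hmx M q != 0]) \/
  (exists p, exists e, [/\ irreducible_poly p, p \is monic & mxminpoly M = p ^+ e]).
Proof.
set mu := mxminpoly M; have mmu : mu \is monic by apply: mxminpoly_monic.
have smu : (1 < size mu)%N by rewrite size_mxminpoly ltnS mxminpoly_nonconstant.
have [p [ip mp] pmu] := irreducible_factor smu.
have [e [g muE cg]] := irreducible_part ip (monic_neq0 mmu).
have g0 : g != 0 by apply: contraNneq (monic_neq0 mmu) => z; rewrite muE z mulr0.
have e0 : (0 < e)%N.
  rewrite lt0n; apply: contraL cg => /eqP z; rewrite muE z expr0 mul1r in pmu.
  by rewrite -(divpK pmu) coprimepMr coprimepp negb_and orbC; case: ip => s _; rewrite neq_ltn s orbT.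
have [sg|sg] := leqP (size g) 1; [right|left].
  exists p, e; split=> //; rewrite muE.
  have [c gE] : exists c, g = c%:P by exists g`_0; apply: size1_polyC.
  have := monicP mmu; rewrite muE gE lead_coefM (monicP (monic_exp e mp)) mul1r lead_coefC => ->.
  by rewrite mulr1.
exists (p ^+ e), g; split.
- exact: coprimep_expl.
- by rewrite -muE; apply: mx_root_minpoly.
- apply/eqP => /mxminpoly_min; rewrite -/mu muE -[X in _ %| X]mulr1 dvdp_mul2l ?expf_neq0 ?monic_neq0 //.
  by rewrite dvdp1 => /eqP s; rewrite s in sg.
apply/eqP => /mxminpoly_min; rewrite -/mu muE -[X in _ %| X]mul1r dvdp_mul2r //.
rewrite dvdp1 => /eqP s1; have := size_exp p e; rewrite s1 /= => /esym/eqP.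
case: ip => + _; rewrite muln_eq0 => + /orP[|]; first by move: (size p) => [|[|]].
by move=> _ /eqP z; rewrite z in e0.
Qed.

Definition cyclic_split m k (a b a' b' : {poly K}) : Prop :=
  [/\ (0 < m)%N && (0 < k)%N, [/\ a \is monic, b \is monic, a' \is monic & b' \is monic],
      [/\ size a = m.+1, size b = k.+1, size a' = m.+1 & size b' = k.+1],
      coprimep a b & coprimep a' b'].

Lemma cyclic_split_sym m k a b a' b' :
  cyclic_split m k a b a' b' -> cyclic_split k m b a b' a'.
Proof.
case=> [/andP[? ?] [? ? ? ?] [? ? ? ?] ? ?]; split=> //; first exact/andP.
  by rewrite coprimep_sym.
by rewrite coprimep_sym.
Qed.

Lemma cyclic_split_admissible n m k a b a' b' d : cyclic_split m k a b a' b' ->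
  n = (m + k)%N -> (a * b)`_0 * (a' * b')`_0 = d -> d != 0 ->
  admissible n (a * b) (a' * b') d.
Proof.
case=> [_ [? ? ? ?] [sa sb sa' sb'] ? ?] -> <- d0.
split; rewrite ?monicMl // size_mul ?monic_neq0 // ?sa ?sb ?sa' ?sb' addSn addnS //.
Qed.

(** Only the determinant of [N] has to be checked; that of [P] follows, because determinants
    multiply along a splitting. *)
Lemma LU_split n m k a b a' b' (M : 'M[K]_n) (P : 'M[K]_m) (N : 'M[K]_k) :
  cyclic_split m k a b a' b' -> M \in unitmx -> (a * b)`_0 * (a' * b')`_0 = \det M ->
  LUsim M P N -> \det N = b`_0 * b'`_0 ->
  (admissible m a a' (\det P) -> inprod a a' P) ->
  (admissible k b b' (\det N) -> inprod b b' N) -> inprod (a * b) (a' * b') M.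
Proof.
case=> [_ [? ? ? ?] [sa sb sa' sb'] cab cab'] uM dE lu dN hP hN.
have dM := LUsim_det lu.
have d0 : \det M != 0 by rewrite -unitfE -unitmxE.
have [dP0 dN0] : \det P != 0 /\ \det N != 0.
  by apply/andP; rewrite -negb_or -mulf_eq0 -dM.
apply: (LU_inprod lu cab cab'); [apply: hP|apply: hN]; split=> //; split=> //.
apply: (mulIf dN0); rewrite -dM -dE dN !coef0M; ring.
Qed.

End Reductions.

(** * Coprime factors over the field with two elements *)

Section TwoElementField.

Variable K : fieldType.
Hypothesis K2 : forall t : K, t = 0 \/ t = 1.

Lemma F2_neq0 (t : K) : t != 0 -> t = 1.
Proof. by case: (K2 t) => -> //; rewrite eqxx. Qed.

Lemma F2_char : 1 + 1 = 0 :> K.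
Proof.
case: (K2 (1 + 1)) => // /eqP; rewrite -subr_eq0 addrK => /eqP h.
by have := oner_neq0 K; rewrite h eqxx.
Qed.

Lemma F2_quadratic (a b : {poly K}) : a \is monic -> b \is monic -> size a = 3 -> size b = 3 ->
  a`_0 != 0 -> b`_0 != 0 -> a`_1 = b`_1 -> a = b.
Proof.
move=> ma mb sa sb a0 b0 e1; apply/polyP => -[|[|[|i]]] //.
- by rewrite (F2_neq0 a0) (F2_neq0 b0).
- by rewrite (monic_top ma sa) (monic_top mb sb).
- by rewrite !nth_default ?sa ?sb.
Qed.

Lemma F2_coprime_quadratic (a b : {poly K}) : a \is monic -> b \is monic ->
  size a = 3 -> size b = 3 -> a`_0 != 0 -> b`_0 != 0 -> coprimep a b -> a`_1 != b`_1.
Proof.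
move=> ma mb sa sb a0 b0; apply: contraL => /eqP e.
by rewrite (F2_quadratic ma mb sa sb a0 b0 e) coprimepp sb.
Qed.

(* The quadratic coefficient depends only on the degrees of the factors; this rules
   out the case not covered by [free_columns22]. *)
Lemma F2_split_coef m k (a b : {poly K}) : a \is monic -> b \is monic ->
  size a = m.+1 -> size b = k.+1 -> a`_0 != 0 -> b`_0 != 0 -> coprimep a b ->
  (0 < m)%N -> (0 < k)%N -> (m + k = 4)%N -> (a * b)`_2 = (m != 2)%:R.
Proof.
have case1 (f g : {poly K}) : f \is monic -> g \is monic -> size f = 2 -> size g = 4 ->
    f`_0 != 0 -> g`_0 != 0 -> coprimep f g -> (f * g)`_2 = 1.
  move=> mf mg sf sg f0 g0.
  have fE : f = 'X - 1%:P.
    apply/polyP => i; rewrite coefB coefX coefC; case: i => [|[|i]] /=.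
    - by rewrite (F2_neq0 f0) sub0r; apply/eqP; rewrite -addr_eq0 F2_char.
    - by rewrite (monic_top mf sf) subr0.
    - by rewrite nth_default ?subr0 // sf.
  rewrite coprimep_sym fE coprimep_XsubC /root => g1.
  have gE : g.[1] = g`_1 + g`_2.
    rewrite horner_coef sg !big_ord_recl big_ord0 /= /bump /= !expr1n !mulr1 addr0.
    rewrite (F2_neq0 g0) (monic_top mg sg) [RHS](_ : _ = (1 + 1) + (g`_1 + g`_2)).
      by ring.
    by rewrite F2_char add0r.
  rewrite mulrBl mul1r coefB coefXM /= -(F2_neq0 g1) gE.
  congr (_ + _); apply/eqP; rewrite eq_sym -addr_eq0.
  by rewrite -{1 2}[g`_2]mulr1 -mulrDr F2_char mulr0.
move=> ma mb sa sb a0 b0 cab m0 k0 mk.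
have : [|| m == 1, m == 2 | m == 3]%N by lia.
case/or3P => /eqP mE; subst m.
- have kE : k = 3 by lia.
  by subst k; apply: case1.
- have kE : k = 2 by lia.
  subst k; have ne := F2_coprime_quadratic ma mb sa sb a0 b0 cab.
  rewrite coefM !big_ord_recl big_ord0 /= /bump /= (F2_neq0 a0) (F2_neq0 b0).
  rewrite (monic_top ma sa) (monic_top mb sb) !mul1r addr0.
  have -> : a`_1 * b`_1 = 0.
    by move: ne; case: (K2 a`_1) => ->; case: (K2 b`_1) => ->; rewrite ?mul0r ?mulr0 ?eqxx.
  by rewrite add0r F2_char.
have kE : k = 1 by lia.
by subst k; rewrite mulrC; apply: case1; rewrite // coprimep_sym.
Qed.

End TwoElementField.

(** * Unipotent matrices with square-zero nilpotent part *)

Section UnipotentSquareZero.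

Variable K : fieldType.

(** Rank 1 needs only [D != 0], and [D = 0] means inverse classes, where the transvection is
    explicit. Higher rank always has independent columns, except that in size 4 the field with two
    elements needs an argument on [D]. *)
Lemma inprod_unipotent_square n (M : 'M[K]_n) m k a b a' b' :
  cyclic_split m k a b a' b' -> n = (m + k)%N -> (4 <= n)%N ->
  (a * b)`_0 * (a' * b')`_0 = 1 -> (M - 1%:M) *m (M - 1%:M) = 0 -> M - 1%:M != 0 ->
  inprod (a * b) (a' * b') M.
Proof.
move=> sp nE n4 e0 RR R0; have ad := cyclic_split_admissible sp nE e0 (oner_neq0 K).
have [f0 f'0] := admissible_neq0 ad; have [mf mf' sf sf' _] := ad.
set f := a * b in ad f0 mf sf e0 *; set f' := a' * b' in ad f'0 mf' sf' e0 *.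
pose D := drop_poly 1 (f - recip f').
have sD : (size D <= n.-1)%N.
  rewrite size_drop_poly -subn1 leq_sub2r //; apply/leq_sizeP => j nj; rewrite coefB.
  have [->|jn] := eqVneq j n.
    by rewrite !monic_top ?subrr ?recip_monic ?size_recip.
  by rewrite !nth_default ?subrr ?size_recip ?sf ?sf' //; lia.
have [s [Q _ sM]] := simx_square_zero RR.
have nrs := simx_size sM.
have rk : (\rank (M - 1%:M)%R + \rank (M - 1%:M)%R <= n)%N.
  have := mxrank_mul_ker (M - 1%:M) (M - 1%:M); rewrite RR mxrank0 add0n.
  have := mxrank_ker (M - 1%:M); have := mxrankS (capmxSr (M - 1%:M) (kermx (M - 1%:M))).
  have := rank_leq_row (M - 1%:M).
  move: (\rank (M - 1%:M)) (\rank (kermx _)) (\rank (_ :&: _)%MS) => x y z; lia.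
have r0 : (0 < \rank (M - 1%:M)%R)%N by rewrite lt0n mxrank_eq0.
have main : free_columns (\rank (M - 1%:M)) s D -> inprod f f' M.
  case=> C [sC CE Cf]; apply: (inprod_square_zero RR nrs r0 _ ad sC CE Cf); lia.
have [r1|r1] := eqVneq (\rank (M - 1%:M)) 1%N.
  have [D0|D0] := eqVneq D 0; last first.
    apply: main; exists (fun=> D); rewrite r1; split.
    - by move=> j _; apply: leq_trans sD _; lia.
    - by rewrite big_ord1 expr0 mulr1.
    move=> y; rewrite big_ord1 => /eqP; rewrite scaler_eq0 (negbTE D0) orbF => /eqP y0 [|j] //.
  have fE : f = recip f'.
    apply/eqP; rewrite -subr_eq0; apply/eqP.
    rewrite -(poly_take_drop 1 (f - recip f')) -/D D0 mul0r addr0.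
    apply/polyP => -[|i]; rewrite coef_take_poly //= !coef0 //.
    by rewrite coefB recip_coef0 // -[f`_0](mulfK f'0) e0 div1r subrr.
  have [/andP[m0 k0] [ma mb _ _] [sa sb _ _] cab _] := sp.
  apply: (inprod_transvection m0 k0 ma mb sa sb cab nE f0 _ RR r1).
  by rewrite -/f fE recipK.
apply: main; move: (\rank (M - 1%:M)) r0 r1 rk nrs {Q sM} => r r0 r1 rk nrs.
apply: free_columns_exist; [by lia|by lia|by rewrite -nrs|].
have [s3|s3] := leqP 3 s; [by left|right].
(* The values at 0 and 1 give [D_0 D_2 = 0] and [D_1 = 1]; then [t^2 = t] for all [t]. *)
apply: contrapT => /forallNP bad.
have {}bad t : t ^+ 2 - D`_1 * t + D`_0 * D`_2 = 0 by apply/eqP/negPn/negP/bad.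
have n4E : n = 4 by lia.
have d02 : D`_0 * D`_2 = 0 by rewrite -[RHS](bad 0) expr0n mulr0 subr0 add0r.
have d1 : D`_1 = 1.
  by have := bad 1; rewrite d02 addr0 mulr1 expr1n => /eqP; rewrite subr_eq0 eq_sym => /eqP.
have K2 (t : K) : t = 0 \/ t = 1.
  have := bad t; rewrite d02 d1 addr0 mul1r expr2 -{3}[t]mulr1 -mulrBr => /eqP.
  by rewrite mulf_eq0 subr_eq0 => /orP[]/eqP ->; [left|right].
have [/andP[m0 k0] [ma mb ma' mb'] [sa sb sa' sb'] cab cab'] := sp.
have nz (p q : {poly K}) : (p * q)`_0 != 0 -> p`_0 != 0 /\ q`_0 != 0.
  by rewrite coef0M mulf_eq0 negb_or => /andP.
have [a0 b0] := nz _ _ f0; have [a'0 b'0] := nz _ _ f'0.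
have mk : (m + k = 4)%N by rewrite -nE.
have E1 := F2_split_coef K2 ma mb sa sb a0 b0 cab m0 k0 mk.
have E2 := F2_split_coef K2 ma' mb' sa' sb' a'0 b'0 cab' m0 k0 mk.
(* In degree 4 reversal fixes the middle coefficient, so [D_1] is the difference of the quadratic
   coefficients of [f] and [f'], which agree. *)
move: d1; rewrite /D coef_drop_poly coefB /recip coef_poly sf' n4E /= (F2_neq0 K2 f'0) divr1.
rewrite /f /f' E1 E2 subrr => /eqP; rewrite eq_sym (negbTE (oner_neq0 K)) //.
Qed.

End UnipotentSquareZero.

(** * Chains and kernels of primary matrices *)

Section PrimaryMatrices.

Variable K : fieldType.

(** A nonzero [h] of this size is [p ^+ i] with [i <= j] times a factor prime to [p]; then [p ^+ j]
    lies in the ideal of [h] and [p ^+ j.+1] and would kill [u]. *)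
Lemma primary_order_min n (M : 'M[K]_n) (u : 'rV_n) p j (h : {poly K}) : irreducible_poly p ->
  u *m hmx M (p ^+ j.+1) = 0 -> u *m hmx M (p ^+ j) != 0 ->
  (size h < size (p ^+ j.+1)%R)%N -> u *m hmx M h = 0 -> h = 0.
Proof.
move=> ip up1 upj sh uh; apply: contrapT => /eqP h0.
have p0 : p != 0 by case: ip => s _; rewrite -size_poly_gt0; lia.
have [i [g hE cpg]] := irreducible_part ip h0.
have g0 : g != 0 by apply: contraNneq h0 => z; rewrite hE z mulr0.
have ij : (i <= j)%N.
  rewrite leqNgt; apply/negP => ji; move: sh; rewrite ltnNge => /negP; apply.
  by apply: dvdp_leq => //; rewrite hE dvdp_mulr // dvdp_exp2l.
have [[x y] /= xy] := Bezout_eq1_coprimepP _ _ (coprimep_expl j.+1 cpg).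
move/eqP: upj; apply.
have -> : p ^+ j = p ^+ j.+1 * (x * p ^+ j) + h * (y * p ^+ (j - i)).
  transitivity ((x * p ^+ j.+1 + y * g) * p ^+ j); first by rewrite xy mul1r.
  rewrite hE (_ : p ^+ i * g * _ = p ^+ i * p ^+ (j - i) * (y * g)); last by ring.
  by rewrite -exprD subnKC //; ring.
by rewrite hmxD mulmxDr !hmxM !mulmxA up1 uh !mul0mx addr0.
Qed.

Lemma exists_primary_vector n (M : 'M[K]_n) p e j :
  hmx M (p ^+ e) = 0 -> hmx M (p ^+ j) != 0 ->
  exists2 u : 'rV_n, u *m hmx M (p ^+ j.+1) = 0 & u *m hmx M (p ^+ j) != 0.
Proof.
elim: e => [|e IH] h0 hj.
  by rewrite expr0 hmx1 in h0; rewrite -[hmx M _]mul1mx h0 mul0mx eqxx in hj.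
have [z|nz] := eqVneq (hmx M (p ^+ e)) 0; first exact: IH.
have [i ui] : exists i, row i (hmx M (p ^+ e)) != 0.
  apply: contrapT => /forallNP h; move/eqP: nz; apply; apply/row_matrixP => i; rewrite row0.
  by apply/eqP/negPn/negP/h.
rewrite rowE in ui.
have [je|ej] := leqP j e.
  exists (delta_mx 0 i *m hmx M (p ^+ (e - j))).
    by rewrite -mulmxA -hmxM -exprD addnS subnK // h0 mulmx0.
  by rewrite -mulmxA -hmxM -exprD subnK.
by move: hj; rewrite -(subnKC ej) exprD hmxM h0 mul0mx eqxx.
Qed.

Lemma simx_chain n (M : 'M[K]_n) p e j : irreducible_poly p -> p \is monic ->
  hmx M (p ^+ e) = 0 -> hmx M (p ^+ j) != 0 ->
  exists s, exists X, exists M2 : 'M[K]_s,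
    simx M (block_mx (companionmx (p ^+ j.+1)) 0 X M2) /\ hmx M2 (p ^+ e) = 0.
Proof.
move=> ip mp h0 hj; have [u u1 u2] := exists_primary_vector h0 hj.
have [|s [X [M2 sM]]] := @simx_order _ _ M u (p ^+ j.+1) (monic_exp _ mp) u1.
  by move=> h sh; apply: primary_order_min u1 u2 sh.
by exists s, X, M2; split=> //; have [] := hmx_lblock0 sM h0.
Qed.

Lemma rank_nilpotent n (R : 'M[K]_n.+1) e j : R ^+ e = 0 -> R ^+ j != 0 ->
  (\rank (R ^+ j.+1) < \rank (R ^+ j))%N.
Proof.
move=> Re Rj; have sub : (R ^+ j.+1 <= R ^+ j)%MS by rewrite exprS submxMl.
rewrite (ltn_neqAle) mxrankS // andbT; apply: contraNneq Rj => rE.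
have /submxP[X XE] : (R ^+ j <= R ^+ j.+1)%MS by rewrite -(geq_leqif (mxrank_leqif_sup sub)) rE.
have it i : R ^+ j = X ^+ i * R ^+ (j + i).
  elim: i => [|i IH]; first by rewrite expr0 mul1r addn0.
  have e1 : R ^+ (j + i) = X * R ^+ (j + i.+1).
    by rewrite exprD {1}XE -mulmxE -mulmxA mulmxE -exprD addSnnS.
  by rewrite IH {1}e1 mulrA -exprSr.
by rewrite (it e) exprD Re !mulr0.
Qed.

Lemma rank_ker_pow n (B : 'M[K]_n.+1) e : B ^+ e = 0 -> (n.+1 <= e * \rank (kermx B))%N.
Proof.
move=> Be; suff: (n.+1 <= \rank (B ^+ e) + e * \rank (kermx B))%N by rewrite Be mxrank0.
elim: e {Be} => [|e IH]; first by rewrite expr0 mxrank1 leq_addr.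
apply: leq_trans IH _; rewrite mulSn exprSr addnA leq_add2r.
by rewrite -(mxrank_mul_ker (B ^+ e) B) leq_add2l mxrankS // capmxSr.
Qed.

(** Each further power of [p(M)] loses at most the dimension of its kernel. A kernel of dimension at
    most [deg p] would bound the size of [M] by [e deg p], the degree of the minimal polynomial. *)
Lemma noncyclic_rank_ker n (M : 'M[K]_n.+1) p e : mxminpoly M = p ^+ e ->
  mxminpoly M != char_poly M -> ((size p).-1 < \rank (kermx (hmx M p)))%N.
Proof.
move=> mE nc; rewrite ltnNge; apply: contra nc => rk.
have h0 : (hmx M p) ^+ e = 0.
  have := mx_root_minpoly M; rewrite mE => h; rewrite -[RHS]h -[horner_mx M _]/(hmx M (p ^+ e)).
  by elim: e {mE h} => [|e IH]; rewrite ?expr0 ?hmx1 // !exprS hmxM IH.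
have := rank_ker_pow h0; move/leq_trans => /(_ _ (leq_mul (leqnn e) rk)) => ne.
have s1 : (n.+2 <= size (mxminpoly M))%N.
  have pos : (0 < size (p ^+ e)%R)%N.
    by rewrite size_poly_gt0 -mE monic_neq0 // mxminpoly_monic.
  by rewrite mE -(ltn_predK pos) ltnS size_exp mulnC.
rewrite -eqp_monic ?mxminpoly_monic ?char_poly_monic // -dvdp_size_eqp ?mxminpoly_dvd_char //.
rewrite eqn_leq dvdp_leq ?mxminpoly_dvd_char ?monic_neq0 ?char_poly_monic //=.
by rewrite size_char_poly.
Qed.

End PrimaryMatrices.

(** * Splitting unipotent matrices along Jordan chains *)

Section UnipotentTargets.

Variable K : fieldType.

Lemma irreducible_Xsub1 : irreducible_poly ('X - 1 : {poly K}) /\ ('X - 1 : {poly K}) \is monic.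
Proof. by rewrite -polyC1; split; [apply: irredp_XsubC|apply: monicXsubC]. Qed.

Lemma hmx_Xsub1 n (M : 'M[K]_n) : hmx M ('X - 1) = M - 1%:M.
Proof. by rewrite hmxB hmxX hmx1. Qed.

Lemma hmx_Xsub1_exp n (M : 'M[K]_n) e : hmx M (('X - 1) ^+ e) = (M - 1%:M) ^+ e.
Proof. by elim: e => [|e IH]; rewrite ?expr0 ?hmx1 // !exprS hmxM IH hmx_Xsub1. Qed.

Lemma size_Xsub1_exp e : size (('X - 1) ^+ e : {poly K}) = e.+1.
Proof. by rewrite -polyC1 size_exp_XsubC. Qed.

Lemma coef0_Xsub1_exp e : (('X - 1) ^+ e : {poly K})`_0 = (-1) ^+ e.
Proof. by rewrite -horner_coef0 horner_exp !hornerE. Qed.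

Lemma cycp_Xsub1_exp e : cycp (companionmx (('X - 1) ^+ e : {poly K})) (('X - 1) ^+ e).
Proof. by apply: cycp_companion; apply: monic_exp; case: irreducible_Xsub1. Qed.

Lemma hmx_scalar1 (x : K) : hmx (x%:M : 'M_1) ('X - x%:P) = 0.
Proof. by rewrite hmxB hmxX hmxC subrr. Qed.

Lemma cycp_scalar1 (c : K) : cycp (c%:M : 'M_1) ('X - c%:P).
Proof.
apply: (gen_cycp (gen_dim1 _)); rewrite ?monicXsubC ?size_XsubC //.
by rewrite hmx_scalar1 mulmx0.
Qed.

Lemma coprime_Xsub (c : K) : c != 1 -> coprimep ('X - c%:P) ('X - 1).
Proof. by move=> h; apply: coprimep_XsubCl; rewrite !hornerE subr_eq0. Qed.

Lemma simx_unipotent_chain n (M : 'M[K]_n) e j : hmx M (('X - 1) ^+ e) = 0 ->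
  (M - 1%:M) ^+ j != 0 ->
  exists s, exists X, exists M2 : 'M[K]_s,
    [/\ simx M (block_mx (companionmx (('X - 1) ^+ j.+1)) 0 X M2), hmx M2 (('X - 1) ^+ e) = 0
      & n = (j.+1 + s)%N].
Proof.
rewrite -hmx_Xsub1_exp => h hj; have [ip mp] := irreducible_Xsub1.
have [s [X [M2 [sM h2]]]] := simx_chain ip mp h hj.
exists s, X, M2; split=> //; have := simx_size sM.
by rewrite size_Xsub1_exp.
Qed.

Lemma simx_lblock_unit n n1 n2 (M : 'M[K]_n) (M1 : 'M[K]_n1) X (M2 : 'M[K]_n2) :
  simx M (block_mx M1 0 X M2) -> M \in unitmx -> M1 \in unitmx /\ M2 \in unitmx.
Proof. by move=> sM /(simx_unitmx sM); rewrite unit_block_lower => /andP. Qed.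

(** A chain of length 2 splits into the entries [1 / d] and [d]. They differ from 1, hence are
    coprime to the unipotent rests, and they carry the determinants of both sides. *)
Lemma inprod_unipotent_det n (M : 'M[K]_n) e m k a b a' b' :
  cyclic_split m k a b a' b' -> n = (m + k)%N -> M \in unitmx ->
  (a * b)`_0 * (a' * b')`_0 = 1 -> hmx M (('X - 1) ^+ e) = 0 -> M - 1%:M != 0 ->
  b`_0 * b'`_0 != 1 -> inprod (a * b) (a' * b') M.
Proof.
move=> sp nE uM e0 h0 R0 d1; set d := b`_0 * b'`_0 in d1.
have [ip mp] := irreducible_Xsub1.
have d0 : d != 0.
  apply: contraTneq (oner_neq0 K) => z; rewrite -e0 !coef0M mulrACA -/d z mulr0.
  by rewrite eqxx.
have [/andP[m0 k0] _ _ _ _] := sp.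
case: m m0 => // m _ in sp nE *; case: k k0 => // k _ in sp nE *.
rewrite -[M - _]expr1 in R0.
have [s [X [M2 [sM h2 nE']]]] := simx_unipotent_chain h0 R0.
have [_ u2] := simx_lblock_unit sM uM.
have sE : s = (m + k)%N by lia.
have s1 : (size ('X - 1 : {poly K})).-1 = 1%N by rewrite -polyC1 size_XsubC.
have [P2 [N2 [e' [lu2 hP2 hN2]]]] :=
  @primary_split K s m k m k M2 _ e ip mp u2 h2 sE (etrans (esym (mul1n _)) (congr1 (muln^~ _) (esym s1)))
     (etrans (esym (mul1n _)) (congr1 (muln^~ _) (esym s1))).
have lu1 : LUsim (companionmx (('X - 1) ^+ 2 : {poly K})) (d^-1%:M : 'M_1) (d%:M : 'M_1).
  apply: (LUsim_cycp _ _ _ (cycp_Xsub1_exp 2) (cycp_scalar1 _) (cycp_scalar1 _)) => //.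
  - by rewrite size_Xsub1_exp.
  - by rewrite coef0_Xsub1_exp !coefB !coefX !coefC /= !sub0r mulrNN mulVf // expr2 mulrNN mulr1.
  by rewrite coefB coefX coefC /= sub0r oppr_eq0.
have [Y [Z lu]] := LUsim_block X lu1 lu2.
have {}lu := LUsim_sim sM lu.
have dN2 := unipotent_det hN2; have dP2 := unipotent_det hP2.
apply: (LU_split sp uM _ lu).
- by rewrite e0; rewrite (unipotent_det h0).
- by rewrite (@det_lblock _ 1 k) dN2 mulr1 det_scalar1.
- move=> ad; apply: (@inprod_side K 1 m d^-1%:M P2 Y ('X - d^-1%:P) ('X - 1) e') => //.
  + exact: hmx_scalar1.
  + by apply: coprime_Xsub; rewrite invr_eq1.
  + by rewrite -(@det_lblock _ 1 m _ Y).
  by move=> _; apply: inprod1.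
move=> ad; apply: (@inprod_side K 1 k d%:M N2 Z ('X - d%:P) ('X - 1) e') => //.
- exact: hmx_scalar1.
- exact: coprime_Xsub.
- by rewrite -(@det_lblock _ 1 k _ Z).
by move=> _; apply: inprod1.
Qed.

(** The sixth cyclotomic polynomial has the value 1 at 0 and at 1 over every field and is its own
    reciprocal: a block with this characteristic polynomial has determinant 1 and is coprime to any
    unipotent rest, and so is its inverse. *)
Definition phi6 : {poly K} := 'X^2 - 'X + 1.

Lemma phi6_monic : phi6 \is monic /\ size phi6 = 3.
Proof.
have s : (size (- 'X + 1 : {poly K})%R < 3)%N.
  by rewrite (leq_ltn_trans (size_polyD _ _)) // size_polyN size_polyX size_poly1.
rewrite /phi6 -addrA; split; last by rewrite size_polyDl size_polyXn.
by rewrite monicE lead_coefDl ?size_polyXn // lead_coefXn.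
Qed.

Lemma phi6_coef0 : phi6`_0 = 1.
Proof. by rewrite !coefD coefN coefXn coefX coef1 /= subr0 add0r. Qed.

Lemma coprime_phi6 : coprimep phi6 ('X - 1).
Proof.
rewrite coprimep_sym -polyC1; apply: coprimep_XsubCl.
by rewrite !hornerE expr1n subrr add0r oner_neq0.
Qed.

Lemma exists_phi6 : exists2 N : 'M[K]_2, cycp N phi6 & \det N = 1.
Proof.
have [m s] := phi6_monic; have [N cN] := exists_cycp m s; exists N => //.
by rewrite (cycp_det cN) phi6_coef0 expr2 mulrNN !mulr1.
Qed.

Lemma inprod_phi6 r s (N1 : 'M[K]_r) (M2 : 'M[K]_s) Z e f f' : (0 < r)%N -> (0 < s)%N ->
  hmx N1 phi6 = 0 -> hmx M2 (('X - 1) ^+ e) = 0 ->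
  admissible (r + s) f f' (\det (block_mx N1 0 Z M2)) -> inprod f f' (block_mx N1 0 Z M2).
Proof.
move=> r0 s0 h1 h2 ad; apply: (@inprod_side K r s N1 M2 Z phi6 ('X - 1) e f f' r0 h1 h2 coprime_phi6); first by rewrite -(det_lblock _ Z).
by move=> z; rewrite z in s0.
Qed.

(** A chain of length 3 splits into the entry 1, all that the side of size 1 can hold, and a [phi6]
    block. The unipotent rest beside this block is nonempty because [4 <= n]. *)
Lemma inprod_unipotent_left1 n (M : 'M[K]_n) e k a b a' b' :
  cyclic_split 1 k a b a' b' -> n = (1 + k)%N -> M \in unitmx -> (4 <= n)%N ->
  (a * b)`_0 * (a' * b')`_0 = 1 -> hmx M (('X - 1) ^+ e) = 0 -> (M - 1%:M) ^+ 2 != 0 ->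
  b`_0 * b'`_0 = 1 -> inprod (a * b) (a' * b') M.
Proof.
move=> sp nE uM n4 e0 h0 R2 d1.
have [s [X [M2 [sM h2 nE']]]] := simx_unipotent_chain h0 R2.
have [_ u2] := simx_lblock_unit sM uM.
have [N1 cN1 dN1] := exists_phi6.
have lu1 : LUsim (companionmx (('X - 1) ^+ 3 : {poly K})) (1%:M : 'M_1) N1.
  apply: (LUsim_cycp _ _ _ (cycp_Xsub1_exp 3) (cycp_scalar1 _) cN1) => //.
  - by rewrite size_Xsub1_exp.
  - by rewrite coef0_Xsub1_exp phi6_coef0 coefB coefX coefC /= sub0r mulr1 -signr_odd expr1.
  by rewrite phi6_coef0 oner_neq0.
have [Y [Z lu]] := LUsim_block X lu1 (LUsim_full u2).
have {}lu := LUsim_sim sM lu.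
have kE : k = (2 + s)%N by lia.
subst k; apply: (LU_split sp uM _ lu).
- by rewrite e0 (unipotent_det h0).
- by rewrite det_lblock dN1 (unipotent_det h2) mulr1.
- by move=> ad; apply: (@inprod1 K).
by apply: (inprod_phi6 _ _ (cycp_hmx0 cN1) h2) => //; lia.
Qed.

Lemma not_all_submx m n r (A : 'M[K]_(m, n)) (V : 'M_(r, n)) : (r < \rank A)%N ->
  exists2 y : 'rV_n, (y <= A)%MS & ~~ (y <= V)%MS.
Proof.
move=> rA; have : ~~ (A <= V)%MS.
  apply/negP => /mxrankS; rewrite leqNgt => /negP; apply.
  by apply: leq_ltn_trans rA; apply: rank_leq_row.
by case/row_subPn => i yi; exists (row i A) => //; apply: row_sub.
Qed.

(** A side of size 2 has no room for [phi6] and a rest. It is left unipotent, with the off-diagonal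
    entry that [inprod_triangular] supplies, and a second kernel vector [y] realizes this entry. The
    other side holds [phi6] and a rest that is nonempty because [5 <= n]. *)
Lemma inprod_unipotent_left2 n (M : 'M[K]_n) e k a b a' b' :
  cyclic_split 2 k a b a' b' -> n = (2 + k)%N -> M \in unitmx -> (5 <= n)%N ->
  (a * b)`_0 * (a' * b')`_0 = 1 -> hmx M (('X - 1) ^+ e) = 0 -> (M - 1%:M) ^+ 2 != 0 ->
  (1 < \rank (kermx (M - 1%:M)))%N ->
  b`_0 * b'`_0 = 1 -> inprod (a * b) (a' * b') M.
Proof.
move=> sp nE uM n5 e0 h0 R2 rk d1.
have [_ [ma mb ma' mb'] [sa sb sa' sb'] _ _] := sp.
have d2 : a`_0 * a'`_0 = 1 by move: e0; rewrite !coef0M mulrACA d1 mulr1.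
have [Q ipQ] : exists Q, inprod a a' (block_mx 1%:M 0 Q 1%:M : 'M[K]_(1 + 1)).
  apply: inprod_triangular => //; rewrite !det1 mulr1; split=> //; split=> //.
  exact: oner_neq0.
pose c := - Q 0 0.
have ipP : inprod a a' (block_mx 1%:M (- c)%:M 0 1%:M : 'M[K]_(1 + 1)).
  apply: inprod_sim ipQ; rewrite {1}[Q]mx11_scalar /c opprK; exact: simx_swap.
set R := M - 1%:M in R2 rk *.
have [e0v u1 u2] : exists2 u : 'rV_n, u *m R *m R *m R = 0 & u *m R *m R != 0.
  have := h0; rewrite -/R in R2; rewrite -hmx_Xsub1_exp in R2.
  move=> /exists_primary_vector /(_ R2)[u]; rewrite !hmx_Xsub1_exp -/R !exprSr expr0 mul1r -!mulmxE.
  by rewrite !mulmxA => ? ?; exists u.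
pose e1 := e0v *m R; pose e2 := e1 *m R.
have e2R : e2 *m R = 0 by [].
have e2n : e2 != 0 by [].
have [y yk yn] := not_all_submx e2 rk.
have yR : y *m R = 0 by apply/sub_kermxP.
have MR : M = 1%:M + R by rewrite /R addrC subrK.
have vM v : v *m M = v + v *m R by rewrite MR mulmxDr mulmx1.
(* The basis [e0v], [y], [f2], [f3] is chosen so that the lower right block has
   characteristic polynomial [phi6] and the Schur complement is the given transvection. *)
pose f2 := - e1 + e2 - c *: y; pose f3 := e2 - e0v.
pose U := col_mx (col_mx e0v y) (col_mx f2 f3).
pose A : 'M[K]_(1 + 1) := block_mx 2%:M (- c)%:M 0 1%:M.
pose B : 'M[K]_(1 + 1) := block_mx (-1)%:M 1%:M 0 0.
pose C : 'M[K]_(1 + 1) := block_mx (-1)%:M 0 (-1)%:M c%:M.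
pose N1 : 'M[K]_(1 + 1) := block_mx 1%:M (-1)%:M 1%:M 0.
have UM : U *m M = block_mx A B C N1 *m U.
  rewrite /U mul_block_col /A /B /C /N1 !mul_block_col !mul_col_mx !vM !mul_scalar_mx !mul0mx.
  rewrite !add_col_mx /f2 /f3 !mulmxDl !mulNmx -/e1 -/e2 e2R -scalemxAl yR.
  rewrite !scaler0 !addr0 !add0r !scale1r !scaleN1r -[2]/(1 + 1) scalerDl scale1r !scaleNr.
  congr (col_mx (col_mx _ _) (col_mx _ _)); apply/rowP => i; rewrite !mxE; ring.
have fU : row_free U.
  apply: row_free4 => r0 r1 r2 r3 h.
  have E1 : r0 *: e1 + (- r2 *: e2 - r3 *: e1) = 0.
    have := congr1 (fun z => z *m R) h; rewrite /f2 /f3 mul0mx !mulmxDl -!scalemxAl.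
    rewrite !mulmxDl !mulNmx -scalemxAl yR e2R -/e1 -/e2 !scaler0 !addr0 !subr0 add0r.
    by rewrite !scalerN scaleNr.
  have E2 : r0 *: e2 - r3 *: e2 = 0.
    have := congr1 (fun z => z *m R) E1; rewrite mul0mx !mulmxDl !mulNmx -!scalemxAl e2R -/e2.
    by rewrite scaler0 add0r.
  have r03 : r3 = r0.
    by move/eqP: E2; rewrite -scalerBl scaler_eq0 (negbTE e2n) orbF subr_eq0 => /eqP.
  have r20 : r2 = 0.
    move/eqP: E1; rewrite r03 addrCA subrr addr0 scaler_eq0 (negbTE e2n) orbF oppr_eq0.
    by move/eqP.
  have r10 : r1 = 0.
    apply: contraNeq yn => r1n; apply/sub_rVP; exists (- r1^-1 * r0).
    have : r1 *: y = - r0 *: e2.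
      apply/eqP; rewrite -subr_eq0; apply/eqP; rewrite -[RHS]h r20 r03 /f3.
      apply/rowP => i; rewrite !mxE; ring.
    move=> /(congr1 (fun z => r1^-1 *: z)); rewrite !scalerA mulVf // scale1r => ->.
    by congr (_ *: _); ring.
  have r00 : r0 = 0.
    move/eqP: h; rewrite r10 r20 r03 /f3 !scale0r !add0r !addr0 scalerBr addrC subrK.
    by rewrite scaler_eq0 (negbTE e2n) orbF => /eqP.
  by rewrite r03.
have [s [X [M2 sM]]] := simx_submodule fU UM.
have nE' := simx_size sM.
have [h1 h2] := hmx_lblock0 sM h0.
have [_ uM2] := simx_lblock_unit sM uM.
have eN1 : N1 *m block_mx 0 1%:M (-1)%:M 1%:M = 1%:M.
  rewrite /N1 mulmx_block !mul0mx !mulmx0 !mul1mx !mulmx1 !addr0 !add0r.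
  rewrite !mul_scalar_mx (scalar_mx_block 1 1 1); congr (block_mx _ _ _ _); apply/matrixP => i j;
  by rewrite !mxE ?ord1 /=; ring.
have uN1 : N1 \in unitmx by case/mulmx1_unit: eN1.
have lu1 : LUsim (block_mx A B C N1) (block_mx 1%:M (- c)%:M 0 1%:M : 'M[K]_(1 + 1)) N1.
  exists A, B, C; split=> //; first exact: simx_refl.
  have CE : C = N1 *m block_mx (-1)%:M c%:M 0 c%:M.
    rewrite /N1 /C mulmx_block !mul0mx !mulmx0 !mul1mx !addr0.
    by rewrite mul_scalar_mx scaleN1r subrr.
  rewrite -mulmxA CE mulKmx // /B mulmx_block !mul0mx !mulmx0 !mul1mx !addr0.
  rewrite !mul_scalar_mx /A opp_block_mx add_block_mx; congr (block_mx _ _ _ _);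
  by apply/matrixP => i j; rewrite !mxE ?ord1 /=; ring.
have phiN : hmx N1 phi6 = 0.
  rewrite hmxD hmxB hmxXn hmxX hmx1 expr2 -mulmxE /N1 mulmx_block !mul0mx !mulmx0 !mul1mx !addr0.
  rewrite ?mulmx1 (scalar_mx_block 1 1 1) opp_block_mx !add_block_mx ?mul_scalar_mx.
  rewrite -[RHS](block_mx0 K 1 1 1 1); congr (block_mx _ _ _ _); apply/matrixP => i j; rewrite !mxE ?ord1 /=; ring.
have [Y [Z lu]] := LUsim_block X lu1 (LUsim_full uM2).
have {}lu := LUsim_sim sM lu.
have s0 : (0 < s)%N by move: n5; rewrite nE'; case: (s).
have kE : k = ((1 + 1) + s)%N by apply: (@addnI 2); rewrite -nE nE'.
subst k; apply: (LU_split sp uM _ lu).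
- by rewrite e0 (unipotent_det h0).
- have := LUsim_det lu; rewrite (unipotent_det h0) [\det (block_mx _ 0 Y _)]det_lblock det_ublock.
  by rewrite !det1 det_mx00 !mul1r d1 => <-.
- by move=> ad; apply: inprod_sim ipP; apply: simx_sym (@simx_lblock_empty _ (1 + 1) _ Y 0).
exact: (@inprod_phi6 (1 + 1) s N1 M2 Z e b b' isT s0 phiN h2).
Qed.

End UnipotentTargets.

(** * Assembly of the unipotent case, and a single eigenvalue *)

Section UnipotentAssembly.

Variable K : fieldType.

Lemma exists_free_rows m n r (A : 'M[K]_(m, n)) : (r <= \rank A)%N ->
  exists S : 'M[K]_(r, m), row_free (S *m A).
Proof.
move=> rA; exists (pid_mx r *m invmx (col_ebase A)).
have -> : pid_mx r *m invmx (col_ebase A) *m A = (pid_mx r : 'M_(r, n)) *m row_ebase A.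
  rewrite -{2}[A]mulmx_ebase !mulmxA mulmxKV ?col_ebase_unit // mul_pid_mx.
  by rewrite (minn_idPl rA) (minn_idPr _) // (leq_trans rA) // rank_leq_row.
rewrite /row_free mxrankMfree ?row_free_unit ?row_ebase_unit // rank_pid_mx //.
exact: leq_trans rA (rank_leq_col A).
Qed.

Lemma unipotent_finish n s (M : 'M[K]_n) e m k a b a' b' (M1 : 'M[K]_(2 + 2)) X (M2 : 'M[K]_s)
    (P1 N1 : 'M[K]_2) :
  cyclic_split m k a b a' b' -> n = (m + k)%N -> M \in unitmx -> (3 <= m)%N -> (3 <= k)%N ->
  (a * b)`_0 * (a' * b')`_0 = 1 -> hmx M (('X - 1) ^+ e) = 0 -> b`_0 * b'`_0 = 1 ->
  simx M (block_mx M1 0 X M2) -> LUsim M1 P1 N1 ->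
  hmx P1 (phi6 K) = 0 -> hmx N1 (phi6 K) = 0 -> \det N1 = 1 ->
  inprod (a * b) (a' * b') M.
Proof.
move=> sp nE uM m3 k3 e0 h0 d1 sM lu1 hP1 hN1 dN1.
have [ip mp] := irreducible_Xsub1 K.
have nE' := simx_size sM; have [_ h2] := hmx_lblock0 sM h0.
have [_ uM2] := simx_lblock_unit sM uM.
have [m' mE] : exists m', m = (2 + m'.+1)%N by exists (m - 3)%N; lia.
have [k' kE] : exists k', k = (2 + k'.+1)%N by exists (k - 3)%N; lia.
have sE : s = (m'.+1 + k'.+1)%N by lia.
have s1 : (size ('X - 1 : {poly K})).-1 = 1%N by rewrite -polyC1 size_XsubC.
have one x : x = ((size ('X - 1 : {poly K})%R).-1 * x)%N by rewrite s1 mul1n.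
have [P2 [N2 [e' [lu2 hP2 hN2]]]] := @primary_split K s _ _ m'.+1 k'.+1 M2 _ e ip mp uM2 h2 sE (one _) (one _).
have [Y [Z lu]] := LUsim_block X lu1 lu2.
have {}lu := LUsim_sim sM lu.
subst m k; apply: (LU_split sp uM _ lu).
- by rewrite e0 (unipotent_det h0).
- by rewrite (@det_lblock _ 2 k'.+1) dN1 (unipotent_det hN2) mulr1 d1.
- exact: (@inprod_phi6 K 2 m'.+1 _ _ _ e').
exact: (@inprod_phi6 K 2 k'.+1 _ _ _ e').
Qed.

Lemma phi6_inv (N : 'M[K]_2) : N \in unitmx -> cycp N (phi6 K) -> hmx (invmx N) (phi6 K) = 0.
Proof.
move=> uN cN; have [mp sp] := phi6_monic K.
by have := cycp_hmx0 (cycp_invmx uN cN); rewrite recip_quadratic // phi6_coef0.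
Qed.

(** Both sides have room for a [phi6] block and a nonempty unipotent rest, so a 4 x 4 piece has to
    split into two [phi6] blocks: a chain of length 4 if the cube of [M - 1] is nonzero, otherwise
    two chains of length 2. *)
Lemma inprod_unipotent_large n (M : 'M[K]_n.+1) e m k a b a' b' :
  cyclic_split m k a b a' b' -> n.+1 = (m + k)%N -> M \in unitmx -> (3 <= m)%N -> (3 <= k)%N ->
  (a * b)`_0 * (a' * b')`_0 = 1 -> hmx M (('X - 1) ^+ e) = 0 -> b`_0 * b'`_0 = 1 ->
  (3 <= \rank (M - 1%:M)%R)%N -> inprod (a * b) (a' * b') M.
Proof.
move=> sp nE uM m3 k3 e0 h0 d1 r3.
have [N1 cN1 dN1] := exists_phi6 K; have hN1 := cycp_hmx0 cN1.
have uN1 : N1 \in unitmx by rewrite unitmxE dN1 unitr1.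
have [R3|R3] := eqVneq ((M - 1%:M) ^+ 3) 0; last first.
  have [s [X [M2 [sM h2 nE']]]] := simx_unipotent_chain h0 R3.
  have c4 := @cycp_Xsub1_exp K 4; have s4 : (size (('X - 1) ^+ 4 : {poly K})).-1 = (2 + 2)%N.
    by rewrite size_Xsub1_exp.
  move: (companionmx _) X sM c4; rewrite s4 => C4 X sM c4.
  apply: (unipotent_finish sp nE uM m3 k3 e0 h0 d1 sM (P1 := N1) (N1 := N1)) => //.
  apply: (LUsim_cycp _ _ _ c4 cN1 cN1) => //.
    by rewrite coef0_Xsub1_exp phi6_coef0 mulr1 -signr_odd.
  by rewrite phi6_coef0 oner_neq0.
set R := M - 1%:M in r3 R3 *.
have R3' : R *m R *m R = 0 by rewrite -[RHS]R3 !exprS expr0 mulr1 -!mulmxE mulmxA.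
(* This dimension is at least [rank R - rank R^2] by counting kernels, and at least [rank R^2]
   because [R^3 = 0]; its double is at least 3. *)
have rk : (2 <= \rank (kermx (R *m R) *m R))%N.
  have l1 := mxrank_mul_ker (kermx (R *m R)) R; have l2 := mxrankS (capmxSr (kermx (R *m R)) (kermx R)).
  have := mxrank_ker R; have := mxrank_ker (R *m R) => e1 e2; rewrite e1 in l1; rewrite e2 in l2.
  have l3 : (\rank (R *m R) <= \rank (kermx (R *m R) *m R))%N.
    by rewrite mxrankS // submxMr //; apply/sub_kermxP; rewrite mulmxA.
  have l4 := rank_leq_row R; have l5 := rank_leq_row (R *m R).
  move: r3 l1 l2 l3 l4 l5; clear.
  move: (\rank R) (\rank (R *m R)) (\rank (_ *m R)) (\rank (_ :&: _)%MS) => x y z t; lia.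
have [S fS] := exists_free_rows rk.
pose W := S *m kermx (R *m R).
have WR2 : W *m R *m R = 0 by rewrite -(mulmxA W) -(mulmxA S) mulmx_ker mulmx0.
have fWR : row_free (W *m R) by rewrite /W -mulmxA.
have MR : M = 1%:M + R by rewrite /R addrC subrK.
have WM : W *m M = W + W *m R by rewrite MR mulmxDr mulmx1.
pose U := col_mx W (W *m M).
pose M1 : 'M[K]_(2 + 2) := block_mx 0 1%:M (- 1)%:M 2%:M.
have UM : U *m M = M1 *m U.
  rewrite /U mul_col_mx /M1 mul_block_col !mul_scalar_mx mul0mx scale1r add0r; congr (col_mx _ _).
  have RM : W *m R *m M = W *m R by rewrite MR mulmxDr mulmx1 WR2 addr0.
  rewrite {1}WM mulmxDl RM WM scaleN1r -[2]/(1 + 1) scalerDl scale1r.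
  by apply/matrixP => i j; rewrite !mxE; ring.
have fU : row_free U.
  apply: row_free_inj0 => r; rewrite -[r]hsubmxK mul_row_col WM; move: (lsubmx r) (rsubmx r) => r1 r2 h.
  have e1 : (r1 + r2) *m (W *m R) = 0.
    have := congr1 (fun z => z *m R) h; rewrite mul0mx mulmxDl mulmxDr !mulmxDl.
    by rewrite -!(mulmxA r2) WR2 mulmx0 addr0 !mulmxA.
  have e2 : r1 + r2 = 0 by apply: (row_free_inj fWR); rewrite e1 mul0mx.
  have e3 : r2 = 0.
    apply: (row_free_inj fWR); rewrite mul0mx -[RHS]h mulmxDr addrA -mulmxDl e2 mul0mx add0r //.
  by move: e2; rewrite e3 addr0 => ->; rewrite row_mx0.
have [s [X [M2 sM]]] := simx_submodule fU UM.
apply: (unipotent_finish sp nE uM m3 k3 e0 h0 d1 sM (P1 := invmx N1) (N1 := N1)) => //; last exact: phi6_inv.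
have := LUsim_quadratic 2 1 uN1; rewrite scale1r; exact.
Qed.

Lemma inprod_unipotent_primary n (M : 'M[K]_n.+1) e m k a b a' b' :
  cyclic_split m k a b a' b' -> n.+1 = (m + k)%N -> M \in unitmx -> (4 <= n.+1)%N ->
  (a * b)`_0 * (a' * b')`_0 = 1 -> mxminpoly M = ('X - 1) ^+ e -> mxminpoly M != char_poly M ->
  M != 1%:M -> inprod (a * b) (a' * b') M.
Proof.
move=> sp nE uM n4 e0 mM nc M1.
have h0 : hmx M (('X - 1) ^+ e) = 0 by rewrite -mM; apply: mx_root_minpoly.
have R0 : M - 1%:M != 0 by rewrite subr_eq0.
have [d1|d1] := eqVneq (b`_0 * b'`_0) 1; last first.
  exact: inprod_unipotent_det sp nE uM e0 h0 R0 d1.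
have d2 : a`_0 * a'`_0 = 1 by move: e0; rewrite !coef0M mulrACA d1 mulr1.
have [R2|R2] := eqVneq ((M - 1%:M) ^+ 2) 0.
  by apply: (inprod_unipotent_square sp nE n4 e0) => //; rewrite mulmxE -expr2.
have Re : (M - 1%:M) ^+ e = 0 by rewrite -hmx_Xsub1_exp.
have rR1 : (1 < \rank (M - 1%:M)%R)%N.
  have := rank_nilpotent (j := 1) Re; rewrite expr1 => /(_ R0); apply: leq_trans.
  by rewrite ltnS lt0n mxrank_eq0.
have [rR|rR] := eqVneq (\rank (M - 1%:M)%R) 2.
  have R3 : (M - 1%:M) ^+ 3 = 0.
    apply/eqP; rewrite -mxrank_eq0; have := rank_nilpotent (j := 1) Re; rewrite expr1 => /(_ R0).
    by have := rank_nilpotent (j := 2) Re R2; rewrite rR; lia.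
  apply: (inprod_rank2 rR _ _ n4).
  - by rewrite mulmxE -expr2.
  - by rewrite !mulmxE -expr2 -exprSr.
  exact: (cyclic_split_admissible sp nE e0 (oner_neq0 K)).
have r3 : (3 <= \rank (M - 1%:M)%R)%N by rewrite ltn_neqAle eq_sym rR.
have rk : (1 < \rank (kermx (M - 1%:M)))%N.
  have := noncyclic_rank_ker mM nc; rewrite hmx_Xsub1 -polyC1 size_XsubC; exact.
have n5 : (5 <= n.+1)%N.
  have := mxrank_ker (M - 1%:M); move: rk r3; move: (\rank _) (\rank (kermx _)) => x y; lia.
have [/andP[m0 k0] _ _ _ _] := sp.
have sp' := cyclic_split_sym sp.
have nE' : n.+1 = (k + m)%N by rewrite addnC.
have e0' : (b * a)`_0 * (b' * a')`_0 = 1 by rewrite [b * a]mulrC [b' * a']mulrC.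
have swap : inprod (b * a) (b' * a') M -> inprod (a * b) (a' * b') M.
  by rewrite [b * a]mulrC [b' * a']mulrC.
have [m3|m3] := leqP 3 m; last first.
  have [mE|mE] : m = 1 \/ m = 2 by lia.
    by subst m; apply: (inprod_unipotent_left1 sp nE uM n4 e0 h0 R2 d1).
  by subst m; apply: (inprod_unipotent_left2 sp nE uM n5 e0 h0 R2 rk d1).
have [k3|k3] := leqP 3 k; last first.
  apply: swap; have [kE|kE] : k = 1 \/ k = 2 by lia.
    by subst k; apply: (inprod_unipotent_left1 sp' nE' uM n4 e0' h0 R2 d2).
  by subst k; apply: (inprod_unipotent_left2 sp' nE' uM n5 e0' h0 R2 rk d2).
exact: inprod_unipotent_large sp nE uM m3 k3 e0 h0 d1 r3.
Qed.

(** Dividing [M] and the first factor by the eigenvalue [l] leads to the unipotent case; the second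
    class is untouched. *)
Lemma inprod_linear_primary n (M : 'M[K]_n.+1) l e m k a b a' b' :
  cyclic_split m k a b a' b' -> n.+1 = (m + k)%N -> M \in unitmx -> (4 <= n.+1)%N ->
  (a * b)`_0 * (a' * b')`_0 = \det M -> mxminpoly M = ('X - l%:P) ^+ e ->
  mxminpoly M != char_poly M -> ~~ is_scalar_mx M -> inprod (a * b) (a' * b') M.
Proof.
move=> sp nE uM n4 e0 mM nc nsc.
have h0 : hmx M (('X - l%:P) ^+ e) = 0 by rewrite -mM; apply: mx_root_minpoly.
have l0 : l != 0.
  apply: contraTneq uM => z; have := @nilpotent_not_unit K n.+1 M ('X - l%:P) e isT h0.
  by rewrite z subr0 hmxX.
have li0 : l^-1 != 0 by rewrite invr_eq0.
set c := l^-1 in li0; pose M1 := c *: M.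
have [? [ma mb ma' mb'] [sa sb sa' sb'] cab cab'] := sp.
have sp1 : cyclic_split m k (scalep c a) (scalep c b) a' b'.
  by split; rewrite ?scalep_monic ?size_scalep ?coprimep_scalep.
have uM1 : M1 \in unitmx by rewrite unitmxE detZ unitrM unitrX ?unitfE //= -unitfE -unitmxE.
have cfm : scalep c (a * b) = scalep c a * scalep c b by apply: scalepM.
have sab : size (a * b) = n.+2 by rewrite size_mul ?monic_neq0 // sa sb addSn addnS nE.
have hM1 f : hmx M1 (scalep c f) = c ^+ (size f).-1 *: hmx M f.
  by rewrite hmxZ hmx_scale.
have e1 : (scalep c a * scalep c b)`_0 * (a' * b')`_0 = \det M1.
  by rewrite -cfm scalep_coef0 sab /= -mulrA e0 detZ.
have scX j : scalep c (('X - l%:P) ^+ j) = ('X - 1) ^+ j.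
  elim: j => [|j IH]; first by rewrite /scalep !expr0 size_poly1 /= scale1r comp_polyC.
  rewrite !exprS scalepM ?monicXsubC ?monic_exp ?monicXsubC // IH; congr (_ * _).
  rewrite /scalep size_XsubC expr1 comp_polyB comp_polyX comp_polyC scalerBr scalerA.
  by rewrite divff // scale1r -mul_polyC -polyCM mulVf.
have hN1 : hmx M1 (('X - 1) ^+ e) = 0 by rewrite -scX hM1 h0 scaler0.
have mM1 : mxminpoly M1 = ('X - 1) ^+ e.
  apply/eqP; rewrite -eqp_monic ?mxminpoly_monic ?monic_exp //; last by case: (irreducible_Xsub1 K).
  rewrite /eqp (mxminpoly_min hN1) /=.
  have [q qE] : exists q, mxminpoly M1 = scalep c q.
    by exists (scalep l (mxminpoly M1)); rewrite /c -{2}[l]invrK scalepK.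
  have mq : q \is monic.
    have -> : q = scalep l (mxminpoly M1) by rewrite qE /c scalepK.
    by rewrite scalep_monic ?mxminpoly_monic.
  have : hmx M q = 0.
    have := mx_root_minpoly M1; rewrite -[horner_mx _ _]/(hmx M1 (mxminpoly M1)) qE hM1 => /eqP.
    by rewrite scaler_eq0 expf_eq0 (negbTE li0) andbF => /eqP.
  move=> /mxminpoly_min; rewrite mM => /dvdpP[r rE].
  rewrite qE rE.
  have r0 : r != 0 by apply: contraNneq (monic_neq0 mq) => z; rewrite rE z mul0r.
  by rewrite /scalep comp_polyM -scX /scalep dvdpZl ?expf_neq0 // dvdpZr ?expf_neq0 // dvdp_mull.
have nc1 : mxminpoly M1 != char_poly M1.
  apply: contra nc => /eqP h; have := congr1 (fun p : {poly K} => size p) h.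
  rewrite mM1 size_char_poly size_Xsub1_exp => -[en].
  rewrite -eqp_monic ?mxminpoly_monic ?char_poly_monic // -dvdp_size_eqp ?mxminpoly_dvd_char //.
  by rewrite mM size_exp_XsubC size_char_poly en.
have ns1 : M1 != 1%:M.
  apply: contra nsc => /eqP h; apply/is_scalar_mxP; exists l.
  by rewrite -[l]mulr1 -scale_scalar_mx -h /M1 scalerA mulfV // scale1r.
have d1 : \det M1 = 1 by apply: unipotent_det hN1.
rewrite d1 in e1.
have ip := inprod_unipotent_primary sp1 nE uM1 n4 e1 mM1 nc1 ns1.
have := inprod_scale l0 ip; rewrite -cfm /M1 scalerA /c mulfV // scale1r.
by rewrite scalepK.
Qed.

End UnipotentAssembly.

(** * Primary matrices with a nonlinear irreducible factor *)

Section NonlinearPrimary.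

Variable K : fieldType.

Lemma inprod_det n (N : 'M[K]_n) f f' : inprod f f' N -> \det N = f`_0 * f'`_0.
Proof.
move=> [X [Y [-> cX cY]]]; rewrite det_mulmx (cycp_det cX) (cycp_det cY).
by rewrite mulrACA sqr_sign mul1r.
Qed.

Lemma irreducible_noroot (p : {poly K}) c : irreducible_poly p -> (2 < size p)%N -> p.[c] != 0.
Proof.
move=> [_ ip] sp; apply/negP => /eqP pc.
have := ip ('X - c%:P); rewrite size_XsubC dvdp_XsubCl /root pc eqxx => /(_ isT isT).
by move/eqp_size; rewrite size_XsubC => e; rewrite -e in sp.
Qed.

(** The remainders of [m] and [k] modulo [d] add up to [d]: one block of size [d] is cut into
    [d - r] and [r], the others stay whole. *)
Lemma split_residue m k d l s : (0 < d)%N -> (m + k = d * l)%N -> (m + k = d + s)%N ->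
  ~~ (d %| k)%N ->
  exists r, exists u, exists v,
    [/\ (0 < r)%N, (r < d)%N, m = ((d - r) + d * u)%N, k = (r + d * v)%N
      & s = (d * u + d * v)%N].
Proof.
move=> d0 nl ns ndv.
have r0 : (0 < k %% d)%N by rewrite lt0n; move: ndv; rewrite /dvdn.
have rd : (k %% d < d)%N by rewrite ltn_mod.
have kE : k = (k %% d + d * (k %/ d))%N by rewrite {1}(divn_eq k d) addnC mulnC.
have vl : (k %/ d < l)%N.
  by rewrite ltnNge; apply/negP => lv; have := leq_mul (leqnn d) lv; lia.
have dE : (d * l = d * (k %/ d) + d + d * (l - (k %/ d).+1))%N.
  by rewrite -mulnSr -mulnDr subnKC.
by exists (k %% d)%N, (l - (k %/ d).+1)%N, (k %/ d)%N; split=> //; lia.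
Qed.

(** A nonzero polynomial of degree below that of [p] is coprime to [p], so beside a nonempty rest a
    binomial with the constant dictated by [beta] will do. Without a rest [inprod_cyclic] has to
    choose the polynomial. *)
Lemma exists_side r s (N2 : 'M[K]_s) p e (f f' : {poly K}) beta :
  irreducible_poly p -> (0 < r)%N -> (r < (size p).-1)%N -> hmx N2 (p ^+ e) = 0 ->
  \det N2 != 0 -> admissible (r + s) f f' beta ->
  exists c : {poly K}, [/\ c \is monic, size c = r.+1, (-1) ^+ r * c`_0 * \det N2 = beta
    & forall (N1 : 'M[K]_r) Z, cycp N1 c -> inprod f f' (block_mx N1 0 Z N2)].
Proof.
move=> ip r0 rp h2 d2 ad; have [s0|s0] := posnP s.
  subst s; rewrite addn0 in ad.
  have [c [N cN ipN]] := inprod_cyclic r0 ad; have mc : c \is monic by case: cN.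
  exists c; split=> //; first exact: cycp_size cN.
    by rewrite det_mx00 mulr1 -(cycp_det cN) (inprod_det ipN); case: ad => _ _ _ _ [].
  move=> N1 Z cN1; apply: inprod_sim ipN.
  exact: simx_trans (cycp_transport cN cN1) (simx_sym (simx_lblock_empty _ _ _)).
have [mc sc c0] := XnaddC ((-1) ^+ r * beta / \det N2) r0.
set c := 'X^r + _ in mc sc c0.
have e1 : (-1) ^+ r * c`_0 * \det N2 = beta by rewrite c0 !mulrA sqr_sign mul1r divfK.
exists c; split=> // N1 Z cN1.
apply: (@inprod_side K r s N1 N2 Z c p e f f' r0 (cycp_hmx0 cN1) h2).
- by rewrite coprimep_sym coprimep_irr ?monic_neq0 // sc -ltn_predRL.
- by rewrite (cycp_det cN1) e1.
by move=> z; rewrite z in s0.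
Qed.

Lemma cyclic_split_neq0 m k (a b a' b' : {poly K}) d : cyclic_split m k a b a' b' ->
  (a * b)`_0 * (a' * b')`_0 = d -> d != 0 ->
  [/\ a`_0 != 0, b`_0 != 0, a'`_0 != 0 & b'`_0 != 0].
Proof.
by move=> _ <-; rewrite !coef0M !mulf_eq0 !negb_or => /andP[/andP[? ?] /andP[? ?]].
Qed.

Lemma inprod_primary_nondvd n (M : 'M[K]_n) p e m k a b a' b' :
  cyclic_split m k a b a' b' -> n = (m + k)%N -> M \in unitmx ->
  (a * b)`_0 * (a' * b')`_0 = \det M -> irreducible_poly p -> p \is monic ->
  hmx M (p ^+ e) = 0 -> ~~ ((size p).-1 %| k)%N -> inprod (a * b) (a' * b') M.
Proof.
move=> sp nE uM e0 ip mp h0 ndv.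
have dM : \det M != 0 by rewrite -unitfE -unitmxE.
have [a0 b0 a'0 b'0] := cyclic_split_neq0 sp e0 dM.
have [/andP[m0 k0] [ma mb ma' mb'] [sa sb sa' sb'] cab cab'] := sp.
have n0 : (0 < n)%N by rewrite nE addn_gt0 m0.
have [s [X [M2 [sM h2]]]] := simx_irreducible ip mp n0 h0.
have nE' := simx_size sM; have [uC uM2] := simx_lblock_unit sM uM.
set d := (size p).-1 in ndv nE'.
have d0 : (0 < d)%N by rewrite /d -subn1 subn_gt0; case: ip.
have [l nl] := primary_dim ip mp h0; rewrite -/d in nl.
have [r [u [v [r0 rd mE kE sE]]]] := split_residue d0 (etrans (esym nE) nl) (etrans (esym nE) nE') ndv.
have [P2 [N2 [e' [lu2 hP2 hN2]]]] := primary_split ip mp uM2 h2 sE erefl erefl.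
have dM2 := LUsim_det lu2.
have [dP2 dN2] : \det P2 != 0 /\ \det N2 != 0.
  by apply/andP; rewrite -negb_or -mulf_eq0 -dM2 -unitfE -unitmxE.
subst m k.
have drd : (d - r < d)%N by rewrite ltn_subrL r0.
have dr0 : (0 < d - r)%N by rewrite subn_gt0.
have [q [mq sq q0 hq]] : exists q : {poly K}, [/\ q \is monic, size q = (d - r).+1,
    (-1) ^+ (d - r) * q`_0 * \det P2 = a`_0 * a'`_0
    & forall (N1 : 'M[K]_(d - r)) Z, cycp N1 q -> inprod a a' (block_mx N1 0 Z P2)].
  by apply: (exists_side ip dr0 drd hP2 dP2); split=> //; split=> //; apply: mulf_neq0.
have [c [mc sc c0 hc]] : exists c : {poly K}, [/\ c \is monic, size c = r.+1,
    (-1) ^+ r * c`_0 * \det N2 = b`_0 * b'`_0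
    & forall (N1 : 'M[K]_r) Z, cycp N1 c -> inprod b b' (block_mx N1 0 Z N2)].
  by apply: (exists_side ip r0 rd hN2 dN2); split=> //; split=> //; apply: mulf_neq0.
have [P1 cP1] := exists_cycp mq sq; have [N1 cN1] := exists_cycp mc sc.
have cC := cycp_companion mp.
have c00 : c`_0 != 0.
  apply: contra_eqN c0 => /eqP ->; rewrite mulr0 mul0r eq_sym; exact: mulf_neq0.
(* Both constants are already fixed by the determinants of the two sides; they fit because the
   determinant of [M] is the product of all. *)
have pqc : p`_0 = q`_0 * c`_0.
  have sg : (-1) ^+ (d - r) * (-1) ^+ r != 0 :> K by rewrite mulf_neq0 ?signr_eq0.
  apply: (mulfI sg); apply: (mulIf (mulf_neq0 dP2 dN2)).
  rewrite -[in LHS]exprD subnK ?(ltnW rd) // -(cycp_det cC) -[in LHS]dM2 -(det_lblock _ X) -(simx_det sM).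
  rewrite -e0 !coef0M mulrACA -q0 -c0; ring.
have lu1 : LUsim (companionmx p) P1 N1.
  apply: (LUsim_cycp dr0 r0 _ cC cP1 cN1 pqc c00).
  by rewrite -/d subnK // ltnW.
have [Y [Z lu]] := LUsim_block X lu1 lu2.
have {}lu := LUsim_sim sM lu.
apply: (LU_split sp uM e0 lu).
- by rewrite det_lblock (cycp_det cN1).
- by move=> _; apply: hq.
by move=> _; apply: hc.
Qed.

End NonlinearPrimary.

(** * Irreducible factors whose degree divides both sizes *)

Section DivisiblePrimary.

Variable K : fieldType.

Lemma split_multiple m k d l : (0 < d)%N -> (0 < m)%N -> (0 < k)%N -> (m + k = d * l)%N ->
  (d %| k)%N ->
  exists u, exists v, [/\ m = (d + d * u)%N & k = (d + d * v)%N].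
Proof.
move=> d0 m0 k0 nl /dvdnP[v kE]; have /dvdnP[u mE] : (d %| m)%N.
  by rewrite -(dvdn_addl _ (n := k)) ?nl ?dvdn_mulr // kE dvdn_mull.
case: u mE => [|u] mE; first by rewrite mE in m0.
case: v kE => [|v] kE; first by rewrite kE in k0.
by exists u, v; rewrite mE kE !mulSn ![(_ * d)%N]mulnC.
Qed.

(** With [d] the degree of [p], there are at least two companion blocks; one is cut into [d - 1] and
    1, the other into 1 and [d - 1]. On each side the entry of size 1 is no eigenvalue of the block
    of size [d - 1], nor a root of [p]. As [d - 1] is at least 2, a constant term and one more value
    can be prescribed. *)
Lemma inprod_primary_dvd n (M : 'M[K]_n) p e m k a b a' b' :
  cyclic_split m k a b a' b' -> n = (m + k)%N -> M \in unitmx ->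
  (a * b)`_0 * (a' * b')`_0 = \det M -> irreducible_poly p -> p \is monic ->
  hmx M (p ^+ e) = 0 -> ((size p).-1 %| k)%N -> (3 < size p)%N -> inprod (a * b) (a' * b') M.
Proof.
move=> sp nE uM e0 ip mp h0 dv s3.
have dM : \det M != 0 by rewrite -unitfE -unitmxE.
have [a0 b0 a'0 b'0] := cyclic_split_neq0 sp e0 dM.
have [/andP[m0 k0] _ _ _ _] := sp.
have n0 : (0 < n)%N by rewrite nE addn_gt0 m0.
have [s [X [M2 [sM h2]]]] := simx_irreducible ip mp n0 h0.
have nE' := simx_size sM; have [uC uM2] := simx_lblock_unit sM uM.
have [l nl] := primary_dim ip mp h0.
have [d1 dE] : exists d1, (size p).-1 = d1.+3 by exists (size p - 4)%N; move: (size p) s3; clear; lia.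
have cC := cycp_companion mp.
move: (companionmx p) cC X sM nE' nl dv uC; rewrite dE => C cC X sM nE' nl dv uC.
have [u [v [mE kE]]] := split_multiple (ltn0Sn _) m0 k0 (etrans (esym nE) nl) dv.
have sE : s = (d1.+3 + (d1.+3 * u + d1.+3 * v))%N.
  by move: nE nE' mE kE; clear; move: (d1.+3 * u)%N (d1.+3 * v)%N; lia.
have s0 : (0 < s)%N by rewrite sE.
have [s' [X' [M3 [sM2 h3]]]] := simx_irreducible ip mp s0 h2.
have sE' := simx_size sM2; have [_ uM3] := simx_lblock_unit sM2 uM2.
move: (companionmx p) (cycp_companion mp) X' sM2 sE'; rewrite dE => C' cC' X' sM2 sE'.
have s'E : s' = (d1.+3 * u + d1.+3 * v)%N by move: sE sE'; clear; lia.
have [P3 [N3 [e' [lu3 hP3 hN3]]]] := @primary_split K _ _ _ u v _ _ _ ip mp uM3 h3 s'E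
   (congr1 (muln^~ u) (esym dE)) (congr1 (muln^~ v) (esym dE)).
have dM3 := LUsim_det lu3.
have [dP3 dN3] : \det P3 != 0 /\ \det N3 != 0.
  by apply/andP; rewrite -negb_or -mulf_eq0 -dM3 -unitfE -unitmxE.
have p0 : p`_0 != 0 by rewrite -horner_coef0; apply: irreducible_noroot ip _; apply: ltnW.
set beta := b`_0 * b'`_0.
have be0 : beta != 0 by apply: mulf_neq0.
have [nu [mnu snu nu0 nu1]] :=
  @exists_monic_value K d1.+2 ((-1) ^+ d1.+2 * beta / \det N3) 1 isT (oner_neq0 K).
have nu00 : nu`_0 != 0 by rewrite nu0; apply: mulf_neq0; [apply: mulf_neq0; rewrite ?signr_eq0|rewrite invr_eq0].
(* [nu] carries the determinant of the lower side; the entry [c] is then forced by the constant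
   coefficient of [p]. *)
pose c := - p`_0 / nu`_0.
have c0 : c != 0 by apply: mulf_neq0; rewrite ?oppr_eq0 ?invr_eq0.
have [q [mq sq q0 qc]] := @exists_monic_value K d1.+2 (- p`_0) c isT c0.
have [P1 cP1] := exists_cycp mq sq; have [N2 cN2] := exists_cycp mnu snu.
have lu1 : LUsim C P1 (1%:M : 'M_1).
  apply: (LUsim_cycp _ _ _ cC cP1 (cycp_scalar1 _)) => //; first by rewrite addn1.
    by rewrite coefB coefX coefC /= sub0r q0 mulrNN mulr1.
  by rewrite coefB coefX coefC /= sub0r oppr_eq0 oner_eq0.
have lu2 : LUsim C' (c%:M : 'M_1) N2.
  apply: (LUsim_cycp _ _ _ cC' (cycp_scalar1 _) cN2) => //.
  by rewrite coefB coefX coefC /= sub0r /c mulNr divfK // opprK.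
have [Y [Z lu23]] := LUsim_block X' lu2 lu3.
have {}lu23 := LUsim_sim sM2 lu23.
have [Y' [Z' lu]] := LUsim_block X lu1 lu23.
have {}lu := LUsim_sim sM lu.
have mE' : m = (d1.+2 + (1 + d1.+3 * u))%N by rewrite mE; clear; lia.
have kE' : k = (1 + (d1.+2 + d1.+3 * v))%N by rewrite kE; clear; lia.
clear mE kE; subst m k.
have noroot x : p.[x] != 0 by apply: irreducible_noroot ip _; apply: ltnW.
apply: (LU_split sp uM e0 lu).
- rewrite !det_lblock det1 mul1r (cycp_det cN2) nu0 -/beta.
  by move: ((-1) ^+ d1.+2) (sqr_sign K d1.+2) => x xx; rewrite -[RHS]mul1r -xx; field.
- move=> ad; apply: (inprod_coprime _ _ (simx_refl _) _ (cycp_hmx0 cP1) (hmx_lblock0M Y (hmx_scalar1 c) hP3)) => //.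
  rewrite coprimepMr; apply/andP; split.
    by rewrite coprimep_sym; apply: coprimep_XsubCl; rewrite qc oner_neq0.
  apply: coprimep_expr; rewrite coprimep_sym coprimep_irr ?monic_neq0 // sq -dE.
  by move: (size p) s3; clear; lia.
move=> ad; apply: (inprod_coprime _ _ (simx_refl _) _ (hmx_scalar1 1) (hmx_lblock0M Z (cycp_hmx0 cN2) hN3)) => //.
rewrite coprimepMr; apply/andP; split; first by apply: coprimep_XsubCl; rewrite nu1 oner_neq0.
by apply: coprimep_expr; apply: coprimep_XsubCl.
Qed.

(** The kernel of [p(M)] is a vector space over the field [K[x]/(p)], and the rank bound gives two
    vectors independent over it. *)
Lemma quadratic_pair n (M : 'M[K]_n) p : irreducible_poly p -> p \is monic -> size p = 3 ->
  (2 < \rank (kermx (hmx M p)))%N ->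
  exists s, exists X, exists M2 : 'M[K]_s,
    simx M (block_mx (block_mx 0 1%:M (- p`_0)%:M (- p`_1)%:M : 'M_(2 + 2)) 0 X M2).
Proof.
move=> ip mp sp rk.
have [u1 u1k u1n] := not_all_submx (0 : 'M[K]_(0, n)) (ltnW (ltnW rk)).
have u10 : u1 != 0 by apply: contraNneq u1n => ->; apply: sub0mx.
have [u2 u2k u2n] := not_all_submx (col_mx u1 (u1 *m M)) rk.
have u1p : u1 *m hmx M p = 0 by apply/sub_kermxP.
have u2p : u2 *m hmx M p = 0 by apply/sub_kermxP.
have lin (v : 'rV[K]_n) x y : v *m hmx M (x%:P + y%:P * 'X) = x *: v + y *: (v *m M).
  by rewrite hmxD hmxM !hmxC hmxX mulmxDr mul_mx_scalar mul_scalar_mx -scalemxAr.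
have cop (h : {poly K}) : (size h <= 2)%N -> h != 0 -> coprimep p h.
  by move=> sh h0; apply: coprimep_irr; rewrite // sp.
have pE := monic_quadratic mp sp.
have sq (v : 'rV[K]_n) : v *m hmx M p = 0 -> v *m M *m M = - p`_0 *: v - p`_1 *: (v *m M).
  rewrite pE hmxD mulmxDr lin hmxXn => /eqP; rewrite addr_eq0 -pE => /eqP.
  by rewrite expr2 -mulmxE mulmxA opprD scaleNr.
have indep (h1 h2 : {poly K}) : (size h1 <= 2)%N -> (size h2 <= 2)%N ->
    u1 *m hmx M h1 + u2 *m hmx M h2 = 0 -> h1 = 0 /\ h2 = 0.
  move=> s1 s2 h.
  have [z|h20] := eqVneq h2 0.
    split=> //; move: h; rewrite z hmx0 mulmx0 addr0 => h; apply: contrapT => /eqP h10.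
    have [[x y] /= xy] := Bezout_eq1_coprimepP _ _ (cop _ s1 h10).
    have := mulmx1 u1; rewrite -(hmx1 M) -xy hmxD mulmxDr [x * p]mulrC [y * h1]mulrC !hmxM !mulmxA.
    by rewrite u1p h !mul0mx addr0 => /esym/eqP; rewrite (negbTE u10).
  have [[x y] /= xy] := Bezout_eq1_coprimepP _ _ (cop _ s2 h20).
  case/negP: u2n.
  have -> : u2 = u1 *m hmx M (- (h1 * y)).
    rewrite -{1}[u2]mulmx1 -(hmx1 M) -xy hmxD mulmxDr [x * p]mulrC [y * h2]mulrC !hmxM !mulmxA.
    rewrite u2p mul0mx add0r hmxN mulmxN hmxM mulmxA -mulNmx; congr (_ *m _).
    by apply/eqP; rewrite -addr_eq0 addrC h.
  rewrite [- _](divp_eq _ p); set r := _ %% p.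
  rewrite hmxD mulmxDr mulrC hmxM mulmxA u1p mul0mx add0r.
  have sr : (size r <= 2)%N by have := ltn_modp (- (h1 * y)) p; rewrite -/r sp monic_neq0.
  rewrite (two_term_poly sr) lin -addsmxE.
  by rewrite addmx_sub_adds // scalemx_sub.
pose W : 'M[K]_(1 + 1, n) := col_mx u1 u2.
pose U := col_mx W (W *m M).
have WMM : W *m M *m M = - p`_0 *: W - p`_1 *: (W *m M).
  by rewrite /W !mul_col_mx !sq // !scale_col_mx opp_col_mx add_col_mx.
have UM : U *m M = (block_mx 0 1%:M (- p`_0)%:M (- p`_1)%:M : 'M_(2 + 2)) *m U.
  rewrite /U mul_block_col mul_col_mx !mul_scalar_mx mul0mx scale1r add0r WMM.
  by rewrite scaleNr [in RHS]scaleNr.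
apply: (simx_submodule (U := U)) UM; rewrite /U /W mul_col_mx; apply: row_free4 => x1 x2 y1 y2.
rewrite addrACA -!lin => /indep[||e1 e2]; try exact: size_two_term.
have c0 x y : x%:P + y%:P * 'X = 0 :> {poly K} -> x = 0 /\ y = 0.
  move=> h; have := congr1 (fun q : {poly K} => q`_0) h; have := congr1 (fun q : {poly K} => q`_1) h.
  by rewrite mul_polyC !(coefD, coefZ, coefC, coefX, coef0) /= !(mulr0, mulr1, addr0, add0r).
by have [-> ->] := c0 _ _ e1; have [-> ->] := c0 _ _ e2.
Qed.

End DivisiblePrimary.

(** * Irreducible quadratic factors, and all nonscalar matrices *)

Section QuadraticPrimary.

Variable K : fieldType.

Lemma scale_inv_lower (s d : K) Q : d != 0 ->
  exists Q', s *: invmx (block_mx 1%:M 0 Q d%:M : 'M_(1 + 1)) =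
             block_mx s%:M 0 Q' (s / d)%:M.
Proof.
move=> d0; set N := block_mx _ _ _ _.
have NZ : N *m block_mx 1%:M 0 (- d^-1 *: Q) d^-1%:M = 1%:M.
  rewrite /N mulmx_block !mul0mx !mulmx0 !mulmx1 ?mul1mx !addr0 !add0r mul_scalar_mx scalerA.
  rewrite mulrN divff // scaleN1r subrr -scalar_mxM divff //.
  by rewrite -scalar_mx_block.
have uN : N \in unitmx by case/mulmx1_unit: NZ.
exists (s *: (- d^-1 *: Q)).
have -> : invmx N = block_mx 1%:M 0 (- d^-1 *: Q) d^-1%:M.
  by rewrite -[RHS](mulKmx uN) NZ mulmx1.
by rewrite scale_block_mx scaler0 !scale_scalar_mx mulr1.
Qed.

(** [LUsim_quadratic] ties the blocks together as [N1] and [p(0) N1^-1]. Both get eigenvalues in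
    [K], which are not roots of [p], so both are coprime to a primary rest. *)
Lemma inprod_quadratic_large n (M : 'M[K]_n) p e u v m k a b a' b' :
  cyclic_split m k a b a' b' -> n = (m + k)%N -> M \in unitmx ->
  (a * b)`_0 * (a' * b')`_0 = \det M -> irreducible_poly p -> p \is monic ->
  hmx M (p ^+ e) = 0 -> size p = 3 -> (2 < \rank (kermx (hmx M p)))%N ->
  m = (2 + 2 * u.+1)%N -> k = (2 + 2 * v)%N -> inprod (a * b) (a' * b') M.
Proof.
move=> sp nE uM e0 ip mp h0 sp3 rk mE kE.
have dM : \det M != 0 by rewrite -unitfE -unitmxE.
have [a0 b0 a'0 b'0] := cyclic_split_neq0 sp e0 dM.
have [_ [ma mb ma' mb'] [sa sb sa' sb'] _ _] := sp.
have noroot x : p.[x] != 0 by apply: irreducible_noroot ip _; rewrite sp3.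
have p0 : p`_0 != 0 by rewrite -horner_coef0.
have [s [X [M2 sM]]] := quadratic_pair ip mp sp3 rk.
have nE' := simx_size sM; have [_ uM2] := simx_lblock_unit sM uM.
have [_ h2] := hmx_lblock0 sM h0.
have sE : s = (2 * u.+1 + 2 * v)%N by move: nE nE' mE kE; clear; lia.
have d2 : 2 = (size p).-1 by rewrite sp3.
have [P3 [N3 [e' [lu3 hP3 hN3]]]] := @primary_split K _ _ _ u.+1 v _ _ _ ip mp uM2 h2 sE
   (congr1 (muln^~ u.+1) d2) (congr1 (muln^~ v) d2).
have dM3 := LUsim_det lu3.
have [dP3 dN3] : \det P3 != 0 /\ \det N3 != 0.
  by apply/andP; rewrite -negb_or -mulf_eq0 -dM3 -unitfE -unitmxE.
set beta := b`_0 * b'`_0.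
have be0 : beta != 0 by apply: mulf_neq0.
pose d := beta / \det N3; have d0 : d != 0 by apply: mulf_neq0; rewrite ?invr_eq0.
(* If the lower side has no rest, [N1] must be a product by itself, and its corner is chosen for
   that. *)
have [Q ipQ] : exists Q, v = 0%N -> inprod b b' (block_mx 1%:M 0 Q d%:M : 'M[K]_(1 + 1)).
  have [v0|v0] := posnP v; last by exists 0 => z; rewrite z in v0.
  have [|Q ipQ] := @inprod_triangular K 1 1 1%:M d%:M b b' isT isT; last by exists Q.
  rewrite v0 in kE; rewrite kE in sb sb'; split=> //; split.
    rewrite det1 mul1r det_scalar1 /d; subst v.
    by rewrite [\det N3]det_mx00 divr1.
  by rewrite det1 mul1r det_scalar1.
pose N1 : 'M[K]_(1 + 1) := block_mx 1%:M 0 Q d%:M.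
have uN1 : N1 \in unitmx by rewrite unitmxE det_lblock det1 mul1r det_scalar1 unitfE.
have [Q' P1E] := scale_inv_lower p`_0 Q d0.
have lu1 := @LUsim_quadratic K 2 (- p`_1) p`_0 N1 uN1.
have [Y [Z lu]] := LUsim_block X lu1 lu3.
have {}lu := LUsim_sim sM lu.
subst m k.
have cop x y : coprimep (('X - x%:P) * ('X - y%:P)) (p ^+ e').
  by rewrite coprimepMl; apply/andP; split; apply: coprimep_expr; apply: coprimep_XsubCl.
apply: (LU_split sp uM e0 lu).
- by rewrite (@det_lblock _ 2) (@det_lblock _ 1 1) det1 mul1r det_scalar1 /d divfK.
- move=> ad.
  have h1 : hmx (p`_0 *: invmx N1) (('X - (p`_0)%:P) * ('X - (p`_0 / d)%:P)) = 0.
    rewrite P1E; apply: (@hmx_lblock0M K 1 1); exact: hmx_scalar1.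
  by apply: (inprod_coprime _ _ (simx_refl _) (cop _ _) h1 hP3).
move=> ad; have [v0|v0] := posnP v.
  subst v; apply: inprod_sim (ipQ erefl).
  exact: simx_sym (simx_lblock_empty _ _ _).
have h1 : hmx N1 (('X - 1%:P) * ('X - d%:P)) = 0.
  by apply: (@hmx_lblock0M K 1 1); apply: hmx_scalar1.
by apply: (inprod_coprime _ _ (simx_refl _) (cop _ _) h1 hN3) => //; rewrite muln_gt0.
Qed.

Lemma inprod_diag2 (x y : K) f f' : x != y -> admissible (1 + 1) f f' (x * y) ->
  inprod f f' (block_mx x%:M 0 0 y%:M : 'M_(1 + 1)).
Proof.
move=> xy ad; apply: (@inprod_coprime K _ _ 1 1 x%:M y%:M 0 _ _ f f' isT isT (simx_refl _) _
  (hmx_scalar1 x) (hmx_scalar1 y)).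
  by apply: coprimep_XsubCl; rewrite hornerXsubC subr_eq0.
by rewrite det_lblock !det_scalar1.
Qed.

Lemma inprod_one n (f : {poly K}) : f \is monic -> f`_0 != 0 -> size f = n.+1 -> recip f = f ->
  inprod f f (1%:M : 'M[K]_n).
Proof.
move=> mf f0 sf rf; have [X cX] := exists_cycp mf sf.
exists X, (invmx X); split=> //; first by rewrite mulmxV // (cycp_unit cX).
by rewrite -rf; apply: cycp_invmx (cycp_unit cX f0) cX.
Qed.

(** No rest is left, so [N1] and [p(0) N1^-1] must both be products. A diagonal [N1] with entries
    [c] and [d / c] works when these differ. If [c^2 = d] for all units, then [d = 1], and the last
    hypothesis gives characteristic 2. *)
Lemma inprod_quadratic4 (M : 'M[K]_(2 + 2)) p a b a' b' :
  cyclic_split 2 2 a b a' b' -> M \in unitmx ->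
  (a * b)`_0 * (a' * b')`_0 = \det M -> irreducible_poly p -> p \is monic ->
  size p = 3 -> (2 < \rank (kermx (hmx M p)))%N ->
  ((forall c : K, c != 0 -> c ^+ 2 = 1) -> 1 + 1 = 0 :> K) -> inprod (a * b) (a' * b') M.
Proof.
move=> sp uM e0 ip mp sp3 rk h3.
have dM : \det M != 0 by rewrite -unitfE -unitmxE.
have [a0 b0 a'0 b'0] := cyclic_split_neq0 sp e0 dM.
have [_ [ma mb ma' mb'] [sa sb sa' sb'] cab cab'] := sp.
have noroot x : p.[x] != 0 by apply: irreducible_noroot ip _; rewrite sp3.
have p0 : p`_0 != 0 by rewrite -horner_coef0.
have [s [X [M2 sM]]] := quadratic_pair ip mp sp3 rk.
have s0 : s = 0%N by have := simx_size sM; clear; lia.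
subst s; have {}sM := simx_trans sM (simx_lblock_empty _ _ _).
have sE (N1 : 'M[K]_2) : N1 \in unitmx -> LUsim M (p`_0 *: invmx N1) N1.
  by move=> uN1; apply: LUsim_sim sM (@LUsim_quadratic K 2 (- p`_1) p`_0 N1 uN1).
set d := b`_0 * b'`_0; have d0 : d != 0 by apply: mulf_neq0.
have [[c c0 c2]|all] := pselect (exists2 c : K, c != 0 & c ^+ 2 != d).
  pose N1 : 'M[K]_(1 + 1) := block_mx c%:M 0 0 (d / c)%:M.
  have uN1 : N1 \in unitmx.
    by rewrite unitmxE det_lblock !det_scalar1 mulrCA divff // mulr1 unitfE.
  have iE : p`_0 *: invmx N1 = block_mx (p`_0 / c)%:M 0 0 (p`_0 * c / d)%:M.
    apply: (scalerI (a := (p`_0)^-1)); first by rewrite invr_eq0.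
    rewrite scalerA mulVf // scale1r; apply: (can_inj (mulKmx uN1)); rewrite mulmxV //.
    rewrite scale_block_mx !scaler0 !scale_scalar_mx /N1 mulmx_block !mul0mx !mulmx0 !addr0 !add0r.
    rewrite -!scalar_mxM (scalar_mx_block 1 1 1); congr (block_mx _%:M _ _ _%:M).
      by field; rewrite c0 p0.
    by field; rewrite c0 p0 d0.
  apply: (LU_split sp uM e0 (sE _ uN1)).
  - by rewrite (@det_lblock _ 1 1) !det_scalar1 mulrCA divff ?mulr1.
  - move=> ad; rewrite iE; apply: inprod_diag2.
      apply: contra c2 => /eqP h; apply/eqP.
      have := congr1 (fun z => z * (c * d / p`_0)) h => h'.
      transitivity (p`_0 * c / d * (c * d / p`_0)); first by field; rewrite d0 p0.
      by rewrite -h'; field; rewrite c0 p0.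
    by move: ad; rewrite iE (@det_lblock _ 1 1) !det_scalar1.
  move=> ad; apply: inprod_diag2; last by move: ad; rewrite (@det_lblock _ 1 1) !det_scalar1.
  by apply: contra c2 => /eqP h; rewrite expr2 {2}h mulrCA divff // mulr1.
(* Only the field with two elements remains, where all quadratics involved are
   their own reciprocals. *)
have {}all c : c != 0 -> c ^+ 2 = d.
  by move=> c0; apply: contrapT => /eqP h; apply: all; exists c.
have d1 : d = 1 by rewrite -(all 1 (oner_neq0 K)) expr1n.
rewrite d1 in all; have ch2 := h3 all.
have K2 (t : K) : t = 0 \/ t = 1.
  have [->|t0] := eqVneq t 0; [by left|right].
  apply/eqP; rewrite -subr_eq0 -[_ == 0]orbb -mulf_eq0; apply/eqP.
  transitivity (t ^+ 2 + 1 - (1 + 1) * t); first by ring.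
  by rewrite all // ch2 mul0r subr0.
have one (x : K) : x != 0 -> x = 1 := F2_neq0 K2 (t := x).
have ab1 := F2_coprime_quadratic K2 ma mb sa sb a0 b0 cab.
have ab1' := F2_coprime_quadratic K2 ma' mb' sa' sb' a'0 b'0 cab'.
have rc (f : {poly K}) : f \is monic -> size f = 3 -> f`_0 != 0 -> recip f = f.
  by move=> mf sf f0; apply: recip_quadratic => //; apply: one.
(* Only two monic quadratics have constant term 1, so the pairs [a, b] and [a', b'] are equal or
   swapped. If equal, the identity serves as [N1]; if swapped, the inverse of a product for [b, b']
   is one for [a, a']. *)
have [e|ne] := eqVneq b`_1 b'`_1.
  have eb : b = b' by apply: (F2_quadratic K2).
  have ea : a = a'.
    apply: (F2_quadratic K2) => //; move: ab1 ab1'; rewrite -e.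
    by case: (K2 a`_1) => ->; case: (K2 a'`_1) => ->; case: (K2 b`_1) => ->; rewrite ?eqxx.
  apply: (LU_split sp uM e0 (sE 1%:M (unitmx1 _ _))).
  - by rewrite det1 -/d d1.
  - move=> _; rewrite (one _ p0) scale1r invmx1 -ea.
    by apply: inprod_one => //; apply: rc.
  move=> _; rewrite -eb.
  by apply: inprod_one => //; apply: rc.
have eab' : a = b'.
  apply: (F2_quadratic K2) => //; move: ab1 ne.
  by case: (K2 a`_1) => ->; case: (K2 b'`_1) => ->; case: (K2 b`_1) => ->; rewrite ?eqxx.
have ea'b : a' = b.
  apply: (F2_quadratic K2) => //; move: ab1' ne.
  by case: (K2 a'`_1) => ->; case: (K2 b'`_1) => ->; case: (K2 b`_1) => ->; rewrite ?eqxx.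
have [X1 cX] := exists_cycp mb sb; have [Y1 cY] := exists_cycp mb' sb'.
have uN : X1 *m Y1 \in unitmx by rewrite unitmx_mul (cycp_unit cX) // (cycp_unit cY).
have ipN : inprod b b' (X1 *m Y1) by exists X1, Y1.
apply: (LU_split sp uM e0 (sE _ uN)).
- exact: inprod_det ipN.
- move=> _; rewrite (one _ p0) scale1r eab' ea'b.
  by have := inprod_invmx b0 b'0 ipN; rewrite !rc.
by move=> _.
Qed.

Lemma inprod_nonlinear_primary n (M : 'M[K]_n.+1) p e m k a b a' b' :
  cyclic_split m k a b a' b' -> n.+1 = (m + k)%N -> M \in unitmx ->
  (a * b)`_0 * (a' * b')`_0 = \det M -> irreducible_poly p -> p \is monic ->
  mxminpoly M = p ^+ e -> mxminpoly M != char_poly M -> (2 < size p)%N ->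
  (n.+1 = 4 -> (forall c : K, c != 0 -> c ^+ 2 = 1) -> 1 + 1 = 0 :> K) ->
  inprod (a * b) (a' * b') M.
Proof.
move=> sp nE uM e0 ip mp mM nc s2 h3.
have h0 : hmx M (p ^+ e) = 0 by rewrite -mM; apply: mx_root_minpoly.
have [dv|ndv] := boolP ((size p).-1 %| k)%N; last exact: inprod_primary_nondvd sp nE uM e0 ip mp h0 ndv.
have [s3|s3] := ltnP 3 (size p); first exact: inprod_primary_dvd sp nE uM e0 ip mp h0 dv s3.
have sp3 : size p = 3 by apply/eqP; rewrite eqn_leq s3.
have rk := noncyclic_rank_ker mM nc; rewrite sp3 /= in rk.
have [/andP[m0 k0] _ _ _ _] := sp.
have [l nl] := primary_dim ip mp h0; rewrite sp3 /= in nl dv.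
have [u [v [mE kE]]] := split_multiple (isT : (0 < 2)%N) m0 k0 (etrans (esym nE) nl) dv.
case: u mE => [|u] mE; last exact: inprod_quadratic_large sp nE uM e0 ip mp h0 sp3 rk mE kE.
case: v kE => [|v] kE.
  have n3 : n = 3 by move: nE mE kE; clear; lia.
  by subst n m k; apply: inprod_quadratic4 ip mp sp3 rk (h3 erefl).
have := @inprod_quadratic_large _ M p e v 0 k m b a b' a' (cyclic_split_sym sp).
rewrite [b * a]mulrC [b' * a']mulrC; apply=> //.
by rewrite addnC.
Qed.

Lemma inprod_nonscalar n (M : 'M[K]_n.+1) m k a b a' b' :
  cyclic_split m k a b a' b' -> n.+1 = (m + k)%N -> (4 <= n.+1)%N -> M \in unitmx ->
  ~~ is_scalar_mx M -> (a * b)`_0 * (a' * b')`_0 = \det M ->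
  (n.+1 = 4 -> (forall c : K, c != 0 -> c ^+ 2 = 1) -> 1 + 1 = 0 :> K) ->
  inprod (a * b) (a' * b') M.
Proof.
move=> sp nE n4 uM nsc e0 h3.
have dM : \det M != 0 by rewrite -unitfE -unitmxE.
have ad := cyclic_split_admissible sp nE e0 dM.
have [[p [q [cpq h hp hq]]]|[p [e [ip mp mM]]]] := minpoly_cases M.
  exact: inprod_nonprimary cpq h hp hq ad.
have [c|nc] := eqVneq (mxminpoly M) (char_poly M).
  have [/andP[m0 k0] [ma mb _ _] [sa sb _ _] cab _] := sp.
  exact: inprod_of_cyclic m0 k0 ma mb sa sb cab (cyclic_cycp c) nE ad.
have [s2|s2] := ltnP 2 (size p).
  exact: inprod_nonlinear_primary sp nE uM e0 ip mp mM nc s2 h3.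
have sp2 : size p = 2 by apply/eqP; rewrite eqn_leq s2; case: ip.
have pE : p = 'X - (- p`_0)%:P.
  have p1 := monic_top mp sp2.
  apply/polyP => i; rewrite coefB coefX coefC; case: i => [|[|i]] /=.
  - by rewrite sub0r opprK.
  - by rewrite p1 subr0.
  by rewrite nth_default ?subr0 // sp2.
rewrite pE in mM; exact: inprod_linear_primary sp nE uM n4 e0 mM nc nsc.
Qed.

End QuadraticPrimary.

(** * Conjugacy classes *)

Section ConjugacyClasses.

Variable K : fieldType.

(** All units are 1 or -1, and the square of 2 being 1 gives [3 = 0], so the map from the prime
    field is onto. *)
Lemma three_element_field (K3 : forall c : K, c != 0 -> c ^+ 2 = 1) : 1 + 1 != 0 :> K ->
  exists f : {rmorphism 'F_3 -> K}, bijective f.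
Proof.
move=> two.
have all3 (y : K) : [\/ y = 0, y = 1 | y = -1].
  have [->|y0] := eqVneq y 0; first by constructor 1.
  have /eqP := K3 y y0; rewrite -subr_eq0 -[1 in X in X == 0](expr1n K 2) subr_sqr mulf_eq0.
  by rewrite subr_eq0 addr_eq0 => /orP[]/eqP ->; [constructor 2|constructor 3].
have p3 : (3 \in [pchar K])%R.
  rewrite inE /= -[3%:R]/(1 + (1 + 1)); have := K3 _ two => h.
  have : (1 + 1 - 1) * (1 + (1 + 1)) = 0 :> K.
    transitivity ((1 + 1 : K) ^+ 2 - 1); first by ring.
    by rewrite h subrr.
  by rewrite addrK mul1r => e; apply/eqP; exact: e.
pose f0 : {rmorphism 'F_3 -> pPrimeCharType p3} := GRing.in_alg (pPrimeCharType p3).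
pose f : {rmorphism 'F_3 -> K} := f0.
exists f; pose g (y : K) : 'F_3 := if y == 0 then 0 else if y == 1 then 1 else -1.
have fg : cancel g f.
  move=> y; rewrite /g; case: eqP => [->|y0]; first by rewrite rmorph0.
  case: eqP => [->|y1]; first by rewrite rmorph1.
  by rewrite rmorphN1; case: (all3 y).
exists g => // x; apply: (fmorph_inj f); exact: fg.
Qed.

Lemma similar_in_simx n (C X : 'M[K]_n) : similar_in unitmx C X <-> simx C X.
Proof.
split=> [[P uP]|/simx_sym/simx_conjugate[T uT ->]].
  rewrite /similar_to /= conjumx // => /eqP <-.
  by apply: (simx_unit uP); rewrite mulmxKV.
by exists (invmx T); rewrite ?unitmx_inv // /similar_to /= conjumx ?unitmx_inv // invmxK.
Qed.

Lemma simx_castmx n n' (e : n = n') (A : 'M[K]_n) : simx (castmx (e, e) A) A.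
Proof. by subst n'; rewrite castmx_id; apply: simx_refl. Qed.

(** With a nonconstant common factor [g], the product of the two polynomials divided by [g] would
    still kill both blocks, so the minimal polynomial would be too small. *)
Lemma cyclic_dblock_coprime n m k (C : 'M[K]_n.+1) (A : 'M[K]_m) (B : 'M[K]_k) :
  mxminpoly C = char_poly C -> simx C (block_mx A 0 0 B) ->
  coprimep (char_poly A) (char_poly B).
Proof.
move=> cC sC; set a := char_poly A; set b := char_poly B.
have ma : a \is monic := char_poly_monic A; have mb : b \is monic := char_poly_monic B.
have nmk : n.+1 = (m + k)%N := simx_size sC.
have ga : gcdp a b %| a := dvdp_gcdl a b; have gb : gcdp a b %| b := dvdp_gcdr a b.
set g := gcdp a b in ga gb *.
have g0 : g != 0 by rewrite gcdp_eq0 negb_and monic_neq0.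
pose h := a * (b %/ g).
have bh : b %| h.
  rewrite -(dvdp_mul2r _ _ g0) /h -mulrA divpK // mulrC dvdp_mul2r ?monic_neq0 //.
have h0 : hmx C h = 0.
  apply: (simx_hmx0 (simx_sym sC)); rewrite hmx_dblock.
  rewrite (hmx_dvd0 (p := a)) ?hmx_char ?dvdp_mulr //.
  by rewrite (hmx_dvd0 (p := b)) ?hmx_char // block_mx0.
have a0 : a != 0 := monic_neq0 ma.
have q0 : b %/ g != 0.
  by apply: contraNneq (monic_neq0 mb) => z; rewrite -(divpK gb) z mul0r.
have := dvdp_leq (mulf_neq0 a0 q0) (mxminpoly_min h0); rewrite cC size_char_poly size_mul //.
rewrite size_divp // !size_char_poly nmk addSn /= => le.
rewrite /coprimep -/g; have : (0 < size g)%N by rewrite size_poly_gt0.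
have : (size g <= k.+1)%N by rewrite -(size_char_poly B) dvdp_leq ?monic_neq0.
by move: le; clear; move: (size g) => t; lia.
Qed.

Lemma mk_cyclic_class_split n m k (Omega : set 'M[K]_n.+1) d :
  mk_cyclic_class m k Omega -> common_det Omega d ->
  exists a, exists b,
    [/\ a \is monic, b \is monic, size a = m.+1, size b = k.+1 & coprimep a b] /\
    [/\ (m + k = n.+1)%N, (a * b)`_0 = (-1) ^+ n.+1 * d & forall X, cycp X (a * b) -> Omega X].
Proof.
move=> [[C uC ->] hC] hd.
have CC : similar_in unitmx C C by apply/similar_in_simx/simx_refl.
have [_ _ cC [e [A [B sC]]]] := hC C CC.
have {}sC : simx C (block_mx A 0 0 B).
  by apply: simx_trans (simx_castmx e _); apply/similar_in_simx.
have cAB := cyclic_dblock_coprime cC sC.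
have cp : char_poly C = char_poly A * char_poly B.
  by rewrite (simx_char sC) /char_poly char_block_diag_mx det_ublock.
have cyC := cyclic_cycp cC; rewrite cp in cyC.
exists (char_poly A), (char_poly B).
split; split; rewrite ?char_poly_monic ?size_char_poly //.
  by rewrite -(hd C CC) (cycp_det cyC) mulrA sqr_sign mul1r.
by move=> X cX; apply/similar_in_simx/(cycp_transport cyC cX).
Qed.

End ConjugacyClasses.

Theorem theorem1p4 (K : fieldType) (n m : nat)
  (hn : (4 <= n.+1)%N) (hm0 : (1 <= m)%N) (hm : (m <= n.+1 - 1)%N)
  (hK : (exists f : {rmorphism 'F_3 -> K}, bijective f) -> (5 <= n.+1)%N)
  (Omega Psi : set 'M[K]_n.+1)
  (hOmega : mk_cyclic_class m (n.+1 - m)%N Omega)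
  (hPsi : mk_cyclic_class m (n.+1 - m)%N Psi)
  (dOmega dPsi : K)
  (hdOmega : common_det Omega dOmega) (hdPsi : common_det Psi dPsi) :
  forall M : 'M[K]_n.+1, M \in unitmx -> ~~ is_scalar_mx M ->
    \det M = dOmega * dPsi -> class_mul Omega Psi M.
Proof.
move=> M uM nsc dM.
have [a [b [[ma mb sa sb cab] [mk e1 hO]]]] := mk_cyclic_class_split hOmega hdOmega.
have [a' [b' [[ma' mb' sa' sb' cab'] [_ e2 hP]]]] := mk_cyclic_class_split hPsi hdPsi.
have sp : cyclic_split m (n.+1 - m)%N a b a' b'.
  by split=> //; rewrite hm0 subn_gt0 ltnS; move: hm; rewrite subn1.
have e0 : (a * b)`_0 * (a' * b')`_0 = \det M.
  by rewrite e1 e2 mulrACA sqr_sign mul1r dM.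
(* The only use of the hypothesis on GF(3). *)
have h3 : n.+1 = 4 -> (forall c : K, c != 0 -> c ^+ 2 = 1) -> 1 + 1 = 0 :> K.
  move=> n4 K3; apply: contrapT => /eqP two.
  by have := hK (three_element_field K3 two); rewrite n4.
have [X [Y [-> cX cY]]] := inprod_nonscalar sp (esym mk) hn uM nsc e0 h3.
by exists X; [apply: hO|exists Y; [apply: hP|]].
Qed.
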